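(* For every $m\ge1$ and every $q$ with $m\le q\le 2m$, $$b_{0q}(m)=\frac{2^{\frac{m^2+m+2}{2}}}{\pi^m(m+2)\prod_{j=1}^{m-1}j!}\int_{Y_{2m-q}}\Big|\prod_{j=1}^m\lambda_j\Big|\,\Delta(\lambda)\,e^{-\sum_{j=1}^m\lambda_j}\,F_q(\lambda)\,d\lambda,$$ where $F_q(\lambda)=e^{(m+2)\lambda_m}$ if $q>m$ and $F_m(\lambda)=1$.
   Context: $\mathrm{Sym}(m,\mathbb C)$ is the space of complex symmetric $m\times m$ matrices, equipped with the Hilbert–Schmidt inner product $\langle H,H'\rangle=\mathrm{Tr}\,HH'^*$ and the associated Lebesgue measure $dH$; $dx$ is Lebesgue measure on $\mathbb C$. For $0\le k\le m$ let $\mathbf S_{m,k}=\{(H,x)\in\mathrm{Sym}(m,\mathbb C)\times\mathbb C:\ 2HH^*-|x|^2I\text{ has exactly }k\text{ negative eigenvalues}\}$, and define $$b_{0q}(m)=\pi^{-\binom{m+2}{2}}\int_{\mathbf S_{m,q-m}}\big|\det(2HH^*-|x|^2I)\big|\,e^{-\mathrm{Tr}\,HH^*-|x|^2}\,dH\,dx .$$ (This is the universal leading coefficient in the asymptotic expansion of the expected density of critical points of Morse index $q$ of random sections of high powers of a positive line bundle.) $Y_p=\{\lambda\in\mathbb R^m:\lambda_1>\dots>\lambda_p>0>\lambda_{p+1}>\dots>\lambda_m\}$, and $\Delta(\lambda)=\prod_{i<j}(\lambda_i-\lambda_j)$ is the Vandermonde determinant. *)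

(* Defs.v *)
From HB Require Import structures.
From mathcomp Require Import all_boot all_order all_algebra.
From mathcomp Require Import all_classical all_reals all_analysis.
From mathcomp Require Import complex.
Unset Printing Implicit Defensive.
Import Order.TTheory GRing.Theory Num.Theory.
Local Open Scope ring_scope.
Local Open Scope classical_set_scope.

Section Defs.
Variable R : realType.

Definition upd (I : eqType) (g : I -> R) (i : I) (t : R) : I -> R :=
  fun j => if j == i then t else g j.

Fixpoint iint (I : eqType) (s : seq I) (f : (I -> R) -> \bar R) (g : I -> R)
  : \bar R :=
  match s with
  | [::] => f g
  | i :: s' => (\int[@lebesgue_measure R]_(t in [set: R]) iint _ s' f (upd _ g i t))%E
  end.

(** Lebesgue integral over R^I, I finite, computed as an iterated integral
    (Tonelli: equals the integral w.r.t. the product Lebesgue measure for the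
    non-negative measurable integrands used below). *)
Definition leb_int (I : finType) (f : (I -> R) -> \bar R) : \bar R :=
  iint _ (enum I) f (fun _ => 0).

Definition leb_int_on (I : finType) (D : set (I -> R)) (f : (I -> R) -> R)
  : \bar R :=
  leb_int _ (fun g => if `[< D g >] then (f g)%:E else 0%E).

(** Real coordinates on Sym(m,C) x C: for each pair i <= j, the real and
    imaginary parts (bool false/true) of an (orthonormally rescaled) entry,
    plus the real and imaginary parts of x. *)
Definition sym_index (m : nat) := {p : 'I_m * 'I_m | (p.1 <= p.2)%N}.
Definition coord_index (m : nat) := ((sym_index m * bool) + bool)%type.

Definition sym_coord (m : nat) (g : coord_index m -> R) (i j : 'I_m) (b : bool)
  : R :=
  let p := if (i <= j)%N then (i, j) else (j, i) in
  match @insub _ (fun p : 'I_m * 'I_m => (p.1 <= p.2)%N) (sym_index m) p with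
  | Some p' => g (inl (p', b))
  | None => 0
  end.

(** The symmetric matrix H whose orthonormal coordinates (for the real inner
    product Re Tr(H H'^* )) are given by g: diagonal entries H_ii = a + i b,
    off-diagonal H_ij = H_ji = (a + i b)/sqrt 2. *)
Definition symH (m : nat) (g : coord_index m -> R) : 'M[R[i]]_m :=
  \matrix_(i < m, j < m)
    let c : R := if i == j then 1 else (Num.sqrt 2)^-1 in
    Complex (c * sym_coord m g i j false) (c * sym_coord m g i j true).

Definition xcoord (m : nat) (g : coord_index m -> R) : R[i] :=
  Complex (g (inr false)) (g (inr true)).

Definition adjmx (m : nat) (A : 'M[R[i]]_m) : 'M[R[i]]_m := map_mx Num.conj A^T.

Definition num_neg_eig (m : nat) (A : 'M[R[i]]_m) (k : nat) : Prop :=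
  exists s : seq R[i],
    char_poly A = \prod_(z <- s) ('X - z%:P) /\ count (fun z => z < 0) s = k.

Definition Mx (m : nat) (g : coord_index m -> R) : 'M[R[i]]_m :=
  2%:R *: (symH m g *m adjmx m (symH m g)) - (`|xcoord m g| ^+ 2)%:M.

Definition Sset (m k : nat) : set (coord_index m -> R) :=
  [set g | num_neg_eig m (Mx m g) k].

Definition b0q (m q : nat) : \bar R :=
  ((pi ^- 'C(m + 2, 2))%:E *
   leb_int_on _ (Sset m (q - m)%N)
     (fun g => (complex.Re `|\det (Mx m g)| *
               expR (- complex.Re (\tr (symH m g *m adjmx m (symH m g)))
                     - complex.Re (`|xcoord m g| ^+ 2)))%R))%E.

(** Y_p (0-indexed: lambda_1..lambda_m are lam 0 .. lam (m-1)) *)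
Definition Yset (m p : nat) : set ('I_m -> R) :=
  [set lam | (forall i j : 'I_m, (i < j)%N -> lam j < lam i) /\
             (forall i : 'I_m, (i < p)%N -> 0 < lam i) /\
             (forall i : 'I_m, (p <= i)%N -> lam i < 0)].

Definition vandermonde (m : nat) (lam : 'I_m -> R) : R :=
  \prod_(i < m) \prod_(j < m | (i < j)%N) (lam i - lam j).

Definition lam_at (m : nat) (lam : 'I_m -> R) (k : nat) : R :=
  match @insub _ (fun k => (k < m)%N) 'I_m k with Some i => lam i | None => 0 end.

Definition Fq (m q : nat) (lam : 'I_m -> R) : R :=
  if (m < q)%N then expR ((m + 2)%:R * lam_at m lam m.-1) else 1.

End Defs.

(* Main.v *)
(** For a symmetric matrix [H] with flat measure and a rapidly decreasing [phi], the
    spectral law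
      int prod_i phi (spec (H H^* )_i) dH
        = Cst * int_{y_1 > ... > y_m > 0} Delta(y) prod_i phi (y_i) dy
    replaces the Takagi factorization and its Jacobian. When [phi] is a polynomial
    times [exp (- s t)], both sides are determined by their moments, and integration by
    parts shows that the two families of moments satisfy the same loop equations; the
    zeroth moments are a Gaussian integral and a Selberg integral (Aomoto's recursion).
    Dominated convergence extends the law to
      phi t = ((2 t - r)^+ + z (r - 2 t)^+) exp (- t),
    and the coefficient of [z ^ k] in the product of the [phi (y_i)] is
    [|det (2 H H^* - r)| exp (- Tr H H^* )] restricted to the matrices with [k] negative
    eigenvalues. For [r = |x|^2], put [y_i = lambda_i + r / 2]; the constraint
    [y_m > 0] becomes [|x|^2 > - 2 lambda_m], and the Gaussian integral over this
    set of [x] produces [F_q]. *)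
Require Import Defs.
From HB Require Import structures.
From mathcomp Require Import all_boot all_order all_algebra.
From mathcomp Require Import all_classical all_reals all_analysis.
From mathcomp Require Import measurable_realfun complex finmap ring lra zify.
Set Implicit Arguments.
Unset Strict Implicit.
Unset Printing Implicit Defensive.
Import Order.TTheory GRing.Theory Num.Theory.
Import numFieldNormedType.Exports.
Local Open Scope ring_scope.
Local Open Scope classical_set_scope.

(** * Iterated Lebesgue integrals *)

(** Only symmetric functions of the eigenvalues are integrated, so the proof makes neither an
    ordered choice of them nor a change of variables on matrices. On the matrix side the loop
    equations come from Gaussian integration by parts against an orthonormal basis of the symmetric
    matrices, whose completeness relation has a direct and a transposed term. On the chamber they
    come from the divergence theorem, without boundary terms, because Delta vanishes on the walls
    y_i = y_j and the field on y_i = 0. Each equation lowers the total degree by one, so the zeroth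
    moment decides everything. No uniqueness theorem for a moment problem is invoked: the law holds
    for a polynomial times exp (- s t) at every rate s, and is then extended by dominated limits.
    The freedom in s matters: a factor exp (- b t) is written as exp (- c t) times an exponential
    with positive exponent, whose Taylor sums increase to it, and exp (- c t) is absorbed in the
    rate. For m = 1 the law says that da db becomes pi dt under t = a^2 + b^2. This also provides
    the integral over x, without polar coordinates. *)

Section Cfg.
Variable R : realType.

(** Cylinder sets: in the sigma-algebra that they generate, a map is measurable as soon as its
    coordinates are, which covers [upd], shifts and reindexings alike. *)
Definition coord_cyl (I : Type) : set (set (I -> R)) :=
  [set A | exists i B, measurable B /\ A = (fun g => g i) @^-1` B].

Definition cfg (I : Type) := g_sigma_algebraType (coord_cyl (I := I)).

Lemma measurable_coord (I : Type) (i : I) :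
  measurable_fun [set: cfg I] (fun g : cfg I => (g : I -> R) i).
Proof.
move=> _ B mB; rewrite setTI; apply: sub_sigma_algebra.
by exists i, B.
Qed.

Lemma measurable_to_cfg d (X : measurableType d) (I : Type) (F : X -> I -> R) :
  (forall i, measurable_fun [set: X] (fun x => F x i)) ->
  measurable_fun [set: X] (F : X -> cfg I).
Proof.
move=> mF; apply: (@measurability _ _ X (cfg I) setT F (@coord_cyl I)) => //.
move=> _ [_ [i [B [mB ->]]] <-]; rewrite setTI.
by have := mF i measurableT B mB; rewrite setTI.
Qed.

Lemma updE (I : eqType) (g : I -> R) i t j :
  upd R I g i t j = if j == i then t else g j.
Proof. by []. Qed.

Lemma updC (I : eqType) (g : I -> R) i j t u : i != j ->
  upd R I (upd R I g i t) j u = upd R I (upd R I g j u) i t.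
Proof.
move=> ij; apply/funext => k; rewrite !updE.
by case: (eqVneq k j) => [->|//]; rewrite eq_sym (negPf ij).
Qed.

Lemma measurable_upd d (X : measurableType d) (I : eqType) i
    (G : X -> I -> R) (h : X -> R) :
  measurable_fun [set: X] (G : X -> cfg I) -> measurable_fun [set: X] h ->
  measurable_fun [set: X] ((fun x => upd R I (G x) i (h x)) : X -> cfg I).
Proof.
move=> mG mh; apply: measurable_to_cfg => j; rewrite /upd; case: eqP => // _.
exact: (measurableT_comp (measurable_coord j) mG).
Qed.

End Cfg.

Section Iint.
Variable R : realType.
Local Notation leb := (@lebesgue_measure R).
Local Open Scope ereal_scope.

Lemma iint_ge0 (I : eqType) (s : seq I) (f : (I -> R) -> \bar R) g :
  (forall g, 0 <= f g) -> 0 <= iint R I s f g.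
Proof.
move=> f0; elim: s g => //= i s IH g; apply: integral_ge0 => t _; exact: IH.
Qed.

Lemma eq_iint (I : eqType) (s : seq I) (f f' : (I -> R) -> \bar R) g :
  f =1 f' -> iint R I s f g = iint R I s f' g.
Proof. by move=> /funext ->. Qed.

(** The parameter [x] is carried along so that Tonelli's theorem can exchange [iint] with an
    integral over an arbitrary outer variable. *)
Lemma measurable_iint d (X : measurableType d) (I : eqType) (s : seq I)
    (f : X -> (I -> R) -> \bar R) :
  measurable_fun [set: X * cfg R I] (fun p => f p.1 p.2) ->
  (forall x g, 0 <= f x g) ->
  measurable_fun [set: X * cfg R I] (fun p => iint R I s (f p.1) p.2).
Proof.
move=> mf f0; elim: s => [//|i s IH] /=.
pose h (q : (X * cfg R I) * measurableTypeR R) :=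
  iint R I s (f q.1.1) (upd R I q.1.2 i q.2).
have mh : measurable_fun setT h.
  pose k (q : (X * cfg R I) * measurableTypeR R) : X * cfg R I :=
    (q.1.1, upd R I q.1.2 i q.2).
  suff mk : measurable_fun setT k by exact: (measurableT_comp IH mk).
  apply/measurable_fun_pairP; split => /=.
    exact: (measurableT_comp measurable_fst measurable_fst).
  apply: measurable_upd; last exact: measurable_snd.
  exact: (measurableT_comp measurable_snd measurable_fst).
have h0 q : 0 <= h q by exact: iint_ge0.
exact: (measurable_fun_fubini_tonelli_F (m2 := leb) h mh h0).
Qed.

Lemma measurable_iint1 (I : eqType) (s : seq I) (f : (I -> R) -> \bar R) :
  measurable_fun [set: cfg R I] f -> (forall g, 0 <= f g) ->
  measurable_fun [set: cfg R I] (iint R I s f).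
Proof.
move=> mf f0.
have mk : measurable_fun setT ((fun g => (tt, g)) : cfg R I -> unit * cfg R I).
  by apply: measurable_fun_pair => //; exact: measurable_id.
exact: (measurableT_comp (measurable_iint (f := fun=> f) s
  (measurableT_comp mf measurable_snd) (fun=> f0)) mk).
Qed.

Lemma iint_tonelli d (X : measurableType d)
    (mu : {sigma_finite_measure set X -> \bar R}) (I : eqType) (s : seq I)
    (f : X -> (I -> R) -> \bar R) g :
  measurable_fun [set: X * cfg R I] (fun p => f p.1 p.2) ->
  (forall x g, 0 <= f x g) ->
  \int[mu]_x iint R I s (f x) g = iint R I s (fun g => \int[mu]_x f x g) g.
Proof.
move=> mf f0; elim: s g => [//|i s IH] g /=.
under [RHS]eq_integral do rewrite -IH.
apply: (fubini_tonelli (m1 := mu) (m2 := leb)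
  (fun q : X * measurableTypeR R => iint R I s (f q.1) (upd R I g i q.2))).
  pose k (q : X * measurableTypeR R) : X * cfg R I := (q.1, upd R I g i q.2).
  suff mk : measurable_fun setT k.
    exact: (measurableT_comp (measurable_iint s mf f0) mk).
  apply/measurable_fun_pairP; split => /=; first exact: measurable_fst.
  by apply: measurable_upd => //; exact: measurable_snd.
by move=> q; apply: iint_ge0.
Qed.

Lemma iint_upd (I : eqType) (s : seq I) (f : (I -> R) -> \bar R) g i t :
  i \notin s ->
  iint R I s f (upd R I g i t) = iint R I s (fun g' => f (upd R I g' i t)) g.
Proof.
elim: s g => //= j s IH g; rewrite inE negb_or => /andP[ij js].
by apply: eq_integral => u _; rewrite updC// IH.
Qed.

Definition int1 (I : eqType) (i : I) (f : (I -> R) -> \bar R) (g : I -> R) :=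
  \int[leb]_t f (upd R I g i t).

Lemma int1_ge0 (I : eqType) (i : I) (f : (I -> R) -> \bar R) g :
  (forall g, 0 <= f g) -> 0 <= int1 i f g.
Proof. by move=> f0; apply: integral_ge0. Qed.

Lemma measurable_int1 (I : eqType) (i : I) (f : (I -> R) -> \bar R) :
  measurable_fun [set: cfg R I] f -> (forall g, 0 <= f g) ->
  measurable_fun [set: cfg R I] (int1 i f).
Proof. exact: (@measurable_iint1 _ [:: i]). Qed.

Lemma measurable_fun_upd2 (I : eqType) (i : I) (f : (I -> R) -> \bar R) :
  measurable_fun [set: cfg R I] f ->
  measurable_fun [set: measurableTypeR R * cfg R I]
    (fun p => f (upd R I p.2 i p.1)).
Proof.
move=> mf; pose k (p : measurableTypeR R * cfg R I) : cfg R I := upd R I p.2 i p.1.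
suff mk : measurable_fun setT k by exact: (measurableT_comp mf mk).
by apply: measurable_upd; [exact: measurable_snd|exact: measurable_fst].
Qed.

(** Tonelli moves the outermost integration innermost. Iterated, this gives independence of the
    order of [s] and singles out one coordinate for integration by parts. *)
Lemma iint_cons_int1 (I : eqType) i (s : seq I) (f : (I -> R) -> \bar R) g :
  measurable_fun [set: cfg R I] f -> (forall g, 0 <= f g) -> i \notin s ->
  iint R I (i :: s) f g = iint R I s (int1 i f) g.
Proof.
move=> mf f0 si /=.
under eq_integral do rewrite iint_upd//.
apply: (@iint_tonelli _ (measurableTypeR R) leb I s
  (fun t g' => f (upd R I g' i t)) g) => //.
exact: measurable_fun_upd2.
Qed.

Lemma iint_rem (I : eqType) i (s : seq I) (f : (I -> R) -> \bar R) g :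
  measurable_fun [set: cfg R I] f -> (forall g, 0 <= f g) ->
  uniq s -> i \in s ->
  iint R I s f g = iint R I (rem i s) (int1 i f) g.
Proof.
move=> mf f0; elim: s g => //= j s IH g /andP[js us].
rewrite inE; case: eqVneq => [-> _|ij /= si].
  exact: iint_cons_int1.
by apply: eq_integral => t _; exact: IH.
Qed.

Lemma iint_perm (I : eqType) (s s' : seq I) (f : (I -> R) -> \bar R) g :
  measurable_fun [set: cfg R I] f -> (forall g, 0 <= f g) ->
  uniq s -> perm_eq s s' ->
  iint R I s f g = iint R I s' f g.
Proof.
move=> mf f0; elim: s' s f mf f0 g => [|i s' IH] s f mf f0 g us ss'.
  by rewrite (perm_nilP ss').
have si : i \in s by rewrite (perm_mem ss') mem_head.
have us' : uniq (i :: s') by rewrite -(perm_uniq ss').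
rewrite (iint_rem (i := i))// iint_cons_int1//; last by case/andP: us'.
apply: IH.
- exact: measurable_int1.
- by move=> ?; exact: int1_ge0.
- exact: rem_uniq.
- by rewrite -(perm_cons i) -(permPl (perm_to_rem si)).
Qed.

Lemma iint_map (I J : eqType) (h : J -> I) (s : seq J)
    (f : (I -> R) -> \bar R) (f' : (J -> R) -> \bar R) g :
  injective h -> (forall g, f g = f' (g \o h)) ->
  iint R I (map h s) f g = iint R J s f' (g \o h).
Proof.
move=> hI ff'; elim: s g => [|j s IH] g /=; first exact: ff'.
apply: eq_integral => t _; rewrite IH; congr iint; apply/funext => k /=.
by rewrite /upd (inj_eq hI).
Qed.

Lemma le_iint (I : eqType) (s : seq I) (f f' : (I -> R) -> \bar R) g :
  measurable_fun [set: cfg R I] f -> (forall g, 0 <= f g) ->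
  measurable_fun [set: cfg R I] f' ->
  (forall g, f g <= f' g) -> iint R I s f g <= iint R I s f' g.
Proof.
move=> mf f0 mf' ff'; have f'0 g' : 0 <= f' g' by exact: le_trans (ff' g').
elim: s g => [|i s IH] g //=.
have mupd : measurable_fun [set: measurableTypeR R]
    ((fun t => upd R I g i t) : _ -> cfg R I) by apply: measurable_upd.
apply: ge0_le_integral => //.
- by move=> t _; exact: iint_ge0.
- exact: measurableT_comp (measurable_iint1 _ mf f0) mupd.
- exact: measurableT_comp (measurable_iint1 _ mf' f'0) mupd.
Qed.

Lemma iint_lim (I : eqType) (s : seq I) (f : ((I -> R) -> \bar R)^nat) g :
  (forall n, measurable_fun [set: cfg R I] (f n)) ->
  (forall n g, 0 <= f n g) ->
  (forall g, {homo f ^~ g : n m / (n <= m)%N >-> n <= m}) ->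
  iint R I s (fun g => limn (f ^~ g)) g = limn (fun n => iint R I s (f n) g).
Proof.
move=> mf f0 ndf; elim: s g => [|i s IH] g //=.
have mupd : measurable_fun [set: measurableTypeR R]
    ((fun t => upd R I g i t) : _ -> cfg R I) by apply: measurable_upd.
under eq_integral do rewrite IH.
apply: monotone_convergence => //.
- by move=> n; exact: measurableT_comp (measurable_iint1 _ (mf n) (f0 n)) mupd.
- by move=> n t _; exact: iint_ge0.
- by move=> t _ m n mn; apply: le_iint => // g'; exact: ndf.
Qed.

Lemma iintD (I : eqType) (s : seq I) (f f' : (I -> R) -> \bar R) g :
  measurable_fun [set: cfg R I] f -> (forall g, 0 <= f g) ->
  measurable_fun [set: cfg R I] f' -> (forall g, 0 <= f' g) ->
  iint R I s (fun g => f g + f' g) g = iint R I s f g + iint R I s f' g.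
Proof.
move=> mf f0 mf' f'0; elim: s g => [//|i s IH] g /=.
have mupd : measurable_fun [set: measurableTypeR R]
    ((fun t => upd R I g i t) : _ -> cfg R I) by apply: measurable_upd.
under eq_integral do rewrite IH.
apply: ge0_integralD => //.
- by move=> t _; exact: iint_ge0.
- exact: measurableT_comp (measurable_iint1 _ mf f0) mupd.
- by move=> t _; exact: iint_ge0.
- exact: measurableT_comp (measurable_iint1 _ mf' f'0) mupd.
Qed.

Lemma iintZl (I : eqType) (s : seq I) (f : (I -> R) -> \bar R) (k : R) g :
  measurable_fun [set: cfg R I] f -> (forall g, 0 <= f g) -> (0 <= k)%R ->
  iint R I s (fun g => k%:E * f g) g = k%:E * iint R I s f g.
Proof.
move=> mf f0 k0; elim: s g => [//|i s IH] g /=.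
have mupd : measurable_fun [set: measurableTypeR R]
    ((fun t => upd R I g i t) : _ -> cfg R I) by apply: measurable_upd.
under eq_integral do rewrite IH.
apply: ge0_integralZl_EFin => //.
- by move=> t _; exact: iint_ge0.
- exact: measurableT_comp (measurable_iint1 _ mf f0) mupd.
Qed.

Lemma iint0 (I : eqType) (s : seq I) g : iint R I s (cst 0) g = 0.
Proof. by elim: s g => //= i s IH g; apply: integral0_eq => t _; exact: IH. Qed.

Lemma iint_sum (I : eqType) (s : seq I) (K : Type) (r : seq K)
    (f : K -> (I -> R) -> \bar R) g :
  (forall k, measurable_fun [set: cfg R I] (f k)) -> (forall k g, 0 <= f k g) ->
  iint R I s (fun g => \sum_(k <- r) f k g) g = \sum_(k <- r) iint R I s (f k) g.
Proof.
move=> mf f0; elim: r => [|k r IH].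
  by rewrite [RHS]big_nil -[RHS](iint0 s g); apply: eq_iint => ?; rewrite big_nil.
rewrite big_cons -IH -iintD//; last 2 first.
- exact: emeasurable_sum.
- by move=> ?; exact: sume_ge0.
by apply: eq_iint => ?; rewrite big_cons.
Qed.

End Iint.

Section Nu.
Variables (R : realType) (I : finType).
Local Open Scope ereal_scope.

(* The iterated integral as a measure, which gives access to dominated convergence. *)
Definition nu (A : set (cfg R I)) : \bar R :=
  leb_int R I (fun g => (\1_A g)%:E).

Lemma measurable_indicE d (T : measurableType d) (A : set T) :
  measurable A -> measurable_fun [set: T] (fun g => (\1_A g)%:E : \bar R).
Proof. by move=> mA; exact/measurable_EFinP/measurable_indic. Qed.

Let nu0 : nu set0 = 0.
Proof.
rewrite /nu /leb_int -(iint0 (enum I) (fun=> 0%R)).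
by apply: eq_iint => g; rewrite indic0.
Qed.

Let nu_ge0 A : 0 <= nu A.
Proof. by apply: iint_ge0 => g; rewrite lee_fin. Qed.

Let nu_sigma_additive : semi_sigma_additive nu.
Proof.
move=> F mF tF mUF.
have mFE i : measurable_fun [set: cfg R I] (fun g => (\1_(F i) g)%:E : \bar R).
  exact: measurable_indicE.
pose S n (g : I -> R) : \bar R := \sum_(i <- index_iota 0 n) (\1_(F i) g)%:E.
have SE n : iint R I (enum I) (S n) (fun=> 0%R) =
    \sum_(0 <= i < n) nu (F i).
  by apply: iint_sum => // i g; rewrite lee_fin.
have Snd g : {homo S ^~ g : n m / (n <= m)%N >-> n <= m}.
  by apply: ereal_nondecreasing_series => i _ _; rewrite lee_fin.
have -> : nu (\bigcup_n F n) =
    limn (fun n => \sum_(0 <= i < n) nu (F i)).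
  rewrite [X in limn X](_ : _ = fun n => iint R I (enum I) (S n) (fun=> 0%R));
    last by apply/funext => n; rewrite SE.
  rewrite -iint_lim//; last 2 first.
  - by move=> n; exact: emeasurable_sum.
  - by move=> n g; apply: sume_ge0 => i _; rewrite lee_fin.
  apply: eq_iint => g; apply/esym/cvg_lim => //.
  (* At each point the indicators sum up by countable additivity of the Dirac mass at [g]. *)
  have := @measure_semi_sigma_additive _ (cfg R I) R (@dirac _ (cfg R I) g R) F mF tF mUF.
  rewrite /dirac. exact.
apply: ereal_nondecreasing_is_cvgn => m n mn.
rewrite -!SE; apply: le_iint => //.
- exact: emeasurable_sum.
- by move=> g; apply: sume_ge0 => i _; rewrite lee_fin.
- exact: emeasurable_sum.
- by move=> g; exact: Snd.
Qed.

HB.instance Definition _ :=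
  isMeasure.Build _ (cfg R I) R nu nu0 nu_ge0 nu_sigma_additive.

Import HBNNSimple.

Lemma ge0_integral_nu (f : (I -> R) -> \bar R) :
  measurable_fun [set: cfg R I] f -> (forall g, 0 <= f g) ->
  \int[nu]_g f g = leb_int R I f.
Proof.
move=> mf f0; pose f_ := nnsfun_approx measurableT mf.
have mf_ n : measurable_fun [set: cfg R I] (fun x => (f_ n x)%:E : \bar R).
  exact/measurable_EFinP/measurable_funP.
have nd_ g : {homo (fun n => (f_ n g)%:E : \bar R) : n m / (n <= m)%N >-> n <= m}.
  by move=> n m nm; rewrite lee_fin; exact/lefP/nd_nnsfun_approx.
have flim g : limn (fun n => (f_ n g)%:E : \bar R) = f g.
  by apply/cvg_lim => //; apply: cvg_nnsfun_approx => // *; exact: f0.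
transitivity (limn (fun n => \int[nu]_x (f_ n x)%:E)).
  rewrite -monotone_convergence//.
  - by apply: eq_integral => y _; rewrite flim.
  - by move=> n y _; rewrite lee_fin.
transitivity (limn (fun n => leb_int R I (fun x => (f_ n x)%:E))); last first.
  rewrite /leb_int -iint_lim//; last by move=> n g; rewrite lee_fin.
  by apply: eq_iint.
congr (limn _); apply/funext => n.
under eq_integral do rewrite fimfunE -fsumEFin//.
rewrite ge0_integral_fsum//; last 2 first.
- by move=> y; exact/measurable_EFinP/measurable_funM.
- by move=> y x _; rewrite nnfun_muleindic_ge0.
transitivity (\sum_(y \in range (f_ n)) y%:E * nu (f_ n @^-1` [set y])).
  apply: eq_fsbigr => r _.
  by rewrite integralZl_indic_nnsfun// integral_indic//= setIT.
have fin : finite_set (range (f_ n)) by [].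
rewrite fsbig_finite//= big_seq.
(* The guard on the sign of [i] makes [h i] non-negative for every real [i], as [iint_sum] requires;
   all values of [f_ n] satisfy it. *)
pose h i (g : I -> R) : \bar R :=
  (if (0 <= i)%R then i * \1_(f_ n @^-1` [set i]) g else 0%R)%:E.
transitivity (leb_int R I (fun g => \sum_(i <- fset_set (range (f_ n))) h i g));
    last first.
  apply: eq_iint => x; rewrite [in RHS]fimfunE -fsumEFin// fsbig_finite//=.
  rewrite big_seq [RHS]big_seq; apply: eq_bigr => r.
  by rewrite in_fset_set// => /set_mem[y _ <-]; rewrite /h fun_ge0.
have h0 k g : 0 <= h k g by rewrite lee_fin; case: ifPn => // k0; rewrite mulr_ge0.
rewrite /leb_int iint_sum//; last first.
  move=> k; apply/measurable_EFinP; case: (0 <= k)%R => //.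
  exact/measurable_funM.
rewrite [RHS]big_seq; apply: eq_bigr => r; rewrite in_fset_set// => /set_mem[x _ <-].
rewrite /nu /leb_int -iintZl//; last by exact: measurable_indicE.
by apply: eq_iint => g; rewrite /h fun_ge0.
Qed.

End Nu.

(** * Weighted integrals of functions of polynomial growth *)

Section Growth.
Variables (R : realType).
Local Notation leb := (@lebesgue_measure R).

Lemma iint_prod (I : eqType) (s : seq I) (w : R -> R) (c : R) g :
  measurable_fun [set: R] w -> (forall t, 0 <= w t) ->
  (\int[leb]_t (w t)%:E = c%:E)%E -> uniq s ->
  iint R I s (fun g => (\prod_(i <- s) w (g i))%:E) g = (c ^+ size s)%:E.
Proof.
move=> mw w0 wc; elim: s g => [|i s IH] g /=; first by rewrite big_nil expr0.
move=> /andP[si us].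
transitivity (\int[leb]_t ((w t)%:E * (c ^+ size s)%:E))%E.
  apply: eq_integral => t _; rewrite iint_upd// -(IH g us) -iintZl//; last 2 first.
  - apply/measurable_EFinP; apply: measurable_prod => j _.
    exact: (measurableT_comp mw (measurable_coord j)).
  - by move=> ?; rewrite lee_fin prodr_ge0.
  apply: eq_iint => g'; rewrite -EFinM big_cons updE eqxx; congr (_ * _)%:E.
  rewrite big_seq [RHS]big_seq; apply: eq_bigr => j sj; rewrite updE.
  by case: eqP => // ji; rewrite ji (negPf si) in sj.
have c0 : 0 <= c by rewrite -lee_fin -wc; apply: integral_ge0 => t _; rewrite lee_fin.
rewrite ge0_integralZr//.
- by rewrite wc exprS EFinM.
- exact/measurable_EFinP.
- by move=> t _; rewrite lee_fin.
- by rewrite lee_fin exprn_ge0.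
Qed.

Variable I : finType.

Lemma leb_int_prod (w : R -> R) (c : R) :
  measurable_fun [set: R] w -> (forall t, 0 <= w t) ->
  (\int[leb]_t (w t)%:E = c%:E)%E ->
  leb_int R I (fun g => (\prod_i w (g i))%:E) = (c ^+ #|I|)%:E.
Proof.
move=> mw w0 wc; rewrite cardE -(iint_prod (fun=> 0) mw w0 wc (enum_uniq I)).
by apply: eq_iint => g; rewrite big_enum.
Qed.

(** The bound is a product over the coordinates, so that against a product weight its integral
    factors into one-dimensional moments. *)
Definition pgrow (f : (I -> R) -> R) :=
  measurable_fun [set: cfg R I] f /\
  exists C k, forall g, `|f g| <= C * \prod_i (1 + `|g i|) ^+ k.

Lemma pgrow_measurable (f : (I -> R) -> R) : pgrow f -> measurable_fun [set: cfg R I] f.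
Proof. by case. Qed.

Lemma pgrow_prod_ge1 (g : I -> R) k : 1 <= \prod_i (1 + `|g i|) ^+ k.
Proof.
apply: (big_ind (fun x => 1 <= x)) => // [x y|i _]; first exact: mulr_ege1.
by rewrite exprn_ege1// lerDl.
Qed.

Lemma pgrow_le (g : I -> R) k l : (k <= l)%N ->
  \prod_i (1 + `|g i|) ^+ k <= \prod_i (1 + `|g i|) ^+ l.
Proof.
move=> kl; apply: ler_prod => i _; rewrite exprn_ge0 ?addr_ge0//=.
by rewrite ler_weXn2l// lerDl.
Qed.

Lemma pgrow_bound (f : (I -> R) -> R) : pgrow f ->
  exists2 C, 0 <= C & exists k, forall g, `|f g| <= C * \prod_i (1 + `|g i|) ^+ k.
Proof.
move=> [_ [C [k Ck]]]; exists `|C| => //; exists k => g.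
apply: (le_trans (Ck g)); rewrite ler_wpM2r// ?ler_norm//.
exact: le_trans ler01 (pgrow_prod_ge1 _ _).
Qed.

Lemma pgrow_bounded (f : (I -> R) -> R) (C : R) : measurable_fun [set: cfg R I] f ->
  (forall g, `|f g| <= C) -> pgrow f.
Proof.
move=> mf fC; split=> //; exists C, 0%N => g.
by under eq_bigr do rewrite expr0; rewrite big1// mulr1.
Qed.

Lemma pgrow_cst c : pgrow (fun=> c).
Proof. by apply: (@pgrow_bounded _ `|c|). Qed.

Lemma pgrow_coord i : pgrow (fun g => g i).
Proof.
split; first exact: measurable_coord.
exists 1, 1%N => g; rewrite mul1r (bigD1 i)//= expr1.
rewrite -[leLHS]mulr1 ler_pM//; first by rewrite lerDr.
apply: (big_ind (fun x => 1 <= x)) => // [x y|j _]; first exact: mulr_ege1.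
by rewrite lerDl.
Qed.

Lemma pgrowD (f f' : (I -> R) -> R) : pgrow f -> pgrow f' -> pgrow (fun g => f g + f' g).
Proof.
move=> pf pf'; split.
  by apply: measurable_funD; apply: pgrow_measurable.
have [C C0 [k Ck]] := pgrow_bound pf; have [D D0 [l Dl]] := pgrow_bound pf'.
exists (C + D), (k + l)%N => g; rewrite (le_trans (ler_normD _ _))// mulrDl.
apply: lerD; [apply: le_trans (Ck g) _|apply: le_trans (Dl g) _];
  rewrite ler_wpM2l// pgrow_le// ?leq_addr// leq_addl//.
Qed.

Lemma pgrowM (f f' : (I -> R) -> R) : pgrow f -> pgrow f' -> pgrow (fun g => f g * f' g).
Proof.
move=> pf pf'; split.
  by apply: measurable_funM; apply: pgrow_measurable.
have [C C0 [k Ck]] := pgrow_bound pf; have [D D0 [l Dl]] := pgrow_bound pf'.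
exists (C * D), (k + l)%N => g; rewrite normrM.
under eq_bigr do rewrite exprD.
by rewrite big_split /= mulrACA ler_pM.
Qed.

Lemma pgrowN (f : (I -> R) -> R) : pgrow f -> pgrow (fun g => - f g).
Proof.
move=> pf; rewrite (_ : (fun _ => _) = (fun g => -1 * f g)).
  by apply: pgrowM => //; exact: pgrow_cst.
by apply/funext => g; rewrite mulN1r.
Qed.

Lemma pgrowB (f f' : (I -> R) -> R) : pgrow f -> pgrow f' -> pgrow (fun g => f g - f' g).
Proof. by move=> pf pf'; apply: pgrowD => //; exact: pgrowN. Qed.

Lemma pgrow_sum (K : Type) (r : seq K) (P : pred K) (f : K -> (I -> R) -> R) :
  (forall k, P k -> pgrow (f k)) -> pgrow (fun g => \sum_(k <- r | P k) f k g).
Proof.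
move=> pf; elim: r => [|k r IH].
  by rewrite (_ : (fun _ => _) = cst 0); [exact: pgrow_cst|apply/funext => g; rewrite big_nil].
rewrite (_ : (fun _ => _) = (fun g => (if P k then f k g else 0) + \sum_(k <- r | P k) f k g)).
  by apply: pgrowD => //; case: (boolP (P k)) => [|_]; [exact: pf|exact: pgrow_cst].
by apply/funext => g; rewrite big_cons; case: ifP => //; rewrite add0r.
Qed.

Lemma pgrow_prod (K : Type) (r : seq K) (P : pred K) (f : K -> (I -> R) -> R) :
  (forall k, P k -> pgrow (f k)) -> pgrow (fun g => \prod_(k <- r | P k) f k g).
Proof.
move=> pf; elim: r => [|k r IH].
  by rewrite (_ : (fun _ => _) = cst 1); [exact: pgrow_cst|apply/funext => g; rewrite big_nil].
rewrite (_ : (fun _ => _) = (fun g => (if P k then f k g else 1) * \prod_(k <- r | P k) f k g)).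
  by apply: pgrowM => //; case: (boolP (P k)) => [|_]; [exact: pf|exact: pgrow_cst].
by apply/funext => g; rewrite big_cons; case: ifP => //; rewrite mul1r.
Qed.

Lemma pgrowX (f : (I -> R) -> R) n : pgrow f -> pgrow (fun g => f g ^+ n).
Proof.
move=> pf; elim: n => [|n IH]; first exact: pgrow_cst.
rewrite (_ : (fun _ => _) = (fun g => f g * f g ^+ n)); first exact: pgrowM.
by apply/funext => g; rewrite exprS.
Qed.

Definition good_weight (W : R -> R) := [/\ (forall t, 0 <= W t),
  measurable_fun [set: R] W &
  forall k, (\int[leb]_t ((1 + `|t|) ^+ k * W t)%:E < +oo)%E].

Lemma measurable_prod_coord (W : R -> R) : measurable_fun [set: R] W ->
  measurable_fun [set: cfg R I] (fun g => \prod_(i : I) W ((g : I -> R) i)).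
Proof.
move=> mW; apply: measurable_prod => j _.
exact: (measurableT_comp mW (measurable_coord j)).
Qed.

Lemma pgrow_integrable (W : R -> R) (f : (I -> R) -> R) : good_weight W -> pgrow f ->
  (@nu R I).-integrable setT (fun g => (f g * \prod_i W (g i))%:E).
Proof.
move=> [W0 mW Wk] pf; have [C C0 [k Ck]] := pgrow_bound pf.
have mV : measurable_fun [set: R] (fun t => (1 + `|t|) ^+ k * W t).
  apply: measurable_funM => //; apply: measurable_funX.
  by apply: measurable_funD => //; exact: measurableT_comp.
have V0 t : 0 <= (1 + `|t|) ^+ k * W t by rewrite mulr_ge0// exprn_ge0// addr_ge0.
have mfW : measurable_fun [set: cfg R I] (fun g => f g * \prod_i W (g i)).
  by apply: measurable_funM; [exact: pgrow_measurable|exact: measurable_prod_coord].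
apply/integrableP; split; first exact/measurable_EFinP.
pose c := fine (\int[leb]_t ((1 + `|t|) ^+ k * W t)%:E)%E.
have cE : (\int[leb]_t ((1 + `|t|) ^+ k * W t)%:E)%E = c%:E.
  by rewrite fineK// ge0_fin_numE// integral_ge0// => t _; rewrite lee_fin.
have mP := measurable_prod_coord mV.
apply: (@le_lt_trans _ _ (\int[@nu R I]_g
    (C%:E * (\prod_i ((1 + `|g i|) ^+ k * W (g i)))%:E)%E)%E).
  apply: ge0_le_integral => //.
  - by apply: measurableT_comp => //; exact/measurable_EFinP.
  - by apply: measurable_funeM; exact/measurable_EFinP.
  - move=> g _; rewrite -EFinM lee_fin normrM big_split /= mulrA.
    have P0 : 0 <= \prod_i W (g i) by exact: prodr_ge0.
    by rewrite (ger0_norm P0) ler_wpM2r.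
rewrite ge0_integralZl_EFin//; last 2 first.
- by move=> g _; rewrite lee_fin prodr_ge0.
- exact/measurable_EFinP.
rewrite ge0_integral_nu; last 2 first.
- exact/measurable_EFinP.
- by move=> g; rewrite lee_fin prodr_ge0.
by rewrite (leb_int_prod mV V0 cE) -EFinM ltry.
Qed.

(** On every line parallel to the axis [i] the positive and negative parts have equal integrals.
    Tonelli applies to each part separately and gives equal total integrals, which integrability
    makes finite. *)
Lemma ibp (i : I) (dF : (I -> R) -> R) :
  (@nu R I).-integrable setT (EFin \o dF) ->
  (forall g, \int[leb]_t (dF (upd R I g i t))%:E = 0)%E ->
  (\int[@nu R I]_g (dF g)%:E = 0)%E.
Proof.
move=> idF dF0.
have mdF := measurable_int _ idF.
have mp : measurable_fun [set: cfg R I] ((EFin \o dF)^\+)%E by exact: measurable_funepos.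
have mn : measurable_fun [set: cfg R I] ((EFin \o dF)^\-)%E by exact: measurable_funeneg.
rewrite integralE.
suff -> : (\int[@nu R I]_x ((EFin \o dF)^\+) x = \int[@nu R I]_x ((EFin \o dF)^\-) x)%E.
  by rewrite subee//; exact: integrable_neg_fin_num.
rewrite !ge0_integral_nu// /leb_int.
rewrite [LHS](iint_rem (i := i)) ?enum_uniq ?mem_enum//.
rewrite [RHS](iint_rem (i := i)) ?enum_uniq ?mem_enum//.
apply: eq_iint => g; have := dF0 g; rewrite integralE => /eqP.
rewrite /int1 /=.
set a := (X in (X - _)%E); set b := (X in (_ - X)%E) => ab.
have b0 : (0 <= b)%E by apply: integral_ge0.
have a0 : (0 <= a)%E by apply: integral_ge0.
have -> : (\int[leb]_t (EFin \o dF)^\+ (upd R I g i t))%E = a.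
  by apply: eq_integral => t _; rewrite !funeposE.
have -> : (\int[leb]_t (EFin \o dF)^\- (upd R I g i t))%E = b.
  by apply: eq_integral => t _; rewrite !funenegE.
(* Among non-negative extended reals, [a - b = 0] leaves no case in which [a] and [b] differ. *)
clearbody a b; move: a b ab a0 b0 => [a| |] [b| |]//=.
by rewrite -EFinB eqe subr_eq0 => /eqP ->.
Qed.

End Growth.

(** * Gaussian and exponential weights on the line *)

Section Calc.
Variables (R : realType).
Local Notation leb := (@lebesgue_measure R).

Lemma exp_dom (s : R) k : 0 < s -> exists2 C, 0 <= C &
  forall u, 0 <= u -> (1 + u) ^+ k * expR (- (s * u)) <= C * expR (- (s / 2 * u)).
Proof.
(* [a <= 1] gives [a * (1 + u) <= 1 + a * u <= expR (a * u)], and [k * a <= s / 2] leaves half of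
   the decay; [k.+1] in the denominator covers [k = 0]. *)
move=> s0; pose a := Num.min 1 (s / 2 / k.+1%:R).
have a0 : 0 < a by rewrite lt_min ltr01 !divr_gt0.
have a1 : a <= 1 by rewrite ge_min lexx.
have aks : k%:R * a <= s / 2.
  apply: (@le_trans _ _ (k%:R * (s / 2 / k.+1%:R))).
    by rewrite ler_wpM2l// ge_min lexx orbT.
  rewrite mulrA ler_pdivrMr// [leLHS]mulrC; apply: ler_wpM2l.
    by rewrite divr_ge0// ltW.
  by rewrite ler_nat.
exists (a ^- k) => [|u u0]; first by rewrite invr_ge0 exprn_ge0// ltW.
have h1 : 1 + u <= a^-1 * expR (a * u).
  rewrite -ler_pdivrMl ?invr_gt0// invrK.
  apply: le_trans (expR_ge1Dx _); rewrite mulrDr mulr1 lerD2r//.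
have h2 : (1 + u) ^+ k <= a ^- k * expR (k%:R * a * u).
  rewrite -mulrA -[k%:R * _]mulrC expRM_natr.
  by rewrite -exprVn -exprMn lerXn2r// nnegrE ?addr_ge0// mulr_ge0 ?expR_ge0// invr_ge0 ltW.
apply: (le_trans (ler_wpM2r (expR_ge0 _) h2)).
rewrite -[leLHS]mulrA; apply: ler_wpM2l.
  by rewrite invr_ge0 exprn_ge0// ltW.
rewrite -expRD ler_expR.
rewrite -subr_ge0 (_ : _ - _ = (s / 2 - k%:R * a) * u); last by field.
by rewrite mulr_ge0// subr_ge0.
Qed.

Definition wgauss (s t : R) := expR (- (s * t ^+ 2)).
Definition wexp (s t : R) := if 0 <= t then expR (- (s * t)) else 0.

Lemma wgauss_gt0 s t : 0 < wgauss s t. Proof. exact: expR_gt0. Qed.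

Lemma wexp_ge0 s t : 0 <= wexp s t.
Proof. by rewrite /wexp; case: ifP => // _; exact: expR_ge0. Qed.

Lemma measurable_wgauss s : measurable_fun [set: R] (wgauss s).
Proof.
apply: measurableT_comp => //; apply: measurableT_comp => //.
by apply: measurable_funM => //; exact: measurable_funX.
Qed.

Lemma wexpE s : wexp s = (fun t => expR (- (s * t))) \_ `[0, +oo[.
Proof.
by apply/funext => t; rewrite patchE /wexp mem_setE in_itv/= andbT.
Qed.

Lemma measurable_wexp s : measurable_fun [set: R] (wexp s).
Proof.
rewrite wexpE; apply/measurable_restrict => //; apply: measurable_funTS.
apply: (measurableT_comp (f := expR)) => //.
by apply: measurable_funN; exact: measurable_funM.
Qed.

Lemma integral_wgauss (s : R) : 0 < s ->
  (\int[leb]_t (wgauss s t)%:E = (Num.sqrt (pi / s))%:E)%E.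
Proof.
(* The normal density of variance [1 / (2 s)] is proportional to [wgauss s]. *)
move=> s0; pose sg := Num.sqrt (2 * s)^-1.
have sg0 : sg != 0 by rewrite gt_eqF// sqrtr_gt0 invr_gt0 mulr_gt0.
have sg2 : sg ^+ 2 = (2 * s)^-1 by rewrite sqr_sqrtr// invr_ge0 mulr_ge0// ltW.
have := integral_normal_pdf 0 sg.
rewrite (normal_pdfE _ sg0).
have -> : normal_peak sg = (Num.sqrt (pi / s))^-1.
  rewrite /normal_peak sg2; congr ((Num.sqrt _)^-1).
  by field; rewrite gt_eqF.
have NE x : normal_fun 0 sg x = wgauss s x.
  rewrite /normal_fun /wgauss subr0 sg2; congr expR.
  by field; rewrite gt_eqF.
under eq_integral do rewrite NE EFinM.
have p0 : 0 < Num.sqrt (pi / s) by rewrite sqrtr_gt0 divr_gt0// pi_gt0.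
rewrite ge0_integralZl_EFin//; last 2 first.
- by move=> x _; rewrite lee_fin ltW// wgauss_gt0.
- by apply/measurable_EFinP; exact: measurable_wgauss.
have : (0 <= \int[leb]_t (wgauss s t)%:E)%E.
  by apply: integral_ge0 => x _; rewrite lee_fin ltW// wgauss_gt0.
case: (\int[leb]_t (wgauss s t)%:E)%E => [r _ | _ | //].
  rewrite -EFinM => -[] /(congr1 (fun x => Num.sqrt (pi / s) * x)).
  by rewrite mulrA divff ?gt_eqF// mul1r mulr1 => ->.
by rewrite gt0_muley// lte_fin invr_gt0.
Qed.

Lemma integral_wexp (s : R) : 0 < s ->
  (\int[leb]_t (wexp s t)%:E = (s^-1)%:E)%E.
Proof.
move=> s0; have := integral_exponential_pdf s0.
have NE x : exponential_pdf s x = s * wexp s x.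
  rewrite /exponential_pdf wexpE !patchE; case: ifP => _; rewrite ?mulr0//.
  by rewrite mulNr.
under eq_integral do rewrite NE EFinM.
rewrite ge0_integralZl_EFin//; last 3 first.
- by move=> x _; rewrite lee_fin wexp_ge0.
- by apply/measurable_EFinP; exact: measurable_wexp.
- exact: ltW.
have : (0 <= \int[leb]_t (wexp s t)%:E)%E.
  by apply: integral_ge0 => x _; rewrite lee_fin wexp_ge0.
case: (\int[leb]_t (wexp s t)%:E)%E => [r _ | _ | //].
  rewrite -EFinM => -[] /(congr1 (fun x => s^-1 * x)).
  by rewrite mulrA mulVf ?gt_eqF// mul1r mulr1 => ->.
by rewrite gt0_muley// lte_fin.
Qed.

Lemma wgauss_good (s : R) : 0 < s -> good_weight (wgauss s).
Proof.
move=> s0; split; [by move=> t; rewrite ltW// wgauss_gt0|exact: measurable_wgauss|].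
move=> k; have [C C0 HC] := exp_dom k s0.
have s20 : 0 < s / 2 by rewrite divr_gt0.
apply: (@le_lt_trans _ _ (\int[leb]_t ((2 ^+ k * C)%:E * (wgauss (s / 2) t)%:E))%E).
  apply: ge0_le_integral => //.
  - by move=> t _; rewrite lee_fin mulr_ge0// ?exprn_ge0 ?addr_ge0// ltW// wgauss_gt0.
  - apply/measurable_EFinP; apply: measurable_funM; last exact: measurable_wgauss.
    by apply: measurable_funX; apply: measurable_funD => //; exact: measurableT_comp.
  - apply: measurable_funeM; apply/measurable_EFinP; exact: measurable_wgauss.
  - move=> t _; rewrite -EFinM lee_fin -mulrA.
    (* The inequality [1 + |t| <= 2 (1 + t ^ 2)] reduces the bound to [exp_dom] at [u = t ^ 2]. *)
    apply: (@le_trans _ _ (2 ^+ k * ((1 + t ^+ 2) ^+ k * wgauss s t))); last first.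
      by rewrite ler_wpM2l ?exprn_ge0// HC// sqr_ge0.
    rewrite mulrA ler_wpM2r// ?(ltW (wgauss_gt0 _ _))// -exprMn lerXn2r//.
    + by rewrite nnegrE addr_ge0.
    + by rewrite nnegrE mulr_ge0// addr_ge0// sqr_ge0.
    + have := sqr_ge0 (`|t| - 1); rewrite -(real_normK (num_real t)); nra.
rewrite ge0_integralZl_EFin//; last 3 first.
- by move=> x _; rewrite lee_fin ltW// wgauss_gt0.
- by apply/measurable_EFinP; exact: measurable_wgauss.
- by rewrite mulr_ge0// exprn_ge0.
by rewrite integral_wgauss// -EFinM ltry.
Qed.

Lemma wexp_good (s : R) : 0 < s -> good_weight (wexp s).
Proof.
move=> s0; split; [by move=> t; exact: wexp_ge0|exact: measurable_wexp|].
move=> k; have [C C0 HC] := exp_dom k s0.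
have s20 : 0 < s / 2 by rewrite divr_gt0.
apply: (@le_lt_trans _ _ (\int[leb]_t (C%:E * (wexp (s / 2) t)%:E))%E).
  apply: ge0_le_integral => //.
  - by move=> t _; rewrite lee_fin mulr_ge0// ?exprn_ge0 ?addr_ge0// wexp_ge0.
  - apply/measurable_EFinP; apply: measurable_funM; last exact: measurable_wexp.
    by apply: measurable_funX; apply: measurable_funD => //; exact: measurableT_comp.
  - apply: measurable_funeM; apply/measurable_EFinP; exact: measurable_wexp.
  - move=> t _; rewrite -EFinM lee_fin /wexp; case: ifPn => t0; last by rewrite !mulr0.
    by rewrite (ger0_norm t0) HC.
rewrite ge0_integralZl_EFin//; last 2 first.
- by move=> x _; rewrite lee_fin wexp_ge0.
- by apply/measurable_EFinP; exact: measurable_wexp.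
by rewrite integral_wexp// -EFinM ltry.
Qed.

End Calc.

(** * Integration by parts in one variable *)

Section Ibp1.
Variables (R : realType).
Local Notation leb := (@lebesgue_measure R).
Implicit Types (q : {poly R}) (s : R).

Lemma horner_growth q : exists2 C, 0 <= C &
  exists k, forall t, `|q.[t]| <= C * (1 + `|t|) ^+ k.
Proof.
exists (\sum_(i < size q) `|q`_i|); first exact: sumr_ge0.
exists (size q) => t; rewrite horner_coef (le_trans (ler_norm_sum _ _ _))//.
rewrite mulr_suml; apply: ler_sum => i _; rewrite normrM ler_wpM2l// normrX.
apply: (@le_trans _ _ ((1 + `|t|) ^+ i)).
  by rewrite lerXn2r ?nnegrE ?addr_ge0// lerDr.
by rewrite ler_weXn2l ?lerDl// ltnW.
Qed.

Lemma measurable_horner q : measurable_fun [set: R] (horner q).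
Proof. by apply: continuous_measurable_fun; exact: continuous_horner. Qed.

Lemma horner_integrable q W : good_weight W ->
  leb.-integrable setT (fun t => (q.[t] * W t)%:E).
Proof.
move=> [W0 mW Wk]; have [C C0 [k Ck]] := horner_growth q.
have mqW : measurable_fun [set: R] (fun t => q.[t] * W t).
  by apply: measurable_funM => //; exact: measurable_horner.
have mV : measurable_fun [set: R] (fun t => (1 + `|t|) ^+ k * W t).
  apply: measurable_funM => //; apply: measurable_funX.
  by apply: measurable_funD => //; exact: measurableT_comp.
have V0 t : 0 <= (1 + `|t|) ^+ k * W t by rewrite mulr_ge0// exprn_ge0// addr_ge0.
apply/integrableP; split; first exact/measurable_EFinP.
apply: (@le_lt_trans _ _ (\int[leb]_t (C%:E * ((1 + `|t|) ^+ k * W t)%:E))%E).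
  apply: ge0_le_integral => //.
  - by apply: measurableT_comp => //; exact/measurable_EFinP.
  - by apply: measurable_funeM; exact/measurable_EFinP.
  - move=> t _; rewrite -EFinM lee_fin normrM mulrA.
    by rewrite (ger0_norm (W0 t)) ler_wpM2r.
rewrite ge0_integralZl_EFin//; last 2 first.
- by move=> t _; rewrite lee_fin.
- exact/measurable_EFinP.
by apply: lte_mul_pinfty.
Qed.

Lemma FTC2_derive (F f : R -> R) (a b : R) : a < b ->
  (forall x : R, is_derive x (1 : R) F (f x)) -> continuous f ->
  (\int[leb]_(t in `[a, b]) (f t)%:E = (F b)%:E - (F a)%:E)%E.
Proof.
move=> ab dF cf; have cF : continuous F.
  by move=> x; apply: differentiable_continuous; apply/derivable1_diffP; have [] := dF x.
apply: continuous_FTC2 => //.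
- by apply: continuous_subspaceT.
- split.
  + by move=> x _; have [] := dF x.
  + by apply: cvg_at_right_filter; exact: cF.
  + by apply: cvg_at_left_filter; exact: cF.
- by move=> x _; rewrite derive1E; have [] := dF x.
Qed.

(** The fundamental theorem of calculus on the intervals [[u n, v n]], which exhaust [D], followed
    by dominated convergence under [|f|]. *)
Lemma integral_derive_lim (D : set R) (u v : R^nat) (F f : R -> R) :
  measurable D -> (forall n, u n < v n) ->
  (forall n, `[u n, v n] `<=` D) ->
  (forall x, D x -> \forall n \near \oo, u n <= x <= v n) ->
  (forall x : R, is_derive x (1 : R) F (f x)) -> continuous f ->
  leb.-integrable D (EFin \o f) ->
  F (v n) - F (u n) @[n --> \oo] --> 0 ->
  (\int[leb]_(t in D) (f t)%:E = 0)%E.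
Proof.
move=> mD uv uvD Duv dF cf intf Flim.
have mf : measurable_fun setT (EFin \o f).
  by apply/measurable_EFinP; exact: continuous_measurable_fun.
pose fn n t : \bar R := (f t * \1_`[u n, v n] t)%:E.
have fnE n : (\int[leb]_(t in D) fn n t = (F (v n) - F (u n))%:E)%E.
  rewrite EFinB -(FTC2_derive (uv n) dF cf).
  rewrite -[in RHS](setIidl (uvD n)) integral_mkcondl.
  apply: eq_integral => t _; rewrite /fn patchE indicE.
  by case: (_ \in _); rewrite ?mulr1 ?mulr0.
have m1 n : measurable_fun D (fn n).
  apply: measurable_funTS; apply/measurable_EFinP; apply: measurable_funM.
    exact: continuous_measurable_fun.
  exact: measurable_indic.
have m2 : measurable_fun D (EFin \o f) by exact: measurable_funTS.
have cfn : {ae leb, forall x, D x -> fn ^~ x @ \oo --> (EFin \o f) x}.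
  apply: aeW => x Dx; apply: cvg_near_cst; near=> n.
  rewrite /fn indicE mem_set ?mulr1//= in_itv/=.
  by near: n; exact: Duv.
have iabs : leb.-integrable D (abse \o (EFin \o f)) by exact: integrable_abse.
have dom : {ae leb, forall x n, D x -> (`|fn n x| <= (abse \o (EFin \o f)) x)%E}.
  apply: aeW => x n Dx; rewrite /fn/= lee_fin normrM indicE.
  by rewrite ler_piMr// normr_nat; case: (_ \in _).
have [_ _] := @dominated_convergence _ (measurableTypeR R) R leb D mD fn
  (EFin \o f) (abse \o (EFin \o f)) m1 m2 cfn iabs dom.
rewrite [X in X @ _ --> _](_ : _ = (fun n => (F (v n) - F (u n))%:E)); last first.
  by apply/funext => n; exact: fnE.
move=> H1; have H : (fun n => (F (v n) - F (u n))%:E) @ \oo --> 0%:E.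
  by apply: cvg_EFin => //; exact: nearW.
exact: (cvg_unique _ H1 H).
Unshelve. all: by end_near.
Qed.

Lemma is_derive_horner_exp q s x :
  is_derive x (1 : R) (fun t => q.[t] * expR (- (s * t)))
    ((q^`() - s *: q).[x] * expR (- (s * x))).
Proof.
apply: is_derive_eq; rewrite /GRing.scale/= hornerD hornerN hornerZ; ring.
Qed.

Lemma is_derive_horner_gauss q s x :
  is_derive x (1 : R) (fun t => q.[t] * wgauss s t)
    ((q^`() - (2 * s) *: ('X * q)).[x] * wgauss s x).
Proof.
rewrite /wgauss.
apply: is_derive_eq; rewrite /GRing.scale/= hornerD hornerN hornerZ hornerM hornerX.
by set e := expR _; ring.
Qed.

Lemma continuous_wgauss s : continuous (wgauss s).
Proof.
move=> x; apply: differentiable_continuous; apply/derivable1_diffP.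
have [] := is_derive_horner_gauss 1 s x.
by under eq_fun do rewrite hornerC mul1r.
Qed.

Lemma continuous_expRMl s : continuous (fun t : R => expR (- (s * t))).
Proof.
move=> x; apply: differentiable_continuous; apply/derivable1_diffP.
have [] := is_derive_horner_exp 1 s x.
by under eq_fun do rewrite hornerC mul1r.
Qed.

Lemma horner_exp_lim q s : 0 < s ->
  q.[n%:R] * expR (- (s * n%:R)) @[n --> \oo] --> 0.
Proof.
move=> s0; have [C C0 [k Ck]] := horner_growth q.
have [D D0 HD] := exp_dom k s0.
apply/norm_cvg0P/squeeze_cvgr; last 2 first.
- exact: (cvg_cst (0 : R)).
- rewrite -[X in _ --> X](mulr0 (C * D)); apply: cvgMr.
  apply: (@cvg_expr _ (expR (- (s / 2)))).
  rewrite ger0_norm ?expR_ge0// expR_lt1 oppr_lt0 divr_gt0//.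
near=> n; rewrite normr_ge0/= normrM (ger0_norm (expR_ge0 _)).
apply: (le_trans (ler_wpM2r (expR_ge0 _) (Ck _))).
rewrite -!mulrA ler_wpM2l// ger0_norm// (le_trans (HD _ _))//.
by rewrite -mulNr expRM_natr.
Unshelve. all: by end_near.
Qed.

Lemma horner_gauss_lim q s : 0 < s ->
  q.[n%:R] * wgauss s n%:R @[n --> \oo] --> 0.
Proof.
move=> s0; have H := cvg_norm (horner_exp_lim q s0); rewrite normr0 in H.
apply/norm_cvg0P/squeeze_cvgr; [|exact: (cvg_cst (0 : R))|exact: H].
(* Along the naturals [n <= n ^ 2], so the Gaussian lies below the exponential there. *)
near=> n; rewrite /= normr_ge0/= !normrM ler_wpM2l//.
rewrite !ger0_norm ?expR_ge0// ler_expR lerN2 ler_wpM2l ?(ltW s0)//.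
case: (n) => [|m]; first by rewrite expr0n.
by rewrite expr2 ler_peMr// ler1n.
Unshelve. all: by end_near.
Qed.

Lemma gauss_ibp q s : 0 < s ->
  (\int[leb]_t ((q^`() - (2 * s) *: ('X * q)).[t] * wgauss s t)%:E = 0)%E.
Proof.
move=> s0; apply: (@integral_derive_lim setT (fun n => - n.+1%:R) (fun n => n.+1%:R)
  (fun t => q.[t] * wgauss s t)) => //.
- by move=> n; rewrite -subr_gt0 opprK addr_gt0.
- move=> x _; near=> n; rewrite -ler_norml.
  apply: (@le_trans _ _ n%:R); last by rewrite ler_nat.
  by near: n; exact: nbhs_infty_ger.
- by move=> x; exact: is_derive_horner_gauss.
- move=> x; apply: cvgM; [exact: continuous_horner|exact: continuous_wgauss].
- by apply: horner_integrable; exact: wgauss_good.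
- rewrite -[X in _ --> X](subr0 0); apply: cvgB.
  + by rewrite (cvg_shiftS (fun n => q.[n%:R] * wgauss s n%:R)); exact: horner_gauss_lim.
  + rewrite [X in X @ _ --> _](_ : _ =
      (fun n => (q \Po (- 'X)).[n.+1%:R] * wgauss s n.+1%:R)).
      by rewrite (cvg_shiftS (fun n => (q \Po (- 'X)).[n%:R] * wgauss s n%:R));
        exact: horner_gauss_lim.
    by apply/funext => n; rewrite horner_comp !hornerE /wgauss sqrrN.
Unshelve. all: by end_near.
Qed.

Lemma exp_ibp_oo q s a b : q.[a] = 0 -> q.[b] = 0 ->
  (\int[leb]_(t in `]a, b[) ((q^`() - s *: q).[t] * expR (- (s * t)))%:E = 0)%E.
Proof.
move=> qa qb; case: (ltP a b) => ab; last first.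
  by rewrite set_itv_ge ?integral_set0// bnd_simp -leNgt.
have mf : measurable_fun setT (fun t => ((q^`() - s *: q).[t] * expR (- (s * t)))%:E).
  apply/measurable_EFinP; apply: measurable_funM; first exact: measurable_horner.
  by apply: continuous_measurable_fun; exact: continuous_expRMl.
rewrite -(integral_itv_bndoo true false); last exact: measurable_funTS.
rewrite (FTC2_derive ab (fun x => is_derive_horner_exp q s x)).
  by rewrite qa qb !mul0r subee.
by move=> x; apply: cvgM; [exact: continuous_horner|exact: continuous_expRMl].
Qed.

Lemma exp_ibp_oy q s a : 0 < s -> 0 <= a -> q.[a] = 0 ->
  (\int[leb]_(t in `]a, +oo[) ((q^`() - s *: q).[t] * expR (- (s * t)))%:E = 0)%E.
Proof.
move=> s0 a0 qa.
have mf : measurable_fun setT (fun t => ((q^`() - s *: q).[t] * expR (- (s * t)))%:E).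
  apply/measurable_EFinP; apply: measurable_funM; first exact: measurable_horner.
  by apply: continuous_measurable_fun; exact: continuous_expRMl.
rewrite integral_itv_obnd_cbnd; last exact: measurable_funTS.
apply: (@integral_derive_lim `[a, +oo[ (fun n => a) (fun n => a + n.+1%:R)
  (fun t => q.[t] * expR (- (s * t)))) => //.
- by move=> n; rewrite ltrDl.
- by move=> n t /=; rewrite !in_itv/= andbT => /andP[].
- move=> x; rewrite /= in_itv/= andbT => ax; near=> n; rewrite ax/= -lerBlDl.
  apply: (@le_trans _ _ n%:R); last by rewrite ler_nat.
  by near: n; exact: nbhs_infty_ger.
- by move=> x; exact: is_derive_horner_exp.
- by move=> x; apply: cvgM; [exact: continuous_horner|exact: continuous_expRMl].
(* By [a0] the half-line lies in [0 <= t], where [wexp s] is the plain exponential. *)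
- have := horner_integrable (q^`() - s *: q) (wexp_good s0).
  move=> /(integrableS measurableT) => /(_ `[a, +oo[) H.
  apply: eq_integrable (H _ _) => //= x /set_mem.
  by rewrite /= in_itv/= andbT /wexp => ax; rewrite (le_trans a0 ax).
- rewrite -[X in _ --> X](subr0 0); apply: cvgB.
  + rewrite [X in X @ _ --> _](_ : _ = (fun n => expR (- (s * a)) *
      ((q \Po ('X + a%:P)).[n.+1%:R] * expR (- (s * n.+1%:R))))).
      rewrite -[X in _ --> X](mulr0 (expR (- (s * a)))); apply: cvgMr.
      rewrite (cvg_shiftS (fun n => (q \Po ('X + a%:P)).[n%:R] * expR (- (s * n%:R)))).
      exact: horner_exp_lim.
    apply/funext => n; rewrite horner_comp hornerD hornerX hornerC mulrDr.
    by rewrite opprD expRD [n.+1%:R + a]addrC mulrCA.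
  + rewrite qa mul0r; exact: cvg_cst.
Unshelve. all: by end_near.
Qed.

End Ibp1.

(** * Loop equations *)

Section EW.
Variables (R : realType) (I : finType).
Local Notation leb := (@lebesgue_measure R).
Implicit Types (W : R -> R) (f : (I -> R) -> R).

Definition EW W f : R := \int[@nu R I]_g (f g * \prod_i W (g i)).

Lemma EW_integrable W f : good_weight W -> pgrow f ->
  (@nu R I).-integrable setT (EFin \o (fun g => f g * \prod_i W (g i))).
Proof. exact: pgrow_integrable. Qed.

Lemma EWE W f : good_weight W -> pgrow f ->
  (\int[@nu R I]_g (f g * \prod_i W (g i))%:E = (EW W f)%:E)%E.
Proof.
move=> gW pf; rewrite /EW /Rintegral fineK//.
exact: (integrable_fin_num measurableT (EW_integrable gW pf)).
Qed.

Lemma eq_EW W f f' : f =1 f' -> EW W f = EW W f'.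
Proof. by move=> /funext ->. Qed.

Lemma EWD W f f' : good_weight W -> pgrow f -> pgrow f' ->
  EW W (fun g => f g + f' g) = EW W f + EW W f'.
Proof.
move=> gW pf pf'; rewrite /EW -RintegralD//; try exact: EW_integrable.
by congr Rintegral; apply/funext => g; rewrite mulrDl.
Qed.

Lemma EWZ W f c : good_weight W -> pgrow f ->
  EW W (fun g => c * f g) = c * EW W f.
Proof.
move=> gW pf; rewrite /EW -RintegralZl//; last exact: EW_integrable.
by congr Rintegral; apply/funext => g; rewrite mulrA.
Qed.

Lemma EWB W f f' : good_weight W -> pgrow f -> pgrow f' ->
  EW W (fun g => f g - f' g) = EW W f - EW W f'.
Proof.
move=> gW pf pf'; rewrite EWD//; last exact: pgrowN.
by congr (_ + _); rewrite -mulN1r -EWZ//; apply: eq_EW => g; rewrite mulN1r.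
Qed.

Lemma EW0 W : EW W (fun=> 0) = 0.
Proof.
rewrite /EW /Rintegral; under eq_integral do rewrite mul0r.
by rewrite integral0.
Qed.

Lemma EW_sum W (K : Type) (r : seq K) (P : pred K) (f : K -> (I -> R) -> R) :
  good_weight W -> (forall k, P k -> pgrow (f k)) ->
  EW W (fun g => \sum_(k <- r | P k) f k g) = \sum_(k <- r | P k) EW W (f k).
Proof.
move=> gW pf; elim: r => [|k r IH].
  by rewrite [RHS]big_nil -[RHS](EW0 W); apply: eq_EW => g; rewrite big_nil.
rewrite [RHS]big_cons; case: ifP => Pk.
  rewrite -IH -EWD//; [|exact: pf|by apply: pgrow_sum].
  by apply: eq_EW => g; rewrite big_cons Pk.
by rewrite -IH; apply: eq_EW => g; rewrite big_cons Pk.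
Qed.

(** Partial derivative along [i] for functions that are polynomial on each line parallel to that
    axis. Indicators and exponentials stay outside, in the weights, and the polynomial [q] is what
    the one-dimensional integrations by parts take. *)
Definition pd (i : I) f f' := forall g, exists q : {poly R}, forall t,
  f (upd R I g i t) = q.[t] /\ f' (upd R I g i t) = q^`().[t].

Lemma pd_cst i c : pd i (fun=> c) (fun=> 0).
Proof. by move=> g; exists c%:P => t; rewrite derivC !hornerC. Qed.

Lemma pd_coord i j : pd i (fun g => g j) (fun=> (j == i)%:R).
Proof.
move=> g; rewrite /upd; case: eqVneq => ji.
  by exists 'X => t; rewrite derivX hornerX hornerC.
by exists (g j)%:P => t; rewrite derivC !hornerC.
Qed.

Lemma pdD i f1 f1' f2 f2' : pd i f1 f1' -> pd i f2 f2' ->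
  pd i (fun g => f1 g + f2 g) (fun g => f1' g + f2' g).
Proof.
move=> h1 h2 g; have [q1 e1] := h1 g; have [q2 e2] := h2 g.
exists (q1 + q2) => t; rewrite derivD !hornerD.
by have [-> ->] := e1 t; have [-> ->] := e2 t.
Qed.

Lemma pdM i f1 f1' f2 f2' : pd i f1 f1' -> pd i f2 f2' ->
  pd i (fun g => f1 g * f2 g) (fun g => f1' g * f2 g + f1 g * f2' g).
Proof.
move=> h1 h2 g; have [q1 e1] := h1 g; have [q2 e2] := h2 g.
exists (q1 * q2) => t; rewrite derivM !hornerE.
by have [-> ->] := e1 t; have [-> ->] := e2 t.
Qed.

Lemma eq_pd i f1 f1' f2 f2' : f1 =1 f2 -> f1' =1 f2' -> pd i f1 f1' -> pd i f2 f2'.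
Proof. by move=> /funext-> /funext->. Qed.

Lemma pd_sum i (K : Type) (r : seq K) (P : pred K) (f f' : K -> (I -> R) -> R) :
  (forall k, P k -> pd i (f k) (f' k)) ->
  pd i (fun g => \sum_(k <- r | P k) f k g) (fun g => \sum_(k <- r | P k) f' k g).
Proof.
move=> h; elim: r => [|k r IH].
  by apply: (eq_pd _ _ (pd_cst i 0)) => g; rewrite big_nil.
case: (boolP (P k)) => Pk.
  by apply: (eq_pd _ _ (pdD (h k Pk) IH)) => g; rewrite big_cons Pk.
by apply: (eq_pd _ _ IH) => g; rewrite big_cons (negPf Pk).
Qed.

(** The weights of the other coordinates are constant on a line parallel to the axis [i], so
    [gauss_ibp] applies line by line. *)
Lemma gauss_stein s i f f' : 0 < s -> pd i f f' -> pgrow f -> pgrow f' ->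
  EW (wgauss s) f' = 2 * s * EW (wgauss s) (fun g => g i * f g).
Proof.
move=> s0 pdf pf pf'; have gW := wgauss_good s0.
have pgf : pgrow (fun g => g i * f g) by apply: pgrowM => //; exact: pgrow_coord.
have pgf2 : pgrow (fun g => 2 * s * (g i * f g)) by apply: pgrowM => //; exact: pgrow_cst.
apply/eqP; rewrite -subr_eq0 -EWZ// -EWB//; apply/eqP.
suff : (\int[@nu R I]_g ((f' g - 2 * s * (g i * f g)) * \prod_i wgauss s (g i))%:E = 0)%E.
  by rewrite EWE//; [case|exact: pgrowB].
apply: (@ibp _ _ i (fun g => (f' g - 2 * s * (g i * f g)) * \prod_i wgauss s (g i))).
  by apply: EW_integrable => //; exact: pgrowB.
move=> g; have [q eq] := pdf g.
pose c := \prod_(j | j != i) wgauss s (g j).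
transitivity (\int[leb]_t (((q^`() - (2 * s) *: ('X * q)).[t] * wgauss s t)%:E * c%:E)%E)%E.
  apply: eq_integral => t _; rewrite -EFinM; congr (_%:E).
  have [-> ->] := eq t; rewrite (bigD1 i)//= updE eqxx -!mulrA.
  rewrite hornerD hornerN hornerZ hornerM hornerX !mulrA; congr (_ * _ * _).
  by apply: eq_bigr => j ji; rewrite updE (negPf ji).
rewrite integralZr//; last exact: horner_integrable.
by rewrite gauss_ibp// mul0e.
Qed.

End EW.

Section Rec.
Variable R : realType.

(* The pairs [(l, K')] where [K'] is [K] with one of its elements [l] replaced by [k + l]. *)
Fixpoint merges (k : nat) (K : seq nat) : seq (nat * seq nat) :=
  match K with
  | [::] => [::]
  | l :: K' => (l, (k + l)%N :: K') :: [seq (x.1, l :: x.2) | x <- merges k K']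
  end.

(* The Schwinger-Dyson equations shared by the moments of [prod_k Tr (H H^* )^k] under
   a Gaussian [H] and by those of the power sums under the weight [vdm] of the chamber. *)
Definition loop_rec (m : nat) (s : R) (M : seq nat -> R) :=
  [/\ forall K K', perm_eq K K' -> M K = M K',
      forall K, M (0%N :: K) = m%:R * M K &
      forall k K, 2 * s * M (k.+1 :: K) =
        k.+1%:R * M (k :: K) + \sum_(a < k.+1) M [:: a : nat, (k - a)%N & K]
        + 2 * \sum_(x <- merges k K) x.1%:R * M x.2].

Lemma merges_sumn k K x : x \in merges k K -> sumn x.2 = (k + sumn K)%N.
Proof.
elim: K x => //= l K IH x; rewrite inE => /orP[/eqP -> /=|/mapP[y /IH e ->] /=].
  by rewrite addnA.
by rewrite e addnCA.
Qed.

(** The third equation lowers the total degree [sumn K] by one and the second removes zero entries,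
    so every value reduces to [M [::]]. *)
Lemma loop_rec_unique m s M M' : 0 < s -> loop_rec m s M -> loop_rec m s M' ->
  M [::] = M' [::] -> M =1 M'.
Proof.
move=> s0 [pM zM rM] [pM' zM' rM'] e0 K.
have [n] := ubnP (sumn K); elim: n K => // n IH K; rewrite ltnS => Kn.
case: (boolP (all (fun k => k == 0%N) K)) => [|/allPn[k kK k0]].
  elim: K {Kn} => [//|k K IHK] /= /andP[/eqP -> /IHK e].
  by rewrite zM zM' e.
have pK := perm_to_rem kK.
rewrite (pM _ _ pK) (pM' _ _ pK).
case: k k0 kK pK => // k _ kK pK.
have sK : (k + sumn (rem k.+1 K) < n)%N.
  have := perm_sumn pK; rewrite /= => sE; rewrite sE in Kn.
  by rewrite -addSn.
apply: (mulfI (x := 2 * s)); first by rewrite mulf_neq0 ?gt_eqF.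
rewrite rM rM'; congr (_ + _ + _).
- by rewrite IH.
- by apply: eq_bigr => a _; rewrite IH//= addnA subnKC// -ltnS.
- congr (_ * _); rewrite big_seq [RHS]big_seq; apply: eq_bigr => x xr.
  by rewrite IH// (merges_sumn xr).
Qed.

Definition psum (m : nat) (k : nat) (x : 'I_m -> R) : R := \sum_i x i ^+ k.
Definition pprod (m : nat) (K : seq nat) (x : 'I_m -> R) : R :=
  \prod_(k <- K) psum k x.

End Rec.

(** * The ordered chamber *)

Section Chamber.
Variables (R : realType) (m : nat).
Local Notation leb := (@lebesgue_measure R).
Local Notation V := ('I_m -> R).

Lemma measurable_bool_natr d (T : measurableType d) (b : T -> bool) :
  measurable_fun [set: T] b -> measurable_fun [set: T] (fun x => (b x)%:R : R).
Proof.
move=> mb; rewrite (_ : (fun _ => _) = (fun x => if b x then 1 else 0)).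
  exact: measurable_fun_ifT.
by apply/funext => x; case: (b x).
Qed.

Lemma natr_forall (K : finType) (P : pred K) :
  ([forall k, P k])%:R = \prod_k (P k)%:R :> R.
Proof.
case: forallP => [Pk|nP]; first by rewrite big1// => k _; rewrite Pk.
apply/esym/eqP/prodf_eq0; have [k Pk] : exists k, ~~ P k.
  by apply/existsP; rewrite -negb_forall; apply/negP => /forallP.
by exists k => //; rewrite (negPf Pk).
Qed.

Lemma measurable_forall_natr d (T : measurableType d) (K : finType) (b : K -> T -> bool) :
  (forall k, measurable_fun [set: T] (b k)) ->
  measurable_fun [set: T] (fun x => [forall k, b k x]%:R : R).
Proof.
move=> mb; rewrite (_ : (fun _ => _) = (fun x => \prod_k (b k x)%:R)).
  by apply: measurable_prod => k _; exact: measurable_bool_natr.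
by apply/funext => x; rewrite natr_forall.
Qed.

Definition cham (x : V) : bool :=
  [forall p : 'I_m * 'I_m, (p.1 < p.2)%N ==> (x p.2 < x p.1)] &&
  [forall j, 0 < x j].

Lemma chamP (x : V) : reflect ((forall i j : 'I_m, (i < j)%N -> x j < x i) /\
  (forall i, 0 < x i)) (cham x).
Proof.
apply: (iffP andP) => -[h1 h2]; split.
- by move=> i j ij; move/forallP: h1 => /(_ (i, j)) /implyP; apply.
- by move/forallP: h2.
- by apply/forallP => -[i j]; apply/implyP => /=; exact: h1.
- exact/forallP.
Qed.

Definition chi (x : V) : R := (cham x)%:R.

Lemma pgrow_chi : pgrow chi.
Proof.
apply: (@pgrow_bounded _ _ _ 1) => [|g]; last by rewrite normr_nat /chi; case: cham.
rewrite (_ : chi = fun x => ([forall p : 'I_m * 'I_m, (p.1 < p.2)%N ==> (x p.2 < x p.1)])%:R *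
   ([forall j, 0 < x j])%:R); last by apply/funext => x; rewrite -natrM mulnb.
apply: measurable_funM.
  apply: measurable_forall_natr => -[i j] /=.
  case: (i < j)%N => //=; apply: measurable_fun_ltr; exact: measurable_coord.
apply: measurable_forall_natr => j.
by apply: measurable_fun_ltr => //; exact: measurable_coord.
Qed.

(** The derivative [F] is defined and of polynomial growth everywhere, as integrability demands. Its
    logarithmic form holds only where no factor vanishes, which for [vdm] includes the chamber. *)
Lemma pd_prod_log (I K : finType) (i : I) (P : pred K) (f f' : K -> (I -> R) -> R) :
  (forall k, P k -> pd i (f k) (f' k)) ->
  (forall k, P k -> pgrow (f k)) -> (forall k, P k -> pgrow (f' k)) ->
  exists F, [/\ pd i (fun g => \prod_(k | P k) f k g) F, pgrow F &
    forall g, (forall k, P k -> f k g != 0) ->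
    F g = (\prod_(k | P k) f k g) * \sum_(k | P k) f' k g / f k g].
Proof.
move=> pdf pf pf'.
elim: (index_enum K) => [|k r [F [pF gF FE]]].
  exists (fun=> 0); split; first by apply: (eq_pd _ _ (pd_cst i 1)) => g; rewrite ?big_nil.
    exact: pgrow_cst.
  by move=> g _; rewrite !big_nil mulr0.
case: (boolP (P k)) => Pk; last first.
  exists F; split => //.
    by apply: (eq_pd _ _ pF) => g; rewrite ?big_cons ?(negPf Pk).
  by move=> g fn0; rewrite !big_cons (negPf Pk); exact: FE.
exists (fun g => f' k g * (\prod_(k <- r | P k) f k g) + f k g * F g); split.
- by apply: (eq_pd _ _ (pdM (pdf k Pk) pF)) => g; rewrite ?big_cons ?Pk.
- apply: pgrowD; apply: pgrowM => //; [exact: pf'|exact: pgrow_prod|exact: pf].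
- move=> g fn0; rewrite (FE g fn0) !big_cons Pk mulrDr; congr (_ + _).
    by field; exact: fn0.
  by rewrite mulrA.
Qed.

Definition vdm (x : V) : R := vandermonde R m x.

Lemma vdmE x : vdm x = \prod_(p : 'I_m * 'I_m | (p.1 < p.2)%N) (x p.1 - x p.2).
Proof. by rewrite /vdm /vandermonde pair_big_dep. Qed.

Lemma pgrow_vdm : pgrow vdm.
Proof.
rewrite (_ : vdm = fun x => \prod_(p : 'I_m * 'I_m | (p.1 < p.2)%N) (x p.1 - x p.2)).
  by apply: pgrow_prod => p _; apply: pgrowB; exact: pgrow_coord.
by apply/funext => x; rewrite vdmE.
Qed.

Lemma vdm_eq0 (x : V) (i j : 'I_m) : i != j -> x i = x j -> vdm x = 0.
Proof.
wlog ij : i j / (i < j)%N.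
  move=> H nij; have [ij|ji|/val_inj ij] := ltngtP i j.
  - exact: H ij nij.
  - by move=> /esym; apply: H ji _; rewrite eq_sym.
  - by rewrite ij eqxx in nij.
move=> _ xij; rewrite vdmE; apply/eqP/prodf_eq0; exists (i, j) => //=.
by rewrite xij subrr.
Qed.

Lemma vdm_gt0 x : cham x -> 0 < vdm x.
Proof.
move=> /chamP[c1 _]; rewrite vdmE; apply: prodr_gt0 => -[i j] /= ij.
by rewrite subr_gt0 c1.
Qed.

(** A line parallel to the axis [i] meets the chamber in an interval whose finite ends are 0 or
    other coordinates of [x], and [q] vanishes at all of these. *)
Lemma chamber_ibp1 (i : 'I_m) (s : R) (q : {poly R}) (x : V) :
  0 < s -> q.[0] = 0 -> (forall j, j != i -> q.[x j] = 0) ->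
  (\int[leb]_t (chi (upd R _ x i t) * ((q^`() - s *: q).[t] * expR (- (s * t))))%:E = 0)%E.
Proof.
move=> s0 q0 qj.
(* [c0] collects the constraints that do not involve the coordinate [i]. The others place [t] above
   0 and all later coordinates, hence above [a], and below all earlier ones. *)
pose c0 := [forall p : 'I_m * 'I_m, (p.1 < p.2)%N && (p.1 != i) && (p.2 != i) ==> (x p.2 < x p.1)]
  && [forall j, (j != i) ==> (0 < x j)].
pose a := \big[Num.max/0]_(j < m | (i < j)%N) x j.
have a0 : 0 <= a by exact: bigmax_ge_id.
have qa : q.[a] = 0.
  rewrite /a; apply: (big_ind (fun y => q.[y] = 0)) => //.
    by move=> u v qu qv; rewrite /Num.max; case: ifP.
  by move=> j ij; apply: qj; rewrite eq_sym -val_eqE/= ltn_eqF// gtn_eqF.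
pose tb t := [forall j : 'I_m, (j < i)%N ==> (t < x j)].
have chE t : cham (upd R _ x i t) = [&& c0, a < t & tb t].
  apply/chamP/and3P => [[h1 h2]|[/andP[c1 c2] at_ tbt]].
    split.
    - apply/andP; split; apply/forallP.
        move=> [j k]; apply/implyP => /= /andP[/andP[jk ji] ki].
        by have := h1 j k jk; rewrite !updE (negPf ji) (negPf ki).
      by move=> j; apply/implyP => ji; have := h2 j; rewrite updE (negPf ji).
    - apply/bigmax_ltP; split; first by have := h2 i; rewrite updE eqxx.
      move=> j ij; have := h1 i j ij; rewrite !updE eqxx.
      by case: eqVneq ij => [->|//]; rewrite ltnn.
    - apply/forallP => j; apply/implyP => ji; have := h1 j i ji.
      by rewrite !updE eqxx; case: eqVneq ji => [->|//]; rewrite ltnn.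
  move/bigmax_ltP: at_ => [t0 tj]; split.
    move=> j k jk; rewrite !updE; case: eqVneq => [ki|ki]; case: eqVneq => [ji|ji].
    - by move: jk; rewrite ki ji ltnn.
    - by move/forallP: tbt => /(_ j); rewrite -ki jk.
    - by apply: tj; rewrite -ji.
    - by move/forallP: c1 => /(_ (j, k)); rewrite /= jk ji ki.
  move=> j; rewrite updE; case: eqVneq => // ji.
  by move/forallP: c2 => /(_ j); rewrite ji.
case: (boolP c0) => c0T; last first.
  apply: integral0_eq => t _; rewrite /chi chE (negPf c0T) mul0r//.
(* If some index precedes [i], the slice is the bounded interval []a, b[], and [x j0] only starts
   the minimum; otherwise the slice is []a, +oo[]. *)
case: (pickP (fun j : 'I_m => (j < i)%N)) => [j0 j0i|noj].
  pose b := \big[Num.min/x j0]_(j < m | (j < i)%N) x j.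
  have qx (j : 'I_m) : (j < i)%N -> q.[x j] = 0.
    by move=> ji; apply: qj; rewrite -val_eqE/= ltn_eqF.
  have qb : q.[b] = 0.
    rewrite /b; apply: (big_ind (fun y => q.[y] = 0)) => //.
    - exact: qx.
    - by move=> u v qu qv; rewrite /Num.min; case: ifP.
  have tbE t : tb t = (t < b).
    apply/forallP/bigmin_gtP => [h|[_ h] j]; last by apply/implyP; exact: h.
    split; last by move=> j ji; move/implyP: (h j); apply.
    by move/implyP: (h j0); apply.
  rewrite -(exp_ibp_oo s qa qb) [RHS]integral_mkcond.
  apply: eq_integral => t _; rewrite patchE /chi chE c0T tbE /=.
  by rewrite mem_setE in_itv/=; case: ifP; rewrite ?mul1r ?mul0r.
have tbE t : tb t by apply/forallP => j; rewrite noj.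
rewrite -(exp_ibp_oy s0 a0 qa) [RHS]integral_mkcond.
apply: eq_integral => t _; rewrite patchE /chi chE c0T tbE andbT /=.
by rewrite mem_setE in_itv/= andbT; case: ifP; rewrite ?mul1r ?mul0r.
Qed.

End Chamber.

(** * The divergence theorem on the chamber *)

Section ChamberLoop.
Variables (R : realType) (m : nat).
Local Notation leb := (@lebesgue_measure R).
Local Notation V := ('I_m -> R).

Lemma pdZ (I : finType) (i : I) c (f f' : (I -> R) -> R) :
  pd i f f' -> pd i (fun g => c * f g) (fun g => c * f' g).
Proof.
by move=> h; apply: (eq_pd _ _ (pdM (pd_cst i c) h)) => g //; rewrite mul0r add0r.
Qed.

Lemma pdB (I : finType) (i : I) (f1 f1' f2 f2' : (I -> R) -> R) :
  pd i f1 f1' -> pd i f2 f2' ->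
  pd i (fun g => f1 g - f2 g) (fun g => f1' g - f2' g).
Proof.
by move=> h1 h2; apply: (eq_pd _ _ (pdD h1 (pdZ (-1) h2))) => g; rewrite mulN1r.
Qed.

Lemma sum_lt_sym (S : 'I_m -> 'I_m -> R) : (forall i j, S i j = S j i) ->
  2 * \sum_(p : 'I_m * 'I_m | (p.1 < p.2)%N) S p.1 p.2 =
  \sum_i \sum_j S i j - \sum_i S i i.
Proof.
move=> symS; rewrite pair_big /=.
rewrite [X in _ = X - _](bigID (fun p : 'I_m * 'I_m => (p.1 < p.2)%N)) /=.
rewrite [X in _ = _ + X - _](bigID (fun p : 'I_m * 'I_m => (p.2 < p.1)%N)) /=.
have -> : \sum_(p : 'I_m * 'I_m | ~~ (p.1 < p.2)%N && (p.2 < p.1)%N) S p.1 p.2 =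
          \sum_(p : 'I_m * 'I_m | (p.1 < p.2)%N) S p.1 p.2.
  rewrite (reindex_inj (h := fun p : 'I_m * 'I_m => (p.2, p.1))) /=; last first.
    by move=> [a b] [c d] [-> ->].
  apply: eq_big => [[a b]|[a b] _] //=.
  by rewrite -leqNgt; case: ltngtP.
have -> : \sum_(p : 'I_m * 'I_m | ~~ (p.1 < p.2)%N && ~~ (p.2 < p.1)%N) S p.1 p.2 =
          \sum_i S i i.
  rewrite -(pair_big_dep predT (fun i j : 'I_m => ~~ (i < j)%N && ~~ (j < i)%N) S) /=.
  apply: eq_bigr => i _; rewrite (big_pred1 i)// => j /=.
  by rewrite -!leqNgt -eqn_leq.
by rewrite addrA addrK mulr2n mulrDl mul1r.
Qed.

(** The divergence of the field with components [h i * vdm], weighted by the exponential, integrates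
    to zero over the chamber: [vdm] vanishes on the walls [x i = x j] and [h i] on [x i = 0]. The
    logarithmic derivative of [vdm] groups the components in pairs and leaves the divided
    differences [gp]. *)
Lemma chamber_loop s (h h' : 'I_m -> V -> R) (gp : 'I_m -> 'I_m -> V -> R) :
  0 < s -> (forall i, pd i (h i) (h' i)) ->
  (forall i, pgrow (h i)) -> (forall i, pgrow (h' i)) ->
  (forall i j, pgrow (gp i j)) ->
  (forall i (x : V), x i = 0 -> h i x = 0) ->
  (forall i j x, h i x - h j x = (x i - x j) * gp i j x) ->
  s * EW (wexp s) (fun x => chi x * vdm x * \sum_i h i x) =
  EW (wexp s) (fun x => chi x * vdm x *
    (\sum_i h' i x + \sum_(p : 'I_m * 'I_m | (p.1 < p.2)%N) gp p.1 p.2 x)).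
Proof.
move=> s0 pdh ph ph' pg h0 hg; have gW := wexp_good s0.
have pv := @pgrow_vdm R m; have pchi := @pgrow_chi R m.
pose df (i : 'I_m) (p : 'I_m * 'I_m) : V -> R := fun=> (p.1 == i)%:R - (p.2 == i)%:R.
have HD (i : 'I_m) : exists D, [/\ pd i (@vdm R m) D, pgrow D &
    forall x, cham x -> D x = vdm x * \sum_(p : 'I_m * 'I_m | (p.1 < p.2)%N) df i p x / (x p.1 - x p.2)].
  have [||| D [pD gD DE]] := @pd_prod_log R 'I_m ('I_m * 'I_m)%type i
    (fun p => (p.1 < p.2)%N) (fun p x => x p.1 - x p.2) (df i).
  - by move=> p _; apply: pdB; exact: pd_coord.
  - by move=> p _; apply: pgrowB; exact: pgrow_coord.
  - by move=> p _; exact: pgrow_cst.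
  exists D; split => //.
    by apply: (eq_pd _ _ pD) => x //; rewrite vdmE.
  move=> x /chamP[c1 _]; rewrite vdmE; apply: DE => p lp.
  by rewrite subr_eq0 gt_eqF// c1.
have [D HDi] := choice HD.
(* The [i]-th term of the divergence, with the exponential factored out. *)
pose T i (x : V) := chi x * (h' i x * vdm x + h i x * D i x - s * (h i x * vdm x)).
have pT i : pgrow (T i).
  have [_ pD _] := HDi i.
  apply: pgrowM => //; apply: pgrowB; first by apply: pgrowD; exact: pgrowM.
  by apply: pgrowM; [exact: pgrow_cst|exact: pgrowM].
have T0 i : EW (wexp s) (T i) = 0.
  have [pdD' pD _] := HDi i.
  suff : (\int[@nu R 'I_m]_g (T i g * \prod_j wexp s (g j))%:E = 0)%E.
    by rewrite EWE//; case.
  apply: (@ibp _ _ i (fun g => T i g * \prod_j wexp s (g j))).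
    exact: EW_integrable.
  move=> x; have [q eq] := pdM (pdh i) pdD' x.
  pose c := \prod_(j | j != i) wexp s (x j).
  have q0 : q.[0] = 0.
    by have [<- _] := eq 0; rewrite h0 ?mul0r// updE eqxx.
  have qj j : j != i -> q.[x j] = 0.
    move=> ji; have [<- _] := eq (x j); rewrite (@vdm_eq0 _ _ _ j i) ?mulr0//.
    by rewrite !updE eqxx (negPf ji).
  have igr : leb.-integrable setT (fun t =>
     (chi (upd R _ x i t) * ((q^`() - s *: q).[t] * expR (- (s * t))))%:E).
    have := horner_integrable (q^`() - s *: q) gW.
    apply: le_integrable => //.
      apply/measurable_EFinP; apply: measurable_funM.
        have mu : measurable_fun [set: measurableTypeR R]
            ((fun t => upd R _ x i t) : _ -> cfg R 'I_m) by apply: measurable_upd.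
        exact: (measurableT_comp (pgrow_measurable pchi) mu).
      apply: measurable_funM; first exact: measurable_horner.
      by apply: continuous_measurable_fun; exact: continuous_expRMl.
    move=> t _; rewrite lee_fin /chi /wexp; case: chamP => [[_ /(_ i)]|_].
      by rewrite updE eqxx => t0; rewrite mul1r (ltW t0).
    by rewrite mul0r normr0.
  transitivity (\int[leb]_t ((chi (upd R _ x i t) * ((q^`() - s *: q).[t] * expR (- (s * t))))%:E * c%:E)%E)%E.
    apply: eq_integral => t _; rewrite -EFinM; congr (_%:E).
    rewrite (bigD1 i)//= updE eqxx.
    have -> : \prod_(j < m | j != i) wexp s (upd R _ x i t j) = c.
      by apply: eq_bigr => j ji; rewrite updE (negPf ji).
    have [e1 e2] := eq t.
    rewrite hornerD hornerN hornerZ -e1 -e2 /T mulrA; congr (_ * _).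
    rewrite /chi /wexp; case: chamP => [[_ /(_ i)]|_]; last by rewrite !mul0r.
    by rewrite updE eqxx => t0; rewrite (ltW t0) !mul1r.
  by rewrite integralZr// chamber_ibp1// mul0e.
have pX : pgrow (fun x => chi x * vdm x * \sum_i h i x).
  by apply: pgrowM; [exact: pgrowM|apply: pgrow_sum => i _].
have pY : pgrow (fun x => chi x * vdm x *
    (\sum_i h' i x + \sum_(p : 'I_m * 'I_m | (p.1 < p.2)%N) gp p.1 p.2 x)).
  apply: pgrowM; first exact: pgrowM.
  by apply: pgrowD; apply: pgrow_sum.
apply/eqP; rewrite -subr_eq0 -EWZ// -EWB//; last by apply: pgrowM => //; exact: pgrow_cst.
apply/eqP; transitivity (- \sum_i EW (wexp s) (T i)); last first.
  by rewrite big1 ?oppr0.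
rewrite -EW_sum// -[RHS]mulN1r -EWZ//; last exact: pgrow_sum.
apply: eq_EW => x; rewrite /T /chi -mulr_sumr.
case: (boolP (cham x)) => cx; last by rewrite !mul0r mulr0 subr0 mulr0.
rewrite !mul1r sumrB big_split /= -!mulr_suml -mulr_sumr -mulr_suml.
(* A pair [p] is met at [i = p.1] and at [i = p.2] with opposite signs, which produces
   [(h p.1 - h p.2) / (x p.1 - x p.2)]. *)
have -> : \sum_i h i x * D i x = vdm x *
    \sum_(p : 'I_m * 'I_m | (p.1 < p.2)%N) gp p.1 p.2 x.
  transitivity (\sum_i \sum_(p : 'I_m * 'I_m | (p.1 < p.2)%N)
       vdm x * (h i x * (df i p x / (x p.1 - x p.2)))).
    apply: eq_bigr => i _; have [_ _ ->//] := HDi i.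
    by rewrite mulrCA -mulr_sumr -mulr_sumr.
  rewrite exchange_big /= mulr_sumr; apply: eq_bigr => p lp.
  rewrite -mulr_sumr; congr (_ * _).
  have xp : x p.1 - x p.2 != 0 by have /chamP[c1 _] := cx; rewrite subr_eq0 gt_eqF// c1.
  apply: (mulfI xp); rewrite -hg mulr_sumr /df.
  transitivity (\sum_i (h i x * (p.1 == i)%:R - h i x * (p.2 == i)%:R)).
    by apply: eq_bigr => i _; field.
  rewrite sumrB; congr (_ - _).
    rewrite (bigD1 p.1)//= big1 ?addr0; first by rewrite eqxx mulr1.
    by move=> i ip; rewrite eq_sym (negPf ip) mulr0.
  rewrite (bigD1 p.2)//= big1 ?addr0; first by rewrite eqxx mulr1.
  by move=> i ip; rewrite eq_sym (negPf ip) mulr0.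
ring.
Qed.

End ChamberLoop.

Section ChamberMoments.
Variables (R : realType) (m : nat).
Local Notation V := ('I_m -> R).

Lemma pdX (I : finType) (i : I) n (f f' : (I -> R) -> R) :
  pd i f f' -> pd i (fun g => f g ^+ n) (fun g => n%:R * f g ^+ n.-1 * f' g).
Proof.
move=> h g; have [q e] := h g; exists (q ^+ n) => t.
rewrite deriv_exp hornerMn hornerM !horner_exp; have [-> ->] := e t; split => //.
by rewrite -mulr_natl; ring.
Qed.

Lemma pgrow_psum k : pgrow (@psum R m k).
Proof. by apply: pgrow_sum => i _; apply: pgrowX; exact: pgrow_coord. Qed.

Lemma pgrow_pprod K : pgrow (@pprod R m K).
Proof. by apply: pgrow_prod => k _; exact: pgrow_psum. Qed.

Lemma psum0 (x : V) : psum 0 x = m%:R.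
Proof.
by rewrite /psum; under eq_bigr do rewrite expr0; rewrite sumr_const card_ord.
Qed.

Fixpoint Dpprod (i : 'I_m) (K : seq nat) (x : V) : R :=
  match K with
  | [::] => 0
  | l :: K' => l%:R * x i ^+ l.-1 * pprod K' x + psum l x * Dpprod i K' x
  end.

Lemma pd_coordX (i : 'I_m) j n :
  pd i (fun x : V => x j ^+ n) (fun x => (j == i)%:R * (n%:R * x i ^+ n.-1)).
Proof.
apply: (eq_pd _ _ (pdX n (@pd_coord R _ i j))) => x //.
by case: eqVneq => [->|]; rewrite ?mulr1 ?mul1r ?mulr0 ?mul0r.
Qed.

Lemma pd_psum i l : pd i (@psum R m l) (fun x => l%:R * x i ^+ l.-1).
Proof.
apply: (eq_pd _ _ (pd_sum (index_enum _) (P := predT) (fun j _ => pd_coordX i j l))) => x //.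
rewrite (bigD1 i)//= eqxx mul1r big1 ?addr0// => j ji.
by rewrite (negPf ji) mul0r.
Qed.

Lemma pd_pprod i K : pd i (@pprod R m K) (Dpprod i K).
Proof.
elim: K => [|l K IH] /=.
  by apply: (eq_pd _ _ (pd_cst i 1)) => x //; rewrite /pprod big_nil.
by apply: (eq_pd _ _ (pdM (pd_psum i l) IH)) => x //; rewrite /pprod big_cons.
Qed.

Lemma pgrow_Dpprod i K : pgrow (Dpprod i K).
Proof.
elim: K => [|l K IH] /=; first exact: pgrow_cst.
apply: pgrowD; apply: pgrowM => //; [|exact: pgrow_pprod|exact: pgrow_psum].
by apply: pgrowM; [exact: pgrow_cst|apply: pgrowX; exact: pgrow_coord].
Qed.

(** Under the vector field [x_i ^ (k + 1)] each factor [psum l] turns into [l * psum (k + l)]; this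
    is the origin of [merges]. *)
Lemma Dpprod_rl k K (x : V) :
  \sum_i x i ^+ k.+1 * Dpprod i K x = \sum_(y <- merges k K) y.1%:R * pprod y.2 x.
Proof.
elim: K => [|l K IH] /=; first by rewrite big_nil big1// => i _; rewrite mulr0.
rewrite big_cons big_map /=.
under eq_bigr do rewrite mulrDr.
rewrite big_split /=; congr (_ + _).
  rewrite /pprod big_cons mulrA mulr_sumr mulr_suml; apply: eq_bigr => i _.
  case: l => [|l]; first by rewrite !mul0r mulr0.
  by rewrite addnS -addSn exprD /=; ring.
under eq_bigr do rewrite mulrCA.
rewrite -mulr_sumr IH mulr_sumr; apply: eq_bigr => y _.
by rewrite /pprod big_cons; ring.
Qed.

Definition ch_moment (s : R) (K : seq nat) : R :=
  EW (wexp s) (fun x : V => chi x * vdm x * pprod K x).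

Lemma pgrow_cv (f : V -> R) : pgrow f -> pgrow (fun x => chi x * vdm x * f x).
Proof.
by move=> pf; apply: pgrowM => //; apply: pgrowM; [exact: pgrow_chi|exact: pgrow_vdm].
Qed.

(** [chamber_loop] for the field [x_i ^ (k + 1) * pprod K]. The sum over pairs is half of the double
    sum minus its diagonal [(k + 1) * psum k]. After doubling, this diagonal reduces the coefficient
    [2 (k + 1)] from the derivative of the field to [k + 1]. *)
Lemma ch_moment_rec s : 0 < s -> loop_rec m s (ch_moment s).
Proof.
move=> s0; have gW := wexp_good s0.
have pM K : pgrow (fun x : V => chi x * vdm x * pprod K x).
  by apply: pgrow_cv; exact: pgrow_pprod.
split=> [K K' KK'|K|k K].
- by apply: eq_EW => x; rewrite /pprod (perm_big _ KK').
- rewrite /ch_moment -EWZ//; apply: eq_EW => x.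
  by rewrite /pprod big_cons psum0; ring.
(* The divided difference of [t ^ (k + 1)] at [x i] and [x j]. *)
pose S (x : V) i j := \sum_(a < k.+1) x i ^+ (k - a) * x j ^+ a.
have symS x i j : S x i j = S x j i.
  rewrite /S (reindex_inj rev_ord_inj) /=; apply: eq_bigr => a _.
  by rewrite subSS subKn 1?mulrC// -ltnS.
have H := @chamber_loop R m s (fun i x => x i ^+ k.+1 * pprod K x)
  (fun i x => k.+1%:R * x i ^+ k * pprod K x + x i ^+ k.+1 * Dpprod i K x)
  (fun i j x => S x i j * pprod K x) s0.
have pS i j : pgrow (fun x => S x i j).
  by apply: pgrow_sum => a _; apply: pgrowM; apply: pgrowX; exact: pgrow_coord.
have {}H : s * ch_moment s (k.+1 :: K) = EW (wexp s) (fun x : V => chi x * vdm x *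
  (\sum_i (k.+1%:R * x i ^+ k * pprod K x + x i ^+ k.+1 * Dpprod i K x) +
   \sum_(p : 'I_m * 'I_m | (p.1 < p.2)%N) S x p.1 p.2 * pprod K x)).
  rewrite -H.
  - congr (_ * _); apply: eq_EW => x; congr (_ * _).
    by rewrite /pprod big_cons mulr_suml.
  - move=> i; apply: (eq_pd _ _ (pdM (pd_coordX i i k.+1) (pd_pprod i K))) => x //.
    by rewrite eqxx mul1r.
  - by move=> i; apply: pgrowM; [apply: pgrowX; exact: pgrow_coord|exact: pgrow_pprod].
  - move=> i; apply: pgrowD; apply: pgrowM; try exact: pgrow_pprod.
    + by apply: pgrowM; [exact: pgrow_cst|apply: pgrowX; exact: pgrow_coord].
    + by apply: pgrowX; exact: pgrow_coord.
    + exact: pgrow_Dpprod.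
  - by move=> i j; apply: pgrowM => //; exact: pgrow_pprod.
  - by move=> i x ->; rewrite expr0n mul0r.
  - by move=> i j x; rewrite -mulrBl subrXX -mulrA.
rewrite -mulrA H -EWZ//; last first.
  apply: pgrow_cv; apply: pgrowD; apply: pgrow_sum => i _; last first.
    by apply: pgrowM => //; exact: pgrow_pprod.
  apply: pgrowD; apply: pgrowM; try exact: pgrow_pprod.
  + by apply: pgrowM; [exact: pgrow_cst|apply: pgrowX; exact: pgrow_coord].
  + by apply: pgrowX; exact: pgrow_coord.
  + exact: pgrow_Dpprod.
pose T K (x : V) := chi x * vdm x * pprod K x.
have pT L : pgrow (T L) by exact: pM.
have pcT c L : pgrow (fun x => c * T L x) by apply: pgrowM; [exact: pgrow_cst|exact: pM].
have pr : pgrow (fun x => \sum_(y <- merges k K) y.1%:R * T y.2 x).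
  by apply: pgrow_sum.
transitivity (EW (wexp s) (fun x => k.+1%:R * T (k :: K) x +
    \sum_(a < k.+1) T [:: a : nat, (k - a)%N & K] x +
    2 * \sum_(y <- merges k K) y.1%:R * T y.2 x)); last first.
  rewrite EWD//; last 2 first.
  - by apply: pgrowD => //; apply: pgrow_sum => a _; exact: pM.
  - by apply: pgrowM; [exact: pgrow_cst|exact: pr].
  rewrite EWD//; last by apply: pgrow_sum => a _; exact: pM.
  rewrite !EWZ//.
  rewrite [X in _ + X + _](EW_sum _ (P := predT) (f := fun (a : 'I_k.+1) x => T [:: a : nat, (k - a)%N & K] x))//.
  rewrite [X in 2 * X](EW_sum _ (P := predT) (f := fun y x => y.1%:R * T y.2 x))//.
  by congr (_ + _ + 2 * _); apply: eq_bigr => y _; rewrite EWZ.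
apply: eq_EW => x; rewrite /T mulrCA -mulr_sumr.
under [X in 2 * X]eq_bigr do rewrite mulrCA.
rewrite -mulr_sumr -Dpprod_rl [RHS]addrAC.
pose B := \sum_i \sum_j S x i j.
have e1 : \sum_(a < k.+1) pprod [:: a : nat, (k - a)%N & K] x =
    B * pprod K x.
  under eq_bigr do rewrite /pprod !big_cons mulrA -/(pprod K x).
  rewrite -mulr_suml; congr (_ * _); rewrite /B /S exchange_big /=.
  transitivity (\sum_j \sum_(a < k.+1) x j ^+ a * \sum_i x i ^+ (k - a)).
    rewrite exchange_big /=; apply: eq_bigr => a _.
    by rewrite /psum mulr_suml.
  apply: eq_bigr => j _; rewrite exchange_big /=; apply: eq_bigr => a _.
  by rewrite mulr_sumr; apply: eq_bigr => i _; rewrite mulrC.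
have e2 : \sum_i S x i i = k.+1%:R * psum k x.
  rewrite /psum mulr_sumr; apply: eq_bigr => i _; rewrite /S.
  rewrite (eq_bigr (fun=> x i ^+ k)); first by rewrite sumr_const card_ord mulr_natl.
  by move=> a _; rewrite -exprD subnK// -ltnS.
have e3 := sum_lt_sym (symS x).
rewrite big_split /= e1.
have -> : \sum_(p : 'I_m * 'I_m | (p.1 < p.2)%N) S x p.1 p.2 * pprod K x =
    (\sum_(p : 'I_m * 'I_m | (p.1 < p.2)%N) S x p.1 p.2) * pprod K x.
  by rewrite mulr_suml.
have -> : \sum_(i < m) k.+1%:R * x i ^+ k * pprod K x = k.+1%:R * psum k x * pprod K x.
  by rewrite -mulr_suml -mulr_sumr.
have -> : pprod (k :: K) x = psum k x * pprod K x by rewrite /pprod big_cons.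
move: e3; rewrite e2 -/B; set A := \sum_(p | _) _.
set D := \sum_i _ * _ => e3.
have -> : B = 2 * A + k.+1%:R * psum k x by rewrite e3 subrK.
ring.
Qed.

End ChamberMoments.

(** * The Selberg integral over the chamber *)

Section Shift.
Variable R : realType.
Local Notation leb := (@lebesgue_measure R).

Lemma measurable_addr (c : R) : measurable_fun [set: measurableTypeR R]
  ((fun t => t + c) : measurableTypeR R -> measurableTypeR R).
Proof. exact: measurable_funD. Qed.

Lemma lebesgue_measure_shift (c : R) (A : set R) : measurable A ->
  pushforward leb ((fun t => t + c) : measurableTypeR R -> measurableTypeR R) A = leb A.
Proof.
move=> mA; apply/esym/lebesgue_measure_unique => //=; first exact: measurable_addr.
move=> mc _ [[a b]] _ <-; rewrite /pushforward.
rewrite (_ : _ @^-1` _ = (`]a - c, b - c]%classic : set R)).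
  have lE (u v : R) : leb `]u, v] = (if u < v then (v - u)%:E else 0%E).
    by rewrite lebesgue_measure_itv/= lte_fin EFinB.
  rewrite lE/= (lE (a - c) (b - c)); case: (ltP a b) => ab; case: (ltP (a - c) (b - c)) => abc //.
  - by congr (_%:E); ring.
  - by exfalso; lra.
  - by exfalso; lra.
by apply/seteqP; split => x /=; rewrite !in_itv/= ltrBlDr lerBrDr.
Qed.

Lemma ge0_integral_shift (f : R -> \bar R) (c : R) :
  measurable_fun [set: R] f -> (forall t, 0 <= f t)%E ->
  (\int[leb]_t f (t + c)%R = \int[leb]_t f t)%E.
Proof.
move=> mf f0.
have mc := measurable_addr c.
transitivity (\int[pushforward leb ((fun t => t + c)%R : measurableTypeR R -> measurableTypeR R)]_t f t)%E.
  by rewrite (ge0_integral_pushforward mc).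
apply: eq_measure_integral => A mA _; exact: lebesgue_measure_shift.
Qed.

(** Since [iint] overwrites every coordinate in [s], an integral over all coordinates ignores the
    base point; after a shift this is what restores the base point of [leb_int]. *)
Lemma iint_base (I : eqType) (s : seq I) (f : (I -> R) -> \bar R) g g' :
  (forall i, i \notin s -> g i = g' i) -> iint R I s f g = iint R I s f g'.
Proof.
elim: s g g' => [|i s IH] g g' gg' /=; first by congr f; apply/funext => i; exact: gg'.
apply: eq_integral => t _; apply: IH => j js; rewrite !updE.
by case: eqVneq => // ji; apply: gg'; rewrite inE negb_or ji.
Qed.

Lemma measurable_shift (I : Type) (c : R) :
  measurable_fun [set: cfg R I] ((fun g i => g i + c) : cfg R I -> cfg R I).
Proof.
apply: measurable_to_cfg => i; apply: measurable_funD => //.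
exact: measurable_coord.
Qed.

Lemma iint_shift (I : eqType) (s : seq I) (f : (I -> R) -> \bar R) (c : R) g :
  measurable_fun [set: cfg R I] f -> (forall g, 0 <= f g)%E ->
  iint R I s (fun g => f (fun i => g i + c)) g = iint R I s f (fun i => g i + c).
Proof.
move=> mf f0; elim: s g => [//|i s IH] g /=.
rewrite -[RHS](ge0_integral_shift c); last 2 first.
- have mupd : measurable_fun [set: measurableTypeR R]
    ((fun t => upd R I (fun j => g j + c) i t) : _ -> cfg R I) by apply: measurable_upd.
  exact: (measurableT_comp (measurable_iint1 s mf f0) mupd).
- by move=> t; exact: iint_ge0.
apply: eq_integral => t _; rewrite IH; congr iint; apply/funext => j.
by rewrite !updE; case: eqP.
Qed.

Lemma leb_int_shift (I : finType) (f : (I -> R) -> \bar R) (c : R) :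
  measurable_fun [set: cfg R I] f -> (forall g, 0 <= f g)%E ->
  leb_int R I (fun g => f (fun i => g i + c)) = leb_int R I f.
Proof.
move=> mf f0; rewrite /leb_int iint_shift//; apply: iint_base => i.
by rewrite mem_enum.
Qed.

Lemma leb_int_lift (n : nat) (f : ('I_n.+1 -> R) -> \bar R) :
  measurable_fun [set: cfg R 'I_n.+1] f -> (forall g, 0 <= f g)%E ->
  leb_int R 'I_n.+1 f = (\int[leb]_t leb_int R 'I_n
    (fun y => f (fun i => if unlift ord_max i is Some j then y j else t)))%E.
Proof.
move=> mf f0; rewrite /leb_int.
rewrite (@iint_perm _ _ _ (ord_max :: map (lift ord_max) (enum 'I_n)))//; last 2 first.
- exact: enum_uniq.
- apply: uniq_perm; rewrite ?enum_uniq//=.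
    rewrite map_inj_uniq ?enum_uniq ?andbT//; last exact: lift_inj.
    by apply/mapP => -[j _ /eqP]; rewrite (negPf (neq_lift _ _)).
  move=> i; rewrite mem_enum inE/=; apply/esym.
  rewrite in_cons; case: (unliftP ord_max i) => [j ->|->]; last by rewrite eqxx.
  by rewrite map_f ?orbT// mem_enum.
move=> /=; apply: eq_integral => t _; rewrite iint_upd; last first.
  by apply/mapP => -[j _ /eqP]; rewrite (negPf (neq_lift _ _)).
apply: (@iint_map _ _ _ (lift ord_max)); first exact: lift_inj.
move=> g /=; congr f; apply/funext => i; rewrite updE.
case: unliftP => [j ->|->]; last by rewrite eqxx.
by rewrite eq_sym (negPf (neq_lift _ _)).
Qed.

End Shift.

(** * Elementary symmetric polynomials *)

Section Aomoto.
Variables (R : realType) (m : nat).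
Local Notation V := ('I_m -> R).

(** Generating polynomial: its coefficient of degree [k] is the elementary symmetric polynomial
    [e_k] in the variables indexed by [P]. Varying [P] leaves out chosen variables. *)
Definition omit (P : pred 'I_m) (x : V) : {poly R} := \prod_(i | P i) (1 + x i *: 'X).
Definition elsym (k : nat) (x : V) : R := (omit predT x)`_k.

Lemma eq_omit (P Q : pred 'I_m) (x : V) : P =1 Q -> omit P x = omit Q x.
Proof. by move=> PQ; apply: eq_bigl. Qed.

Lemma omitD1 (P : pred 'I_m) (x : V) i : P i ->
  omit P x = (1 + x i *: 'X) * omit (fun j => P j && (j != i)) x.
Proof. by move=> Pi; rewrite /omit (bigD1 i). Qed.

Lemma card_omit (P : pred 'I_m) i : P i ->
  #|P| = #|[pred j | P j && (j != i)]|.+1.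
Proof.
move=> Pi; rewrite (cardD1 i) [i \in P]Pi; congr _.+1.
by apply: eq_card => j; rewrite !inE andbC.
Qed.

Lemma omit_deriv (P : pred 'I_m) (x : V) :
  deriv (omit P x) = \sum_(i | P i) x i *: omit (fun j => P j && (j != i)) x.
Proof.
have [n] := ubnP #|P|; elim: n P => // n IH P; rewrite ltnS => Pn.
case: (pickP P) => [i0 Pi0|P0]; last first.
  by rewrite big_pred0// /omit big_pred0// derivC.
rewrite (omitD1 x Pi0) derivM derivD derivC add0r derivZ derivX IH; last first.
  by rewrite -ltnS -(card_omit Pi0).
rewrite [RHS](bigD1 i0)//= -scalerAl mul1r; congr (_ + _).
rewrite mulr_sumr; apply: eq_bigr => i /andP[Pi ii0].
rewrite -scalerAr; congr (_ *: _).
rewrite [RHS](@omitD1 _ _ i0); last by rewrite Pi0 eq_sym.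
by congr (_ * _); apply: eq_bigl => j; rewrite -!andbA [(j != i0) && _]andbC.
Qed.

Lemma coef_omitD1 (P : pred 'I_m) (x : V) i k : P i ->
  (omit P x)`_k.+1 = (omit (fun j => P j && (j != i)) x)`_k.+1 +
    x i * (omit (fun j => P j && (j != i)) x)`_k.
Proof.
by move=> Pi; rewrite (omitD1 x Pi) mulrDl mul1r -scalerAl coefD coefZ coefXM.
Qed.

Lemma coef0_omit (P : pred 'I_m) (x : V) : (omit P x)`_0 = 1.
Proof.
rewrite -horner_coef0 /omit horner_prod big1// => i _.
by rewrite hornerD hornerZ hornerX hornerC mulr0 addr0.
Qed.

(** A monomial of degree [k + 1] arises once from each of its variables; the derivative of the
    generating polynomial does this count. *)
Lemma sum_mul_coef_omit (P : pred 'I_m) (x : V) k :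
  \sum_(i | P i) x i * (omit (fun j => P j && (j != i)) x)`_k =
  k.+1%:R * (omit P x)`_k.+1.
Proof.
rewrite mulr_natl -coef_deriv omit_deriv coef_sum.
by apply: eq_bigr => i _; rewrite coefZ.
Qed.

(** A monomial of degree [k] survives the omission of each variable outside it, hence is counted
    [#|P| - k] times. *)
Lemma sum_coef_omit (P : pred 'I_m) (x : V) k :
  \sum_(i | P i) (omit (fun j => P j && (j != i)) x)`_k =
  (#|P|%:R - k%:R) * (omit P x)`_k.
Proof.
case: k => [|k].
  under eq_bigr do rewrite coef0_omit.
  by rewrite coef0_omit sumr_const subr0 mulr1.
rewrite mulrBl -sum_mul_coef_omit; apply/eqP; rewrite eq_sym subr_eq; apply/eqP.
rewrite -big_split /=; under [RHS]eq_bigr => i Pi do rewrite -coef_omitD1//.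
by rewrite sumr_const mulr_natl.
Qed.

Lemma elsym_full (x : V) : elsym m x = \prod_i x i.
Proof.
rewrite /elsym.
(* The vanishing above the top degree is part of the induction: it removes the first term of
   [coef_omitD1]. *)
suff H (P : pred 'I_m) : (omit P x)`_#|P| = \prod_(i | P i) x i /\
    forall k, (#|P| < k)%N -> (omit P x)`_k = 0.
  by have [<- _] := H predT; congr (_ `_ _); rewrite [RHS]card_ord.
have [n] := ubnP #|P|; elim: n P => // n IH P; rewrite ltnS => Pn.
case: (pickP P) => [i0 Pi0|P0]; last first.
  rewrite big_pred0// (eq_card0 P0) coef0_omit; split => // k k0.
  by rewrite /omit big_pred0// coef1 gtn_eqF.
have cP := card_omit Pi0.
have [|IH1 IH2] := IH (fun j => P j && (j != i0)); first by rewrite -cP.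
rewrite cP; split => [|[//|k]].
  by rewrite (coef_omitD1 _ _ Pi0) (bigD1 i0)//= IH2// add0r IH1.
by rewrite ltnS => kP; rewrite (coef_omitD1 _ _ Pi0) !IH2 ?mulr0 ?addr0// ltnW.
Qed.

End Aomoto.

Section Selberg.
Variables (R : realType).

Lemma EW_leb (I : finType) (W : R -> R) (f : (I -> R) -> R) :
  good_weight W -> pgrow f -> (forall g, 0 <= f g * \prod_i W (g i)) ->
  leb_int R I (fun g => (f g * \prod_i W (g i))%:E) = (EW W f)%:E.
Proof.
move=> gW pf f0; rewrite -EWE// ge0_integral_nu//.
exact: (measurable_int _ (EW_integrable gW pf)).
Qed.

Lemma pgrow_coef_omit m (P : pred 'I_m) k : pgrow (fun x : 'I_m -> R => (omit P x)`_k).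
Proof.
rewrite /omit; elim: (index_enum _) k => [|i r IH] k.
  rewrite (_ : (fun _ => _) = (fun=> (1 : {poly R})`_k)); first exact: pgrow_cst.
  by apply/funext => x; rewrite big_nil.
case: (boolP (P i)) => Pi; last first.
  by rewrite (_ : (fun _ => _) = (fun x => (\prod_(j <- r | P j) (1 + x j *: 'X))`_k))//;
    apply/funext => x; rewrite big_cons (negPf Pi).
rewrite (_ : (fun _ => _) = (fun x => (\prod_(j <- r | P j) (1 + x j *: 'X))`_k +
   x i * (if k is k'.+1 then (\prod_(j <- r | P j) (1 + x j *: 'X))`_k' else 0))).
  apply: pgrowD => //; apply: pgrowM; first exact: pgrow_coord.
  by case: k => [|k]; [exact: pgrow_cst|exact: IH].
apply/funext => x; rewrite big_cons Pi mulrDl mul1r -scalerAl coefD coefZ coefXM.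
by case: k.
Qed.

Definition selberg m (s : R) k := EW (wexp s) (fun x : 'I_m -> R => chi x * vdm x * elsym k x).

(** [chamber_loop] for the field [x_i * e_k] with [x_i] omitted from [e_k]. Its [i]-th component has
    derivative [e_k] without [x_i], and its divided differences are [e_k] without [x_i] and [x_j],
    so both sums are multiples of [e_k]. *)
Lemma aomoto m (s : R) k : 0 < s ->
  2 * s * k.+1%:R * selberg m s k.+1 = (m%:R - k%:R) * (m%:R - k%:R + 1) * selberg m s k.
Proof.
move=> s0; have gW := wexp_good s0.
pose F i (x : 'I_m -> R) := (omit (fun j => predT j && (j != i)) x)`_k.
(* The factor [(i != j)%:R] removes the diagonal, so that [sum_lt_sym] gives exactly the double sum
   over distinct indices. *)
pose G (i j : 'I_m) (x : 'I_m -> R) :=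
  (omit (fun l => [&& predT l, l != i & l != j]) x)`_k * (i != j)%:R.
have H := @chamber_loop R m s (fun i x => x i * F i x) F G s0.
have pF i : pgrow (F i) by exact: pgrow_coef_omit.
have pE l : pgrow (fun x : 'I_m -> R => chi x * vdm x * elsym l x).
  by apply: pgrow_cv; exact: pgrow_coef_omit.
have eF (x : 'I_m -> R) : \sum_i x i * F i x = k.+1%:R * elsym k.+1 x.
  exact: (@sum_mul_coef_omit _ _ predT).
have sF (x : 'I_m -> R) : \sum_i F i x = (m%:R - k%:R) * elsym k x.
  by rewrite /F (@sum_coef_omit _ _ predT) card_ord.
have symG x i j : G i j x = G j i x.
  rewrite /G eq_sym; congr (_ * _); congr ((polyseq _)`_k).
  by apply: eq_omit => l; rewrite /= andbC.
have sG (x : 'I_m -> R) : 2 * \sum_(p : 'I_m * 'I_m | (p.1 < p.2)%N) G p.1 p.2 x =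
    (m%:R - k%:R - 1) * (m%:R - k%:R) * elsym k x.
  rewrite (sum_lt_sym (symG x)) [X in _ - X]big1 ?subr0; last first.
    by move=> i _; rewrite /G eqxx mulr0.
  rewrite -mulrA -sF mulr_sumr; apply: eq_bigr => i _.
  rewrite (bigD1 i)//= {1}/G eqxx mulr0 add0r.
  transitivity (\sum_(j | predT j && (j != i)) (omit (fun l => (predT l && (l != i)) && (l != j)) x)`_k).
    apply: eq_bigr => j ji; rewrite /G eq_sym ji mulr1; congr ((polyseq _)`_k).
  rewrite (sum_coef_omit (fun j => predT j && (j != i))); congr (_ * _).
  have -> : #|[pred j : 'I_m | predT j && (j != i)]| = m.-1.
    by have := @card_omit m predT i isT; rewrite [LHS]card_ord => /(congr1 predn) /= <-.
  by rewrite -[in RHS](prednK (leq_ltn_trans (leq0n i) (ltn_ord i))) -natr1; ring.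
have {}H : s * (k.+1%:R * selberg m s k.+1) =
    2^-1 * ((m%:R - k%:R) * (m%:R - k%:R + 1)) * selberg m s k.
  rewrite -[k.+1%:R * _]EWZ// -[RHS]EWZ//.
  transitivity (s * EW (wexp s) (fun x : 'I_m -> R => chi x * vdm x * \sum_i x i * F i x)).
    by congr (_ * _); apply: eq_EW => x; rewrite eF mulrCA.
  rewrite H.
  - apply: eq_EW => x; rewrite sF mulrCA; congr (_ * _).
    have := sG x; set T := \sum_(p | _) _ => e.
    have -> : T = 2^-1 * ((m%:R - k%:R - 1) * (m%:R - k%:R) * elsym k x).
      by rewrite -e mulrA mulVf// mul1r.
    by field.
  - move=> i; have pd0 : pd i (F i) (fun=> 0).
      move=> g; exists (F i g)%:P => t; rewrite derivC !hornerC; split => //.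
      rewrite /F /omit; congr ((polyseq _)`_k); apply: eq_bigr => j /= ji.
      by rewrite updE (negPf ji).
    by apply: (eq_pd _ _ (pdM (pd_coord i i) pd0)) => x //; rewrite eqxx mul1r mulr0 addr0.
  - by move=> i; apply: pgrowM => //; exact: pgrow_coord.
  - by [].
  - by move=> i j; apply: pgrowM; [exact: pgrow_coef_omit|exact: pgrow_cst].
  - by move=> i x ->; rewrite mul0r.
  - move=> i j x; rewrite /G; case: (eqVneq i j) => [->|ij]; first by rewrite !subrr mul0r.
    rewrite mulr1 /F.
    set w := omit (fun l => [&& _, _ & _]) x.
    have ei : omit (fun l => predT l && (l != i)) x = (1 + x j *: 'X) * w.
      rewrite (@omitD1 _ _ _ _ j) ?[j == i]eq_sym ?ij//.
    have ej : omit (fun l => predT l && (l != j)) x = (1 + x i *: 'X) * w.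
      rewrite (@omitD1 _ _ _ _ i) ?ij//; congr (_ * _).
      by apply: eq_omit => l; rewrite /= andbC.
    rewrite ei ej !mulrDl !mul1r -!scalerAl !coefD !coefZ !coefXM.
    ring.
rewrite -!mulrA H; by field.
Qed.

Lemma selberg_full m s : 0 < s ->
  selberg m s m = selberg m s 0 * (m.+1)`!%:R / (2 * s) ^+ m.
Proof.
move=> s0; have ns : 2 * s != 0 by rewrite mulf_neq0 ?gt_eqF.
(* Telescoping of [aomoto], cleared of denominators: the left-hand side does not depend on [k]. *)
suff H k : (k <= m)%N ->
    selberg m s k * (2 * s) ^+ k * k`!%:R * (m - k)`!%:R * (m - k).+1`!%:R =
    selberg m s 0 * m`!%:R * m.+1`!%:R.
  have := H m (leqnn m); rewrite subnn fact0 factS fact0 !muln1 !mulr1 => e.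
  have mf : m`!%:R != 0 :> R by rewrite pnatr_eq0 -lt0n fact_gt0.
  have nz : (2 * s) ^+ m != 0 by exact: expf_neq0.
  apply: (mulIf mf); apply: (mulIf nz); rewrite mulrAC e.
  by move: nz; set u := _ ^+ m => nz; field.
elim: k => [|k IH] km; first by rewrite subn0 expr0 fact0 !mulr1.
rewrite -IH 1?ltnW//.
have -> : (m - k = (m - k.+1).+1)%N by rewrite subnSK.
set d := (m - k.+1)%N; have md : m%:R - k%:R = d.+1%:R :> R.
  by rewrite -natrB 1?ltnW// /d subnSK.
have := aomoto m k s0; rewrite md => e.
rewrite exprS (factS k) (factS d.+1) (factS d) !natrM.
have -> : d.+2%:R = d.+1%:R + 1 :> R by rewrite natr1.
transitivity (2 * s * k.+1%:R * selberg m s k.+1 * (2 * s) ^+ k * k`!%:R * d`!%:R *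
  (d.+1%:R * d`!%:R)).
  ring.
by rewrite e; ring.
Qed.

End Selberg.

(** * Recursion in the number of variables *)

Section Zrec.
Variables (R : realType).
Local Notation leb := (@lebesgue_measure R).

Definition glue n (y : 'I_n -> R) (t : R) : 'I_n.+1 -> R :=
  fun i => if unlift ord_max i is Some j then y j else t.

Lemma glue_max n (y : 'I_n -> R) t : glue y t ord_max = t.
Proof. by rewrite /glue unlift_none. Qed.

Lemma glue_lift n (y : 'I_n -> R) t j : glue y t (lift ord_max j) = y j.
Proof. by rewrite /glue liftK. Qed.

Lemma glue_widen n (y : 'I_n -> R) t j : glue y t (widen_ord (leqnSn n) j) = y j.
Proof.
by rewrite -[RHS](glue_lift y t); congr glue; apply: val_inj; rewrite [RHS]lift_max.
Qed.

Lemma vdm_glue n (y : 'I_n -> R) t :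
  vdm (glue y t) = vdm (fun i => y i - t) * \prod_i (y i - t).
Proof.
rewrite /vdm /vandermonde big_ord_recr /=.
rewrite [X in _ * X]big_pred0 ?mulr1; last first.
  by move=> j; apply/negbTE; rewrite -leqNgt -ltnS.
rewrite -big_split /=; apply: eq_bigr => i _.
rewrite big_mkcond big_ord_recr /= ltn_ord glue_max glue_widen; congr (_ * _).
rewrite [RHS]big_mkcond; apply: eq_bigr => j _; rewrite glue_widen /=.
by case: ifP => // _; rewrite opprB addrA subrK.
Qed.

Lemma cham_glue n (y : 'I_n -> R) t :
  cham (glue y t) = (0 < t) && cham (fun i => y i - t).
Proof.
apply/chamP/andP => [[h1 h2]|[t0 /chamP[h1 h2]]]; split.
- by have := h2 ord_max; rewrite glue_max.
- apply/chamP; split => [i j ij|i].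
    rewrite ltrD2r; have := h1 (lift ord_max i) (lift ord_max j).
    by rewrite !glue_lift; apply; rewrite !lift_max.
  rewrite subr_gt0; have := h1 (lift ord_max i) ord_max; rewrite glue_lift glue_max.
  by apply; rewrite lift_max /=.
- move=> i j; case: (unliftP ord_max i) => [i' ->|->]; case: (unliftP ord_max j) => [j' ->|->].
  + rewrite !glue_lift => ij; rewrite -(ltrD2r (- t)); apply: h1.
    by move: ij; rewrite !lift_max.
  + by rewrite glue_lift glue_max -subr_gt0.
  + by rewrite lift_max /= ltnNge ltnW.
  + by rewrite ltnn.
- move=> i; case: (unliftP ord_max i) => [i' ->|->]; last by rewrite glue_max.
  by rewrite glue_lift; have := h2 i'; rewrite subr_gt0; apply: lt_trans.
Qed.

Lemma wexp_prod_cham n (x : 'I_n -> R) (s : R) : cham x ->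
  \prod_i wexp s (x i) = expR (- (s * \sum_i x i)).
Proof.
move=> /chamP[_ x0]; rewrite mulr_sumr -sumrN expR_sum.
by apply: eq_bigr => i _; rewrite /wexp (ltW (x0 i)).
Qed.

(** The differences to the least coordinate, coming from the Vandermonde factor, form [elsym n]; the
    [n + 1] copies of [t] in the sum of the coordinates give the rate [s * (n + 1)]. *)
Lemma glue_integrand n (y : 'I_n -> R) t (s : R) :
  chi (glue y t) * vdm (glue y t) * \prod_i wexp s (glue y t i) =
  (if 0 < t then expR (- (s * n.+1%:R * t)) else 0) *
  (let z i := y i - t in chi z * vdm z * elsym n z * \prod_i wexp s (z i)).
Proof.
rewrite /chi cham_glue; case: ltP => t0 /=; last by rewrite !mul0r.
case: (boolP (cham _)) => cz; last by rewrite !mul0r mulr0.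
rewrite wexp_prod_cham; last by rewrite cham_glue t0.
rewrite wexp_prod_cham// vdm_glue elsym_full !mul1r mulrCA; congr (_ * _).
rewrite -expRD; congr expR.
rewrite big_ord_recr /= glue_max sumrB sumr_const card_ord.
under eq_bigr do rewrite glue_widen.
by rewrite -mulr_natl -[n.+1%:R]natr1; ring.
Qed.

(* Writing [x_i = y_i + t] with [t] the least coordinate, [t] integrates out and
   [vdm x] becomes [vdm y * prod_i y_i]. *)
Lemma selberg_rec n (s : R) : 0 < s -> selberg n.+1 s 0 = selberg n s n / (s * n.+1%:R).
Proof.
move=> s0; have gW := wexp_good s0.
have sn : 0 < s * n.+1%:R by rewrite mulr_gt0.
have pE m k : pgrow (fun x : 'I_m -> R => chi x * vdm x * elsym k x).
  by apply: pgrow_cv; exact: pgrow_coef_omit.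
have E0 m k (g : 'I_m -> R) : (k = m \/ k = 0)%N -> 0 <= chi g * vdm g * elsym k g * \prod_i wexp s (g i).
  move=> km; rewrite /chi; case: (boolP (cham g)) => cg; last by rewrite !mul0r.
  rewrite mul1r mulr_ge0//; last by apply: prodr_ge0 => i _; exact: wexp_ge0.
  rewrite mulr_ge0 ?(ltW (vdm_gt0 cg))//.
  case: km => ->; last by rewrite /elsym coef0_omit.
  by rewrite elsym_full; apply: prodr_ge0 => i _; have /chamP[_ /(_ i)/ltW] := cg.
have mE m k : measurable_fun [set: cfg R 'I_m]
    (fun x : 'I_m -> R => (chi x * vdm x * elsym k x * \prod_i wexp s (x i))%:E).
  exact: (measurable_int _ (EW_integrable gW (pE m k))).
suff : (selberg n.+1 s 0)%:E = ((s * n.+1%:R)^-1 * selberg n s n)%:E.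
  by case=> ->; rewrite mulrC.
rewrite /selberg -EW_leb//; last by move=> g; apply: E0; right.
rewrite leb_int_lift//; last by move=> g; rewrite lee_fin; apply: E0; right.
transitivity (\int[leb]_t ((if (0 < t)%R then expR (- (s * n.+1%:R * t)) else 0)%:E * (selberg n s n)%:E))%E.
  apply: eq_integral => t _.
  rewrite /selberg -EW_leb//; last by move=> g; apply: E0; left.
  rewrite -[X in _ = (_ * X)%E](leb_int_shift (- t) (mE n n)) //; last by move=> g; rewrite lee_fin; apply: E0; left.
  rewrite /leb_int -iintZl//; last 3 first.
  - exact: (measurableT_comp (mE n n) (measurable_shift _)).
  - by move=> g; rewrite lee_fin; apply: E0; left.
  - by case: ifP => // _; exact: expR_ge0.
  apply: eq_iint => y; rewrite -EFinM; congr (_%:E).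
  by rewrite -[LHS]/(chi (glue y t) * vdm (glue y t) * elsym 0 (glue y t) *
    \prod_i wexp s (glue y t i)) /elsym coef0_omit mulr1 glue_integrand.
have S0 : 0 <= selberg n s n.
  rewrite -lee_fin /selberg -EW_leb//; last by move=> g; apply: E0; left.
  by apply: iint_ge0 => g; rewrite lee_fin; apply: E0; left.
have me : measurable_fun setT (fun t => expR (- (s * n.+1%:R * t)) : R).
  by apply: continuous_measurable_fun; exact: continuous_expRMl.
have mif : measurable_fun setT (fun t : R => if 0 < t then expR (- (s * n.+1%:R * t)) else 0).
  by apply: measurable_fun_ifT => //; apply: measurable_fun_ltr.
rewrite ge0_integralZr//; last 2 first.
- exact/measurable_EFinP.
- by move=> t _; case: ifP => // _; rewrite lee_fin expR_ge0.
rewrite EFinM; congr (_ * _)%E; rewrite -integral_wexp//.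
transitivity (\int[leb]_(t in `]0%R, +oo[) (expR (- (s * n.+1%:R * t)))%:E)%E.
  rewrite [RHS]integral_mkcond; apply: eq_integral => t _.
  by rewrite patchE mem_setE in_itv/= andbT; case: ifP.
rewrite integral_itv_obnd_cbnd; last by apply/measurable_EFinP; exact: measurable_funTS.
rewrite integral_mkcond; apply: eq_integral => t _.
by rewrite patchE mem_setE in_itv/= andbT /wexp; case: ifP.
Qed.

Lemma selberg0 (s : R) : 0 < s -> selberg 0 s 0 = 1.
Proof.
move=> s0; have gW := wexp_good s0.
have pE : pgrow (fun x : 'I_0 -> R => chi x * vdm x * elsym 0 x).
  by apply: pgrow_cv; exact: pgrow_coef_omit.
have E (g : 'I_0 -> R) : chi g * vdm g * elsym 0 g * \prod_i wexp s (g i) = 1.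
  rewrite /elsym coef0_omit /vdm /vandermonde !big_ord0 !mulr1 /chi.
  by case: chamP => // -[]; split => -[].
apply: EFin_inj; rewrite /selberg -EW_leb//; last by move=> g; rewrite E.
by rewrite /leb_int enum_ord0 /= E.
Qed.

(** Passing from [n] to [n + 1] variables multiplies the integral by [n! / (2 ^ n * s ^ (n + 1))],
    by [selberg_rec] and [selberg_full]. *)
Lemma selbergE m (s : R) : 0 < s ->
  selberg m s 0 = (\prod_(1 <= j < m) (j`!)%:R) / 2 ^+ 'C(m, 2) / s ^+ 'C(m.+1, 2).
Proof.
move=> s0; have ns : s != 0 by rewrite gt_eqF.
elim: m => [|m IH].
  by rewrite selberg0// big_geq// bin0n bin_small// !expr0 !divr1.
rewrite selberg_rec// selberg_full// IH.
have -> : \prod_(1 <= j < m.+1) (j`!)%:R = \prod_(1 <= j < m) (j`!)%:R * m`!%:R :> R.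
  case: m {IH} => [|m]; first by rewrite !big_geq// fact0 mulr1.
  by rewrite big_nat_recr.
set P := \prod_(1 <= j < m) _.
have -> : s ^+ 'C(m.+2, 2) = s ^+ 'C(m.+1, 2) * (s * s ^+ m).
  by rewrite binS bin1 exprD exprS.
have -> : 2 ^+ 'C(m.+1, 2) = 2 ^+ 'C(m, 2) * 2 ^+ m :> R.
  by rewrite binS bin1 exprD.
have -> : (m.+1)`!%:R = m.+1%:R * m`!%:R :> R by rewrite factS natrM.
rewrite exprMn.
have n1 : (2 : R) ^+ 'C(m, 2) != 0 by rewrite expf_neq0.
have n2 : s ^+ 'C(m.+1, 2) != 0 by rewrite expf_neq0.
have n3 : (2 : R) ^+ m != 0 by rewrite expf_neq0.
have n4 : s ^+ m != 0 by rewrite expf_neq0.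
have n5 : m.+1%:R != 0 :> R by rewrite pnatr_eq0.
move: n1 n2 n3 n4 n5; move: (_ ^+ 'C(m, 2)) (s ^+ 'C(m.+1, 2)) (_ ^+ m) (s ^+ m) (m.+1%:R).
by move=> u1 u2 u3 u4 u5 n1 n2 n3 n4 n5; field; rewrite n1 n2 n3 n4 n5 ns.
Qed.

End Zrec.

(** * Gaussian complex symmetric matrices *)

Section SymMatrices.
Variables (R : realType) (m : nat).
Local Notation C := (R[i]).
Local Notation cRe := (@complex.Re R).
Local Notation cIm := (@complex.Im R).

Lemma cReD (x y : C) : cRe (x + y) = cRe x + cRe y. Proof. by case: x; case: y. Qed.
Lemma cImD (x y : C) : cIm (x + y) = cIm x + cIm y. Proof. by case: x; case: y. Qed.
Lemma cReM (x y : C) : cRe (x * y) = cRe x * cRe y - cIm x * cIm y.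
Proof. by case: x; case: y. Qed.
Lemma cImM (x y : C) : cIm (x * y) = cRe x * cIm y + cIm x * cRe y.
Proof. by case: x; case: y. Qed.
Lemma cRe_conj (x : C) : cRe (Num.conj x) = cRe x. Proof. by case: x. Qed.
Lemma cIm_conj (x : C) : cIm (Num.conj x) = - cIm x. Proof. by case: x. Qed.
Lemma conj_complex (a b : R) : Num.conj (Complex a b) = Complex a (- b).
Proof. by []. Qed.
Lemma cRe_real (x : R) (y : C) : cRe (real_complex R x * y) = x * cRe y.
Proof. by rewrite cReM /= mul0r subr0. Qed.
Lemma cRe_sum (K : Type) (r : seq K) (P : pred K) (F : K -> C) :
  cRe (\sum_(k <- r | P k) F k) = \sum_(k <- r | P k) cRe (F k).
Proof. by elim/big_rec2 : _ => // k x y _ <-; rewrite cReD. Qed.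
Lemma cIm_sum (K : Type) (r : seq K) (P : pred K) (F : K -> C) :
  cIm (\sum_(k <- r | P k) F k) = \sum_(k <- r | P k) cIm (F k).
Proof. by elim/big_rec2 : _ => // k x y _ <-; rewrite cImD. Qed.

Section PolyFunctions.
Variable I : finType.

Definition pdC (i : I) (f f' : (I -> R) -> C) :=
  pd i (fun g => cRe (f g)) (fun g => cRe (f' g)) /\
  pd i (fun g => cIm (f g)) (fun g => cIm (f' g)).

Definition pgrowC (f : (I -> R) -> C) :=
  pgrow (fun g => cRe (f g)) /\ pgrow (fun g => cIm (f g)).

Lemma eq_pdC i f1 f1' f2 f2' : f1 =1 f2 -> f1' =1 f2' -> pdC i f1 f1' -> pdC i f2 f2'.
Proof. by move=> /funext-> /funext->. Qed.

Lemma pdC_cst i c : pdC i (fun=> c) (fun=> 0).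
Proof. by split; exact: pd_cst. Qed.

Lemma pdCM i f1 f1' f2 f2' : pdC i f1 f1' -> pdC i f2 f2' ->
  pdC i (fun g => f1 g * f2 g) (fun g => f1' g * f2 g + f1 g * f2' g).
Proof.
move=> [r1 i1] [r2 i2]; split.
  apply: (eq_pd _ _ (pdB (pdM r1 r2) (pdM i1 i2))) => g; rewrite ?cReD !cReM //; ring.
apply: (eq_pd _ _ (pdD (pdM r1 i2) (pdM i1 r2))) => g; rewrite ?cImD !cImM //; ring.
Qed.

Lemma pdC_sum i (K : Type) (r : seq K) (P : pred K) (f f' : K -> (I -> R) -> C) :
  (forall k, P k -> pdC i (f k) (f' k)) ->
  pdC i (fun g => \sum_(k <- r | P k) f k g) (fun g => \sum_(k <- r | P k) f' k g).
Proof.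
move=> h; split.
  have hr k : P k -> pd i (fun g => cRe (f k g)) (fun g => cRe (f' k g)) by move=> /h[].
  by apply: (eq_pd _ _ (pd_sum r hr)) => g; rewrite cRe_sum.
have hi k : P k -> pd i (fun g => cIm (f k g)) (fun g => cIm (f' k g)) by move=> /h[].
by apply: (eq_pd _ _ (pd_sum r hi)) => g; rewrite cIm_sum.
Qed.

Lemma pgrowC_cst c : pgrowC (fun=> c).
Proof. by split; exact: pgrow_cst. Qed.

Lemma eq_pgrow (f f' : (I -> R) -> R) : f =1 f' -> pgrow f -> pgrow f'.
Proof. by move=> /funext->. Qed.

Lemma pgrowCD f1 f2 : pgrowC f1 -> pgrowC f2 -> pgrowC (fun g => f1 g + f2 g).
Proof.
move=> [r1 i1] [r2 i2]; split.
  by apply: (eq_pgrow _ (pgrowD r1 r2)) => g; rewrite cReD.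
by apply: (eq_pgrow _ (pgrowD i1 i2)) => g; rewrite cImD.
Qed.

Lemma pgrowCM f1 f2 : pgrowC f1 -> pgrowC f2 -> pgrowC (fun g => f1 g * f2 g).
Proof.
move=> [r1 i1] [r2 i2]; split.
  by apply: (eq_pgrow _ (pgrowB (pgrowM r1 r2) (pgrowM i1 i2))) => g; rewrite cReM.
by apply: (eq_pgrow _ (pgrowD (pgrowM r1 i2) (pgrowM i1 r2))) => g; rewrite cImM.
Qed.

Lemma pgrowC_sum (K : Type) (r : seq K) (P : pred K) (f : K -> (I -> R) -> C) :
  (forall k, P k -> pgrowC (f k)) -> pgrowC (fun g => \sum_(k <- r | P k) f k g).
Proof.
move=> h; split.
  have hr k : P k -> pgrow (fun g => cRe (f k g)) by move=> /h[].
  by apply: (eq_pgrow _ (pgrow_sum r hr)) => g; rewrite cRe_sum.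
have hi k : P k -> pgrow (fun g => cIm (f k g)) by move=> /h[].
by apply: (eq_pgrow _ (pgrow_sum r hi)) => g; rewrite cIm_sum.
Qed.

Definition pdmx (i : I) (A A' : (I -> R) -> 'M[C]_m) :=
  forall a b, pdC i (fun g => A g a b) (fun g => A' g a b).
Definition pgrowmx (A : (I -> R) -> 'M[C]_m) := forall a b, pgrowC (fun g => A g a b).

Lemma eq_pdmx i A1 A1' A2 A2' : A1 =1 A2 -> A1' =1 A2' -> pdmx i A1 A1' -> pdmx i A2 A2'.
Proof. by move=> /funext-> /funext->. Qed.

Lemma pdmx_cst i X : pdmx i (fun=> X) (fun=> 0).
Proof. by move=> a b; apply: (eq_pdC _ _ (pdC_cst i (X a b))) => g //; rewrite mxE. Qed.

Lemma pdmxM i A A' B B' : pdmx i A A' -> pdmx i B B' ->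
  pdmx i (fun g => A g *m B g) (fun g => A' g *m B g + A g *m B' g).
Proof.
move=> hA hB a b.
have h k : predT k -> pdC i (fun g => A g a k * B g k b)
   (fun g => A' g a k * B g k b + A g a k * B' g k b) by move=> _; exact: pdCM.
apply: (eq_pdC _ _ (pdC_sum (index_enum _) h)) => g; rewrite !mxE//.
by rewrite -big_split.
Qed.

Lemma pdC_trace i A A' : pdmx i A A' -> pdC i (fun g => \tr (A g)) (fun g => \tr (A' g)).
Proof. by move=> h; apply: pdC_sum => k _; exact: h. Qed.

Lemma pgrowmxM A B : pgrowmx A -> pgrowmx B -> pgrowmx (fun g => A g *m B g).
Proof.
move=> hA hB a b.
have h k : predT k -> pgrowC (fun g => A g a k * B g k b) by move=> _; exact: pgrowCM.
have := pgrowC_sum (index_enum _) h.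
by rewrite (_ : (fun g => _) = (fun g => (A g *m B g) a b))//; apply/funext => g; rewrite mxE.
Qed.

Lemma pgrowmxD A B : pgrowmx A -> pgrowmx B -> pgrowmx (fun g => A g + B g).
Proof.
move=> hA hB a b; have := pgrowCD (hA a b) (hB a b).
by rewrite (_ : (fun g => _) = (fun g => (A g + B g) a b))//; apply/funext => g; rewrite mxE.
Qed.

Lemma pgrowmx_sum (K : Type) (r : seq K) (A : K -> (I -> R) -> 'M[C]_m) :
  (forall k, pgrowmx (A k)) -> pgrowmx (fun g => \sum_(k <- r) A k g).
Proof.
move=> hA a b; have := pgrowC_sum r (P := predT) (fun k _ => hA k a b).
by rewrite (_ : (fun g => _) = (fun g => (\sum_(k <- r) A k g) a b))//;
  apply/funext => g; rewrite summxE.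
Qed.

Lemma pgrowmx_cst X : pgrowmx (fun=> X).
Proof. by move=> a b; exact: pgrowC_cst. Qed.

Lemma pgrowC_trace A : pgrowmx A -> pgrowC (fun g => \tr (A g)).
Proof. by move=> h; apply: pgrowC_sum => k _; exact: h. Qed.

Lemma pgrowmxX A n : pgrowmx A -> pgrowmx (fun g => A g ^+ n).
Proof.
move=> hA; elim: n => [|n IH]; first exact: pgrowmx_cst.
have := pgrowmxM hA IH.
by rewrite (_ : (fun g => _) = (fun g => A g ^+ n.+1))//; apply/funext => g; rewrite exprS.
Qed.

End PolyFunctions.

Definition J := (sym_index m * bool)%type.

(** The coordinates of [x] are filled with 0, so that [symH] serves for matrices alone. *)
Definition ext (g : J -> R) : coord_index m -> R :=
  fun c => match c with inl j => g j | inr _ => 0 end.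

Definition Hm (g : J -> R) : 'M[C]_m := symH R m (ext g).
Definition Hs (g : J -> R) : 'M[C]_m := adjmx R m (Hm g).

Definition delta (c : J) : J -> R := fun j => (j == c)%:R.
(** [Hm] is real linear, so its derivative along [c] is its value at the unit vector. These matrices
    form an orthonormal basis over the reals. *)
Definition Bm (c : J) : 'M[C]_m := Hm (delta c).
Definition Bs (c : J) : 'M[C]_m := Hs (delta c).

Fact ordp_subproof (i j : 'I_m) :
  ((if (i <= j)%N then (i, j) else (j, i)).1 <= (if (i <= j)%N then (i, j) else (j, i)).2)%N.
Proof. by case: ifP => //= /negbT; rewrite -ltnNge => /ltnW. Qed.

Definition ordp (i j : 'I_m) : sym_index m :=
  exist _ (if (i <= j)%N then (i, j) else (j, i)) (ordp_subproof i j).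

Definition scal (i j : 'I_m) : R := if i == j then 1 else (Num.sqrt 2)^-1.

Lemma symHE (g : coord_index m -> R) a b : symH R m g a b =
  Complex (scal a b * g (inl (ordp a b, false))) (scal a b * g (inl (ordp a b, true))).
Proof.
have E t : sym_coord R m g a b t = g (inl (ordp a b, t)).
  rewrite /sym_coord insubT; first exact: ordp_subproof.
  by move=> h; congr (g (inl (_, t))); apply: val_inj.
by rewrite mxE !E.
Qed.

Lemma HmE g a b : Hm g a b =
  Complex (scal a b * g (ordp a b, false)) (scal a b * g (ordp a b, true)).
Proof. by rewrite /Hm symHE. Qed.

Lemma HsE g a b : Hs g a b = Num.conj (Hm g b a).
Proof. by rewrite /Hs /adjmx !mxE. Qed.

Lemma ordpC a b : ordp a b = ordp b a.
Proof.
apply: val_inj => /=; case: (ltngtP a b) => // ab.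
by have -> : a = b by apply: val_inj.
Qed.

Lemma scalC a b : scal a b = scal b a. Proof. by rewrite /scal eq_sym. Qed.

Lemma Hm_sym g : (Hm g)^T = Hm g.
Proof. by apply/matrixP => a b; rewrite mxE !HmE scalC ordpC. Qed.

Lemma Hs_sym g : (Hs g)^T = Hs g.
Proof. by apply/matrixP => a b; rewrite mxE !HsE !HmE scalC ordpC. Qed.

Lemma pdmx_Hm (c : J) : pdmx c Hm (fun=> Bm c).
Proof.
move=> a b; split.
  by apply: (eq_pd _ _ (pdZ (scal a b) (pd_coord c (ordp a b, false)))) => g;
    rewrite /Bm HmE.
by apply: (eq_pd _ _ (pdZ (scal a b) (pd_coord c (ordp a b, true)))) => g;
    rewrite /Bm HmE.
Qed.

Lemma pdmx_Hs (c : J) : pdmx c Hs (fun=> Bs c).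
Proof.
move=> a b; have [hr hi] := pdmx_Hm c b a; split.
  by apply: (eq_pd _ _ hr) => g; rewrite ?/Bs HsE cRe_conj.
by apply: (eq_pd _ _ (pdZ (-1) hi)) => g; rewrite ?/Bs HsE cIm_conj mulN1r.
Qed.

Lemma pgrowmx_Hm : pgrowmx Hm.
Proof.
move=> a b; split.
  by apply: (eq_pgrow _ (pgrowM (pgrow_cst _ (scal a b)) (pgrow_coord _ (ordp a b, false)))) => g;
    rewrite HmE.
by apply: (eq_pgrow _ (pgrowM (pgrow_cst _ (scal a b)) (pgrow_coord _ (ordp a b, true)))) => g;
    rewrite HmE.
Qed.

Lemma pgrowmx_Hs : pgrowmx Hs.
Proof.
move=> a b; have [hr hi] := pgrowmx_Hm b a; split.
  by apply: (eq_pgrow _ hr) => g; rewrite HsE cRe_conj.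
by apply: (eq_pgrow _ (pgrowN hi)) => g; rewrite HsE cIm_conj.
Qed.

Definition Br (p : sym_index m) : 'M[C]_m := Bm (p, false).
Local Notation ic := (Complex (0 : R) (1 : R)).

Lemma BrE p a b : Br p a b = real_complex R (scal a b * (ordp a b == p)%:R).
Proof. by rewrite /Br /Bm HmE /delta !xpair_eqE andbT andbF mulr0. Qed.

Lemma Bm_true p : Bm (p, true) = ic *: Br p.
Proof.
apply/matrixP => a b; rewrite [RHS]mxE BrE /Bm HmE /delta !xpair_eqE andbT andbF mulr0.
by apply/eqP; rewrite eq_complex /=; apply/andP; split; apply/eqP; ring.
Qed.

Lemma Bs_false p : Bs (p, false) = Br p.
Proof.
apply/matrixP => a b; rewrite /Bs HsE -[Hm _]/(Br p) !BrE scalC ordpC.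
by rewrite conj_complex oppr0.
Qed.

Lemma Bs_true p : Bs (p, true) = - (ic *: Br p).
Proof.
apply/matrixP => a b; rewrite /Bs HsE -[Hm _]/(Bm (p, true)) Bm_true [RHS]mxE [in RHS]mxE.
rewrite [X in Num.conj X]mxE !BrE scalC ordpC.
by apply/eqP; rewrite eq_complex /=; apply/andP; split; apply/eqP; ring.
Qed.

Lemma ordp_eq a b c d : (ordp a b == ordp c d) =
  ((a == c) && (b == d)) || ((a == d) && (b == c)).
Proof.
apply/eqP/idP => [/(congr1 val) /=|/orP[] /andP[/eqP-> /eqP->] //]; last first.
  by rewrite ordpC.
by case: (a <= b)%N; case: (c <= d)%N => -[-> ->]; rewrite !eqxx ?orbT.
Qed.

Lemma scal_sq a b : scal a b * scal a b = if a == b then 1 else 2^-1.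
Proof.
rewrite /scal; case: eqP => _; first by rewrite mulr1.
by rewrite -invfM -expr2 sqr_sqrtr.
Qed.

(** Completeness of the orthonormal basis [Br]: the right-hand side is the kernel of the projection
    of a matrix onto its symmetric part. *)
Lemma Br_complete a b c d : \sum_p Br p a b * Br p c d =
  2^-1 * ((((a == c) && (b == d))%:R + ((a == d) && (b == c))%:R)).
Proof.
transitivity (real_complex R (2^-1 * ((((a == c) && (b == d))%:R + ((a == d) && (b == c))%:R))));
  last by rewrite rmorphM rmorphD !rmorph_nat fmorphV rmorph_nat.
transitivity (real_complex R (scal a b * scal c d * (ordp a b == ordp c d)%:R)).
  under eq_bigr do rewrite !BrE -rmorphM mulrACA -natrM mulnb.
  rewrite (bigD1 (ordp a b)) //= big1 ?addr0; first by rewrite eqxx eq_sym.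
  by move=> p pn; rewrite [ordp a b == p]eq_sym (negPf pn) mulr0.
congr (real_complex R _); rewrite ordp_eq.
case: (boolP ((a == c) && (b == d))) => [/andP[/eqP <- /eqP <-]|h1] /=.
  rewrite scal_sq mulr1; case: (eqVneq a b) => [_|ab] /=; first by rewrite -natrD mulVf.
  by rewrite addr0 mulr1.
case: (boolP ((a == d) && (b == c))) => [/andP[/eqP e1 /eqP e2]|h2] /=.
  rewrite add0r !mulr1 -e1 -e2 [scal b a]scalC scal_sq.
  by case: (eqVneq a b) h1 => [ab|//]; rewrite -e1 -e2 ab eqxx.
by rewrite addr0 !mulr0.
Qed.

(** In [Br_complete], contracted with [X] in the inner indices, one pairing transposes [X] and the
    other closes a trace. *)
Lemma Br_sandwich (X : 'M[C]_m) :
  \sum_p Br p *m X *m Br p = 2^-1 *: (X^T + (\tr X)%:M).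
Proof.
apply/matrixP => a d; rewrite summxE !mxE.
transitivity (\sum_b \sum_c X b c * \sum_p Br p a b * Br p c d).
  transitivity (\sum_p \sum_b \sum_c X b c * (Br p a b * Br p c d)).
    apply: eq_bigr => p _; rewrite mxE exchange_big /=; apply: eq_bigr => c _.
    by rewrite mxE mulr_suml; apply: eq_bigr => b _; ring.
  rewrite exchange_big /=; apply: eq_bigr => b _.
  rewrite exchange_big /=; apply: eq_bigr => c _.
  by rewrite mulr_sumr.
transitivity (2^-1 * (\sum_b \sum_c X b c * ((a == c) && (b == d))%:R +
                     \sum_b \sum_c X b c * ((a == d) && (b == c))%:R)).
  rewrite -big_split /= mulr_sumr; apply: eq_bigr => b _.
  rewrite -big_split /= mulr_sumr; apply: eq_bigr => c _.
  by rewrite Br_complete; ring.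
congr (_ * (_ + _)).
  rewrite (bigD1 d)//= [X in _ + X]big1 ?addr0; last first.
    by move=> b bd; apply: big1 => c _; rewrite (negPf bd) andbF mulr0.
  rewrite (bigD1 a)//= big1 ?addr0; last first.
    by move=> c ca; rewrite eq_sym (negPf ca) mulr0.
  by rewrite !eqxx mulr1.
case: (eqVneq a d) => ad /=; last first.
  by rewrite mulr0n big1// => b _; apply: big1 => c _; rewrite mulr0.
rewrite mulr1n /mxtrace; apply: eq_bigr => b _.
rewrite (bigD1 b)//= eqxx mulr1 big1 ?addr0// => c cb.
by rewrite eq_sym (negPf cb) mulr0.
Qed.

Lemma Br_tr2 (X Y : 'M[C]_m) :
  \sum_p \tr (X *m Br p) * \tr (Br p *m Y) = 2^-1 * (\tr (X *m Y) + \tr (X *m Y^T)).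
Proof.
have E (U V : 'M[C]_m) : \tr (U *m V) = \sum_a \sum_b U a b * V b a.
  by rewrite /mxtrace; apply: eq_bigr => a _; rewrite mxE.
transitivity (\sum_a \sum_b \sum_c \sum_d X a b * Y d c * \sum_p Br p b a * Br p c d).
  transitivity (\sum_p \sum_a \sum_b \sum_c \sum_d X a b * Y d c * (Br p b a * Br p c d)).
    apply: eq_bigr => p _; rewrite !E mulr_suml; apply: eq_bigr => a _.
    rewrite mulr_suml; apply: eq_bigr => b _.
    rewrite mulr_sumr; apply: eq_bigr => c _.
    by rewrite mulr_sumr; apply: eq_bigr => d _; ring.
  rewrite exchange_big; apply: eq_bigr => a _.
  rewrite exchange_big; apply: eq_bigr => b _.
  rewrite exchange_big; apply: eq_bigr => c _.
  rewrite exchange_big; apply: eq_bigr => d _.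
  by rewrite mulr_sumr.
rewrite !E -big_split mulr_sumr; apply: eq_bigr => a _ /=.
rewrite -big_split mulr_sumr; apply: eq_bigr => b _ /=.
transitivity (\sum_c \sum_d 2^-1 * (X a b * Y d c * ((b == c) && (a == d))%:R) +
  \sum_c \sum_d 2^-1 * (X a b * Y d c * ((b == d) && (a == c))%:R)).
  rewrite -big_split; apply: eq_bigr => c _ /=.
  by rewrite -big_split; apply: eq_bigr => d _ /=; rewrite Br_complete; ring.
rewrite mulrDr addrC; congr (_ + _).
  rewrite (bigD1 a)//= [X in _ + X]big1 ?addr0; last first.
    by move=> c ca; apply: big1 => d _; rewrite [a == c]eq_sym (negPf ca) andbF !mulr0.
  rewrite (bigD1 b)//= big1 ?addr0; last first.
    by move=> d db; rewrite [b == d]eq_sym (negPf db) !mulr0.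
  by rewrite !eqxx mulr1.
rewrite (bigD1 b)//= [X in _ + X]big1 ?addr0; last first.
  by move=> c cb; apply: big1 => d _; rewrite [b == c]eq_sym (negPf cb) !mulr0.
rewrite (bigD1 a)//= big1 ?addr0; last first.
  by move=> d da; rewrite [a == d]eq_sym (negPf da) andbF !mulr0.
by rewrite !eqxx mulr1 mxE.
Qed.

End SymMatrices.

(** * Derivatives of traces of powers of H H^* *)

Section SymLoop.
Variables (R : realType) (m : nat).
Local Notation C := (R[i]).
Local Notation J := (J m).
Local Notation ic := (Complex (0 : R) (1 : R)).

Local Notation Bm := (@Bm R m).
Local Notation Bs := (@Bs R m).
Local Notation Br := (@Br R m).

Definition Am (g : J -> R) : 'M[C]_m := Hm g *m Hs g.
Definition trk (k : nat) (g : J -> R) : C := \tr (Am g ^+ k).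
Definition trprod (K : seq nat) (g : J -> R) : C := \prod_(k <- K) trk k g.

Definition dA (c : J) (g : J -> R) : 'M[C]_m := Bm c *m Hs g + Hm g *m Bs c.
Definition dpow (c : J) (k : nat) (g : J -> R) : 'M[C]_m :=
  \sum_(a < k) Am g ^+ a *m dA c g *m Am g ^+ (k - a.+1).

Lemma pdmx_Am c : pdmx c Am (dA c).
Proof. exact: (pdmxM (@pdmx_Hm R m c) (@pdmx_Hs R m c)). Qed.

Lemma pgrowmx_Am : pgrowmx Am.
Proof. exact: (pgrowmxM (@pgrowmx_Hm _ _) (@pgrowmx_Hs _ _)). Qed.

Lemma pgrowmx_dA c : pgrowmx (dA c).
Proof.
apply: pgrowmxD; apply: pgrowmxM; try exact: pgrowmx_cst.
- exact: pgrowmx_Hs.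
- exact: pgrowmx_Hm.
Qed.

Lemma dpowS c k g : dpow c k.+1 g = dA c g *m Am g ^+ k + Am g *m dpow c k g.
Proof.
rewrite /dpow big_ord_recl /= expr0 mul1mx subn1; congr (_ + _).
rewrite mulmx_sumr; apply: eq_bigr => a _.
by rewrite /bump /= add1n exprS !mulmxA subSS.
Qed.

Lemma pdmx_pow c k : pdmx c (fun g => Am g ^+ k) (dpow c k).
Proof.
elim: k => [|k IH].
  by apply: (eq_pdmx _ _ (pdmx_cst c 1)) => g //; rewrite /dpow big_ord0.
apply: (eq_pdmx _ _ (pdmxM (pdmx_Am c) IH)) => g; first by rewrite exprS.
by rewrite dpowS.
Qed.

Lemma pgrowmx_dpow c k : pgrowmx (dpow c k).
Proof.
apply: pgrowmx_sum => a; apply: pgrowmxM; first apply: pgrowmxM.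
- by apply: pgrowmxX; exact: pgrowmx_Am.
- exact: pgrowmx_dA.
- by apply: pgrowmxX; exact: pgrowmx_Am.
Qed.

Lemma pdC_trk c k : pdC c (trk k) (fun g => \tr (dpow c k g)).
Proof. by apply: pdC_trace; exact: pdmx_pow. Qed.

Lemma pgrowC_trk k : pgrowC (trk k).
Proof. by apply: pgrowC_trace; apply: pgrowmxX; exact: pgrowmx_Am. Qed.

Lemma pgrowC_trprod K : pgrowC (trprod K).
Proof.
elim: K => [|k K IH].
  rewrite (_ : trprod [::] = fun=> 1); first exact: pgrowC_cst.
  by apply/funext => g; rewrite /trprod big_nil.
rewrite (_ : trprod (k :: K) = fun g => trk k g * trprod K g).
  by apply: pgrowCM => //; exact: pgrowC_trk.
by apply/funext => g; rewrite /trprod big_cons.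
Qed.

Fixpoint Dtr (c : J) (K : seq nat) (g : J -> R) : C :=
  match K with
  | [::] => 0
  | l :: K' => \tr (dpow c l g) * trprod K' g + trk l g * Dtr c K' g
  end.

Lemma pdC_trprod c K : pdC c (trprod K) (Dtr c K).
Proof.
elim: K => [|l K IH] /=.
  by apply: (eq_pdC _ _ (pdC_cst c 1)) => g //; rewrite /trprod big_nil.
by apply: (eq_pdC _ _ (pdCM (pdC_trk c l) IH)) => g //; rewrite /trprod big_cons.
Qed.

Lemma pgrowC_Dtr c K : pgrowC (Dtr c K).
Proof.
elim: K => [|l K IH] /=; first exact: pgrowC_cst.
apply: pgrowCD; apply: pgrowCM => //.
- by apply: pgrowC_trace; exact: pgrowmx_dpow.
- exact: pgrowC_trprod.
- exact: pgrowC_trk.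
Qed.

(** By cyclicity all [k] terms of the Leibniz sum have the same trace; at [k = 0] the factor [k%:R]
    makes the exponent [k.-1] harmless. *)
Lemma tr_dpow c k g : \tr (dpow c k g) = k%:R * \tr (dA c g *m Am g ^+ k.-1).
Proof.
rewrite /dpow linear_sum /=.
rewrite (eq_bigr (fun=> \tr (dA c g *m Am g ^+ k.-1))).
  by rewrite sumr_const card_ord mulr_natl.
move=> a _; rewrite -mulmxA mxtrace_mulC -mulmxA; congr (\tr (_ *m _)).
rewrite mulmxE -exprD; congr (_ ^+ _).
by case: k a => [[]//|k] a /=; rewrite subSS subnK// -ltnS.
Qed.

Lemma Am_tr g : (Am g)^T = Hs g *m Hm g.
Proof. by rewrite /Am trmx_mul Hm_sym Hs_sym. Qed.

Lemma Am_pow_tr g k : (Am g ^+ k)^T = (Hs g *m Hm g) ^+ k.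
Proof.
elim: k => [|k IH]; first by rewrite !expr0 trmx1.
by rewrite exprS exprSr -mulmxE trmx_mul IH Am_tr mulmxE.
Qed.

Lemma Hm_pow g k : Hm g *m (Hs g *m Hm g) ^+ k = Am g ^+ k *m Hm g.
Proof.
elim: k => [|k IH]; first by rewrite !expr0 mulmx1 mul1mx.
rewrite exprSr -mulmxE mulmxA IH exprSr -mulmxE -!mulmxA; congr (_ *m _).
Qed.

Lemma sum_J (T : nmodType) (F : J -> T) : \sum_c F c = \sum_p (F (p, false) + F (p, true)).
Proof.
transitivity (\sum_p \sum_t F (p, t)); first by rewrite pair_bigA; apply: eq_bigr => -[].
by apply: eq_bigr => p _; rewrite big_bool addrC.
Qed.

Let ic2 : ic * ic = -1.
Proof. by apply/eqP; rewrite eq_complex /=; apply/andP; split; apply/eqP; ring. Qed.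

(* Over the two directions [1] and [i] of a matrix entry, the part of the derivative
   of [H H^*] coming from [H^*] cancels and the part coming from [H] doubles. *)
Lemma twist_cancel (X Z Y B : 'M[C]_m) :
  X *m (ic *: Z) *m Y *m (- (ic *: B)) = X *m Z *m Y *m B.
Proof.
rewrite mulmxN -scalemxAr -scalemxAr -!scalemxAl scalerA ic2.
by rewrite scaleN1r opprK.
Qed.

Lemma twist_sum (X Y B U V : 'M[C]_m) :
  \tr (X *m (B *m U + V *m B) *m Y *m B) +
  \tr (X *m ((ic *: B) *m U + V *m (- (ic *: B))) *m Y *m (- (ic *: B))) =
  2 * \tr (X *m B *m (U *m Y) *m B).
Proof.
have -> : (ic *: B) *m U + V *m (- (ic *: B)) = ic *: (B *m U - V *m B).
  by rewrite mulmxN -scalemxAl -scalemxAr scalerBr.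
rewrite twist_cancel -mxtraceD -!mulmxDl -mulmxDr addrACA subrr addr0.
by rewrite -mulr2n mulr2n mulmxDr !mulmxDl mxtraceD !mulmxA mulr2n mulrDl mul1r.
Qed.

Lemma sum_dA_quad (X Y : 'M[C]_m) g :
  \sum_c \tr (X *m dA c g *m Y *m Bs c) =
  2 * \sum_p \tr (X *m Br p *m (Hs g *m Y) *m Br p).
Proof.
rewrite sum_J mulr_sumr; apply: eq_bigr => p _.
by rewrite /dA Bm_true Bs_true Bs_false -/(Br p) twist_sum.
Qed.

Lemma twist_cancel2 (X Z B : 'M[C]_m) :
  \tr (X *m (- (ic *: B))) * \tr (ic *: Z) = \tr (X *m B) * \tr Z.
Proof.
by rewrite mulmxN -scalemxAr raddfN /= !mxtraceZ mulNr mulrACA ic2 mulN1r opprK.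
Qed.

Lemma twist_sum2 (X Y B U V : 'M[C]_m) :
  \tr (X *m B) * \tr ((B *m U + V *m B) *m Y) +
  \tr (X *m (- (ic *: B))) * \tr (((ic *: B) *m U + V *m (- (ic *: B))) *m Y) =
  2 * (\tr (X *m B) * \tr (B *m (U *m Y))).
Proof.
have -> : (ic *: B) *m U + V *m (- (ic *: B)) = ic *: (B *m U - V *m B).
  by rewrite mulmxN -scalemxAl -scalemxAr scalerBr.
rewrite -scalemxAl twist_cancel2 -mulrDr -mxtraceD -mulmxDl addrACA subrr addr0.
by rewrite mulmxDl mxtraceD mulmxA mulrDr mulr2n mulrDl mul1r.
Qed.

Lemma sum_dA_tr (X Y : 'M[C]_m) g :
  \sum_c \tr (X *m Bs c) * \tr (dA c g *m Y) =
  2 * \sum_p \tr (X *m Br p) * \tr (Br p *m (Hs g *m Y)).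
Proof.
rewrite sum_J mulr_sumr; apply: eq_bigr => p _.
by rewrite /dA Bm_true Bs_true Bs_false -/(Br p) twist_sum2.
Qed.

Lemma sum_Bm_Bs (X : 'M[C]_m) :
  \sum_c \tr (X *m Bm c *m Bs c) = 2 * \sum_p \tr (X *m Br p *m 1%:M *m Br p).
Proof.
rewrite sum_J mulr_sumr; apply: eq_bigr => p _.
rewrite Bm_true Bs_true Bs_false -/(Br p) mulmx1.
have -> : X *m (ic *: Br p) *m - (ic *: Br p) = X *m Br p *m Br p.
  by have := twist_cancel X (Br p) 1%:M (Br p); rewrite !mulmx1.
by rewrite mulr2n mulrDl mul1r.
Qed.

Lemma sandwich_tr (X Y : 'M[C]_m) :
  2 * \sum_p \tr (X *m Br p *m Y *m Br p) = \tr (X *m Y^T) + \tr X * \tr Y.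
Proof.
have -> : \sum_p \tr (X *m Br p *m Y *m Br p) = \tr (X *m \sum_p (Br p *m Y *m Br p)).
  rewrite mulmx_sumr linear_sum /=; apply: eq_bigr => p _.
  by rewrite !mulmxA.
rewrite Br_sandwich -scalemxAr mxtraceZ mulrA mulfV ?mul1r; last by rewrite pnatr_eq0.
by rewrite mulmxDr mxtraceD mul_mx_scalar mxtraceZ [\tr Y * _]mulrC.
Qed.

(** What remains of [Am ^ (k + 1)] when its last factor [Hs] is split off. That factor is linear in
    the coordinates, which is the form required by Stein's identity. *)
Definition Wk (k : nat) (g : J -> R) : 'M[C]_m := Am g ^+ k *m Hm g.

Lemma Wk_sym k g : (Wk k g)^T = Wk k g.
Proof. by rewrite /Wk trmx_mul Hm_sym Am_pow_tr Hm_pow. Qed.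

Lemma Wk_Hs k g : Wk k g *m Hs g = Am g ^+ k.+1.
Proof. by rewrite /Wk -mulmxA -/(Am g) exprSr. Qed.

Definition dWk (c : J) k g : 'M[C]_m := dpow c k g *m Hm g + Am g ^+ k *m Bm c.

Lemma pdmx_Wk c k : pdmx c (Wk k) (dWk c k).
Proof. exact: (pdmxM (pdmx_pow c k) (@pdmx_Hm R m c)). Qed.

(** Each of the [k + 1] occurrences of [H] is differentiated. The transposed term of [sandwich_tr]
    gives [trk k] each time, and the trace term splits the power into [trk a * trk (k - a)]; the
    last occurrence gives [a = k]. *)
Lemma sum_dWk k g : \sum_c \tr (dWk c k g *m Bs c) =
  k.+1%:R * trk k g + \sum_(a < k.+1) trk a g * trk (k - a) g.
Proof.
rewrite /dWk; under eq_bigr do rewrite mulmxDl mxtraceD.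
rewrite big_split /= sum_Bm_Bs sandwich_tr trmx1 mulmx1.
rewrite [X in X + _ = _](_ : _ = \sum_(a < k) (trk k g + trk a g * trk (k - a) g)).
  rewrite big_split /= sumr_const card_ord big_ord_recr /= subnn.
  have -> : trk 0 g = \tr (1%:M : 'M[C]_m) by rewrite /trk expr0.
  by rewrite -!addrA -[_ *+ k]mulr_natl -natr1 -/(trk k g); ring.
transitivity (\sum_(a < k) \sum_c \tr (Am g ^+ a *m dA c g *m (Am g ^+ (k - a.+1) *m Hm g) *m Bs c)).
  rewrite [RHS]exchange_big /=; apply: eq_bigr => c _.
  rewrite /dpow !mulmx_suml linear_sum /=; apply: eq_bigr => a _.
  by rewrite !mulmxA.
apply: eq_bigr => a _; rewrite sum_dA_quad sandwich_tr.
have e : (k - a = (k - a.+1).+1)%N by rewrite subnSK.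
congr (_ + _).
  rewrite !trmx_mul Hm_sym Hs_sym Am_pow_tr Hm_pow -mulmxA -/(Am g).
  rewrite !mulmxE -exprSr -exprD -e subnKC//; exact: ltnW.
rewrite mxtrace_mulC -mulmxA -/(Am g) mulmxE -exprSr -e.
by [].
Qed.

(** A factor [trk l] contributes [2 * l * trk (k + l)]: [sum_dA_tr] provides the 2, and the two
    halves in [Br_tr2] are equal because [Wk] is symmetric. *)
Lemma sum_trWk_Dtr k K g : \sum_c \tr (Wk k g *m Bs c) * Dtr c K g =
  2 * \sum_(x <- merges k K) x.1%:R * trprod x.2 g.
Proof.
elim: K => [|l K IH] /=.
  by rewrite big_nil mulr0 big1// => c _; rewrite mulr0.
under eq_bigr do rewrite mulrDr.
rewrite big_split /= big_cons big_map /= mulrDr; congr (_ + _).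
  transitivity (l%:R * trprod K g * \sum_c \tr (Wk k g *m Bs c) * \tr (dA c g *m Am g ^+ l.-1)).
    rewrite mulr_sumr; apply: eq_bigr => c _; rewrite tr_dpow; ring.
  rewrite sum_dA_tr Br_tr2.
  case: l => [|l] /=; first by rewrite !mul0r mulr0.
  have e1 : \tr (Wk k g *m (Hs g *m Am g ^+ l)) = trk (k + l.+1) g.
    by rewrite mulmxA Wk_Hs mulmxE -exprD addSnnS.
  have e2 : \tr (Wk k g *m (Hs g *m Am g ^+ l)^T) = trk (k + l.+1) g.
    by rewrite -e1 -mxtrace_tr trmx_mul trmxK Wk_sym mxtrace_mulC.
  rewrite e1 e2 /trprod big_cons.
  have n2 : (2 : C) != 0 by rewrite pnatr_eq0.
  by field.
transitivity (trk l g * \sum_c \tr (Wk k g *m Bs c) * Dtr c K g).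
  by rewrite mulr_sumr; apply: eq_bigr => c _; ring.
rewrite IH !mulr_sumr; apply: eq_bigr => y _.
by rewrite /trprod big_cons; ring.
Qed.

End SymLoop.

(** * Loop equations of the Gaussian matrix *)

Section SymMoments.
Variables (R : realType) (m : nat).
Local Notation C := (R[i]).
Local Notation cRe := (@complex.Re R).
Local Notation J := (J m).
Local Notation Bm := (@Bm R m).
Local Notation Bs := (@Bs R m).

Definition mx_moment (s : R) (K : seq nat) : R :=
  EW (wgauss s) (fun g : J -> R => cRe (trprod K g)).

Lemma Hm_sum (g : J -> R) : Hm g = \sum_c real_complex R (g c) *: Bm c.
Proof.
apply/matrixP => a b; rewrite summxE.
apply/eqP; rewrite eq_complex; apply/andP; split; apply/eqP; rewrite HmE /=.
  rewrite cRe_sum (bigD1 (ordp a b, false))//= big1 ?addr0.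
    by rewrite [X in _ = cRe X]mxE cRe_real HmE /= /delta eqxx mulr1 mulrC.
  move=> c cn; rewrite [X in cRe X]mxE cRe_real HmE /= /delta.
  by rewrite eq_sym (negPf cn) !mulr0.
rewrite cIm_sum (bigD1 (ordp a b, true))//= big1 ?addr0.
  by rewrite [X in _ = complex.Im X]mxE cImM HmE /= /delta eqxx mulr1 mulrC mul0r addr0.
move=> c cn; rewrite [X in complex.Im X]mxE cImM HmE /= /delta.
by rewrite [_ == c]eq_sym (negPf cn) !mulr0 mul0r addr0.
Qed.

Lemma Hs_sum (g : J -> R) : Hs g = \sum_c real_complex R (g c) *: Bs c.
Proof.
apply/matrixP => a b; rewrite HsE Hm_sum !summxE rmorph_sum.
apply: eq_bigr => c _; rewrite [RHS]mxE.
have -> : (real_complex R (g c) *: Bm c) b a = real_complex R (g c) * Bm c b a.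
  by rewrite [LHS]mxE.
rewrite rmorphM; congr (_ * _).
  by apply/eqP; rewrite eq_complex /= oppr0 !eqxx.
by rewrite /Bs HsE.
Qed.

(** In [trk k.+1] the last factor [Hs] is expanded in coordinates, and Stein's identity is applied
    to each coordinate [c]. The derivative of [Wk] gives the split terms by [sum_dWk], that of the
    other traces gives the [merges] by [sum_trWk_Dtr]. *)
Lemma mx_moment_rec s : 0 < s -> loop_rec m s (mx_moment s).
Proof.
move=> s0; have gW := wgauss_good s0.
have pM K : pgrow (fun g : J -> R => cRe (trprod K g)) by have [] := @pgrowC_trprod R m K.
split=> [K K' KK'|K|k K].
- by apply: eq_EW => g; rewrite /trprod (perm_big _ KK').
- rewrite /mx_moment -EWZ//; apply: eq_EW => g.
  rewrite /trprod big_cons {1}/trk expr0 mxtrace1 -(cRe_real (m%:R : R)).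
  by rewrite rmorph_nat.
pose f c (g : J -> R) : C := \tr (Wk k g *m Bs c) * trprod K g.
pose f' c (g : J -> R) : C := \tr (dWk c k g *m Bs c) * trprod K g + \tr (Wk k g *m Bs c) * Dtr c K g.
have pW : pgrowmx (@Wk R m k).
  by apply: pgrowmxM; [apply: pgrowmxX; exact: pgrowmx_Am|exact: pgrowmx_Hm].
have pf c : pgrowC (f c).
  apply: pgrowCM; last exact: pgrowC_trprod.
  by apply: pgrowC_trace; apply: pgrowmxM => //; exact: pgrowmx_cst.
have pdW c : pgrowmx (dWk c k : (J -> R) -> 'M[C]_m).
  apply: pgrowmxD; apply: pgrowmxM; try exact: pgrowmx_cst.
  - exact: pgrowmx_dpow.
  - exact: pgrowmx_Hm.
  - by apply: pgrowmxX; exact: pgrowmx_Am.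
have pf' c : pgrowC (f' c).
  apply: pgrowCD; apply: pgrowCM.
  - by apply: pgrowC_trace; apply: pgrowmxM => //; exact: pgrowmx_cst.
  - exact: pgrowC_trprod.
  - by apply: pgrowC_trace; apply: pgrowmxM => //; exact: pgrowmx_cst.
  - exact: pgrowC_Dtr.
have pdf c : pdC c (f c) (f' c).
  have h1 := pdC_trace (pdmxM (@pdmx_Wk R m c k) (pdmx_cst c (Bs c))).
  apply: (eq_pdC _ _ (pdCM h1 (@pdC_trprod R m c K))) => g //.
  by rewrite /f' mulmx0 addr0.
have st c : EW (wgauss s) (fun g => cRe (f' c g)) = 2 * s * EW (wgauss s) (fun g : J -> R => g c * cRe (f c g)).
  have [p1 _] := pdf c; have [q1 _] := pf c; have [q2 _] := pf' c.
  exact: gauss_stein.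
have E1 : mx_moment s (k.+1 :: K) = \sum_c EW (wgauss s) (fun g : J -> R => g c * cRe (f c g)).
  rewrite -EW_sum//; last first.
    by move=> c _; apply: pgrowM; [exact: pgrow_coord|have [] := pf c].
  apply: eq_EW => g.
  under [RHS]eq_bigr do rewrite -cRe_real.
  rewrite -cRe_sum /trprod big_cons /trk -Wk_Hs Hs_sum mulmx_sumr linear_sum /= mulr_suml.
  congr cRe; apply: eq_bigr => c _.
  by rewrite -scalemxAr mxtraceZ mulrA.
have -> : 2 * s * mx_moment s (k.+1 :: K) = \sum_c EW (wgauss s) (fun g => cRe (f' c g)).
  by rewrite E1 mulr_sumr; apply: eq_bigr => c _; rewrite -st.
rewrite -EW_sum//; last by move=> c _; have [] := pf' c.
have pc c L : pgrow (fun g : J -> R => c * cRe (trprod L g)).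
  by apply: pgrowM; [exact: pgrow_cst|exact: pM].
have pr : pgrow (fun g : J -> R => \sum_(y <- merges k K) y.1%:R * cRe (trprod y.2 g)).
  by apply: pgrow_sum.
transitivity (EW (wgauss s) (fun g : J -> R => k.+1%:R * cRe (trprod (k :: K) g) +
    \sum_(a < k.+1) cRe (trprod [:: a : nat, (k - a)%N & K] g) +
    2 * \sum_(y <- merges k K) y.1%:R * cRe (trprod y.2 g))); last first.
  rewrite EWD//; last 2 first.
  - by apply: pgrowD => //; apply: pgrow_sum => a _; exact: pM.
  - by apply: pgrowM; [exact: pgrow_cst|exact: pr].
  rewrite EWD//; last by apply: pgrow_sum => a _; exact: pM.
  rewrite !EWZ//.
  rewrite [X in _ + X + _](EW_sum _ (P := predT) (f := fun (a : 'I_k.+1) g => cRe (trprod [:: a : nat, (k - a)%N & K] g)))//.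
  rewrite [X in 2 * X](EW_sum _ (P := predT) (f := fun y g => y.1%:R * cRe (trprod y.2 g)))//.
  by congr (_ + _ + 2 * _); apply: eq_bigr => y _; rewrite EWZ.
apply: eq_EW => g; rewrite -cRe_sum /f' big_split /= -mulr_suml sum_dWk sum_trWk_Dtr.
have natC n : n%:R = real_complex R n%:R by rewrite rmorph_nat.
rewrite mulrDl !cReD; congr (_ + _ + _).
- by rewrite -mulrA natC cRe_real /trprod big_cons.
- by rewrite mulr_suml cRe_sum; apply: eq_bigr => a _; rewrite /trprod !big_cons mulrA.
- rewrite natC cRe_real cRe_sum; congr (_ * _); apply: eq_bigr => y _.
  by rewrite natC cRe_real.
Qed.

Lemma card_J : #|{: J}| = (m * m.+1)%N.
Proof.
rewrite card_prod card_bool card_sig.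
have -> : #|[pred p : 'I_m * 'I_m | (p.1 <= p.2)%N]| = 'C(m.+1, 2).
  rewrite -sum1_card -(pair_big_dep predT (fun i j : 'I_m => (i <= j)%N) (fun _ _ => 1%N)) /=.
  rewrite (exchange_big_dep predT) //= -bin2_sum big_mkord big_ord_recl add0n.
  apply: eq_bigr => j _; rewrite sum1_card.
  have wi : injective (widen_ord (ltn_ord j)).
    by move=> x y /(congr1 val) /= /val_inj.
  rewrite -[RHS](card_ord j.+1) -(card_imset _ wi).
  apply: eq_card => i; apply/idP/imsetP => [ij|[k _ ->]]; last first.
    exact: (ltn_ord k : (k <= j)%N).
  by exists (Ordinal (ij : (i < j.+1)%N)) => //; apply: val_inj.
by rewrite bin2 muln2 halfK /= oddM /= andNb subn0 mulnC.
Qed.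

Lemma mx_moment0 s : 0 < s -> mx_moment s [::] = Num.sqrt (pi / s) ^+ (m * m.+1).
Proof.
move=> s0; have gW := wgauss_good s0.
have pM : pgrow (fun g : J -> R => cRe (trprod [::] g)) by have [] := @pgrowC_trprod R m [::].
have E (g : J -> R) : cRe (trprod [::] g) = 1 by rewrite /trprod big_nil.
apply: EFin_inj; rewrite /mx_moment -EW_leb//; last first.
  by move=> g; rewrite E mul1r; apply: prodr_ge0 => i _; rewrite ltW// wgauss_gt0.
rewrite -card_J -(leb_int_prod J (measurable_wgauss s) _ (integral_wgauss s0)).
  by apply: eq_iint => g; rewrite E mul1r.
by move=> t; rewrite ltW// wgauss_gt0.
Qed.

End SymMoments.

(** * Comparison of the moments, and Newton's identities *)

Section MomentEq.
Variables (R : realType) (m : nat).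

(* The ratio of the two zeroth moments: a Gaussian integral and a Selberg integral. *)
Definition Cst : R :=
  pi ^+ 'C(m.+1, 2) * 2 ^+ 'C(m, 2) / \prod_(1 <= j < m) (j`!)%:R.

Lemma pprod_nil (x : 'I_m -> R) : pprod [::] x = 1.
Proof. by rewrite /pprod big_nil. Qed.

Lemma ch_moment0 (s : R) : ch_moment m s [::] = selberg m s 0.
Proof. by apply: eq_EW => x; rewrite pprod_nil /elsym coef0_omit. Qed.

Lemma prod_fact_neq0 : \prod_(1 <= j < m) (j`!)%:R != 0 :> R.
Proof.
by rewrite prodf_seq_neq0; apply/allP => j _; rewrite pnatr_eq0 -lt0n fact_gt0.
Qed.

(** Both zeroth moments scale as [s ^- 'C(m.+1, 2)], so their ratio [Cst] is the same for every [s];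
    the loop equations are linear and propagate it to all [K]. *)
Lemma mx_moment_ch_moment (s : R) K : 0 < s -> mx_moment m s K = Cst * ch_moment m s K.
Proof.
move=> s0; have ns : s != 0 by rewrite gt_eqF.
have H := @loop_rec_unique R m s (mx_moment m s) (fun K => Cst * ch_moment m s K) s0 (mx_moment_rec m s0).
apply: H.
  have [p z r] := ch_moment_rec m s0; split => [K1 K2 K12|K1|k K1].
  - by rewrite (p _ _ K12).
  - by rewrite z mulrCA.
  - rewrite mulrCA r !mulrDr; congr (_ + _ + _); first by rewrite mulrCA.
      by rewrite mulr_sumr.
    rewrite mulrCA; congr (_ * _); rewrite mulr_sumr; apply: eq_bigr => x _.
    by rewrite mulrCA.
rewrite mx_moment0// ch_moment0 selbergE// /Cst.
have -> : (m * m.+1 = 2 * 'C(m.+1, 2))%N.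
  by rewrite bin2 mul2n halfK /= oddM /= andNb subn0 mulnC.
rewrite exprM sqr_sqrtr; last by rewrite divr_ge0 ?pi_ge0// ltW.
rewrite exprMn exprVn.
have n0 := prod_fact_neq0.
have n1 : (2 : R) ^+ 'C(m, 2) != 0 by rewrite expf_neq0.
have n2 : s ^+ 'C(m.+1, 2) != 0 by rewrite expf_neq0.
move: n0 n1 n2; set u0 := (\prod_(_ <= _ < _) _).
move: u0 (2 ^+ _) (s ^+ _) (pi ^+ _) => u0 u1 u2 u3 n0 n1 n2.
by field; rewrite n0 n1 n2.
Qed.

(** Polynomials in the power sums, with an explicit list of terms: the same list is evaluated on the
    matrix side and on the chamber side. *)
Definition pspan (f : ('I_m -> R) -> R) := exists L : seq (R * seq nat),
  forall x, f x = \sum_(a <- L) a.1 * pprod a.2 x.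

Lemma eq_pspan f f' : f =1 f' -> pspan f -> pspan f'.
Proof. by move=> /funext->. Qed.

Lemma pspan_cst c : pspan (fun=> c).
Proof. by exists [:: (c, [::])] => x; rewrite big_seq1 pprod_nil mulr1. Qed.

Lemma pspan_psum k : pspan (@psum R m k).
Proof. by exists [:: (1, [:: k])] => x; rewrite big_seq1 /pprod big_seq1 mul1r. Qed.

Lemma pspanD f f' : pspan f -> pspan f' -> pspan (fun x => f x + f' x).
Proof. by move=> [L hL] [L' hL']; exists (L ++ L') => x; rewrite big_cat hL hL'. Qed.

Lemma pspanM f f' : pspan f -> pspan f' -> pspan (fun x => f x * f' x).
Proof.
move=> [L hL] [L' hL'].
exists [seq (a.1 * b.1, a.2 ++ b.2) | a <- L, b <- L'] => x.
rewrite big_allpairs_dep hL hL' mulr_suml; apply: eq_bigr => a _.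
rewrite mulr_sumr; apply: eq_bigr => b _ /=.
by rewrite /pprod big_cat mulrACA.
Qed.

Lemma pspanZ c f : pspan f -> pspan (fun x => c * f x).
Proof. by move=> pf; apply: pspanM => //; exact: pspan_cst. Qed.

Lemma pspan_sum (K : Type) (r : seq K) (f : K -> ('I_m -> R) -> R) :
  (forall k, pspan (f k)) -> pspan (fun x => \sum_(k <- r) f k x).
Proof.
move=> h; elim: r => [|k r IH].
  by apply: (eq_pspan _ (pspan_cst 0)) => x; rewrite big_nil.
by apply: (eq_pspan _ (pspanD (h k) IH)) => x; rewrite big_cons.
Qed.

Lemma pspan_horner (q : {poly R}) : pspan (fun x => \sum_i q.[x i]).
Proof.
have h (k : 'I_(size q)) : pspan (fun x => q`_k * psum k x).
  by apply: pspanZ; exact: pspan_psum.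
apply: (eq_pspan _ (pspan_sum (index_enum _) h)) => x.
rewrite /psum; under eq_bigr do rewrite mulr_sumr.
by rewrite exchange_big; apply: eq_bigr => i _; rewrite horner_coef.
Qed.

(** Newton's identities in the variables [y_i = q (x_i)], as a joint induction. The sum of
    [y_i * e_k] with [y_i] omitted is [(k + 1) * e_(k+1)]. Omitting [y_i] from [e_(k+1)] leaves
    [e_(k+1)] minus [y_i] times [e_k] without [y_i], which trades the degree [k + 1] for the
    exponent [j + 1]. *)
Lemma pspan_elsym (q : {poly R}) k :
  pspan (fun x => elsym k (fun i => q.[x i])) /\
  forall j, pspan (fun x => \sum_i q.[x i] ^+ j *
    (omit (fun l => predT l && (l != i)) (fun i => q.[x i]))`_k).
Proof.
have hp j : pspan (fun x => \sum_i q.[x i] ^+ j).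
  by apply: (eq_pspan _ (pspan_horner (q ^+ j))) => x; apply: eq_bigr => i _; rewrite horner_exp.
elim: k => [|k [IH1 IH2]].
  split; first by apply: (eq_pspan _ (pspan_cst 1)) => x; rewrite /elsym coef0_omit.
  by move=> j; apply: (eq_pspan _ (hp j)) => x; apply: eq_bigr => i _; rewrite coef0_omit mulr1.
have he : pspan (fun x => elsym k.+1 (fun i => q.[x i])).
  apply: (eq_pspan _ (pspanZ k.+1%:R^-1 (IH2 1%N))) => x.
  under eq_bigr do rewrite expr1.
  rewrite (@sum_mul_coef_omit _ _ predT (fun i => q.[x i])) mulrA mulVf.
    by rewrite mul1r.
  by rewrite pnatr_eq0.
split => // j.
apply: (eq_pspan _ (pspanD (pspanM he (hp j)) (pspanZ (-1) (IH2 j.+1)))) => x.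
rewrite mulN1r mulr_sumr -sumrB; apply: eq_bigr => i _.
rewrite /elsym (@coef_omitD1 _ _ predT _ i)// exprS.
ring.
Qed.

Lemma newton_span (q : {poly R}) : pspan (fun x => \prod_i q.[x i]).
Proof.
have [h _] := pspan_elsym q m.
by apply: (eq_pspan _ h) => x; rewrite elsym_full.
Qed.

End MomentEq.

(** * The spectral law *)

Section Spectrum.
Variables (R : realType) (m : nat).
Local Notation C := (R[i]).
Local Notation cRe := (@complex.Re R).
Local Notation rc := (real_complex R).
Local Open Scope sesquilinear_scope.

Lemma adjmxM (A B : 'M[C]_m) : adjmx R m (A *m B) = adjmx R m B *m adjmx R m A.
Proof. by rewrite /adjmx trmx_mul map_mxM. Qed.

Lemma adjmxE (A : 'M[C]_m) a b : adjmx R m A a b = Num.conj (A b a).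
Proof. by rewrite /adjmx [LHS]mxE; congr (Num.conj _); rewrite [LHS]mxE. Qed.

Definition rdiag (x : 'I_m -> R) : 'M[C]_m := diag_mx (\row_i rc (x i)).

Lemma spectrum_exists (g : J m -> R) : exists x : 'I_m -> R,
  (forall i, 0 <= x i) /\
  exists2 P : 'M[C]_m, P \in unitmx & Am g = invmx P *m rdiag x *m P.
Proof.
have herm : Am g \is hermsymmx.
  apply/is_hermitianmxP; rewrite expr0 scale1r -/(adjmx R m _) adjmxM.
  by congr (_ *m _); apply/matrixP => a b; rewrite adjmxE HsE conjCK.
have AE := orthomx_spectralP (hermitian_normalmx herm).
set P := spectralmx _ in AE; set d := spectral_diag _ in AE.
have uP : P \is unitarymx by exact: spectral_unitarymx.
have Pu : P \in unitmx by exact: spectral_unit.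
clearbody P d.
(* The diagonalized matrix is [P H] times its adjoint, so its diagonal entries are sums of squared
   moduli. *)
have dE : diag_mx d = (P *m Hm g) *m adjmx R m (P *m Hm g).
  rewrite adjmxM mulmxA -[P *m _ *m _]mulmxA -/(Am g) AE !mulmxA mulmxV// mul1mx.
  have /unitarymxP PP := uP.
  by rewrite -mulmxA -[adjmx R m P]/(P ^t*) PP mulmx1.
have d0 i : 0 <= d 0 i.
  have -> : d 0 i = diag_mx d i i by rewrite mxE eqxx mulr1n.
  rewrite dE mxE; apply: sumr_ge0 => j _.
  by rewrite adjmxE mul_conjC_ge0.
have dR i : d 0 i = rc (cRe (d 0 i)).
  have := d0 i; rewrite lecE /= => /andP[/eqP h _].
  by case: (d 0 i) h => a b /= ->.
exists (fun i => cRe (d 0 i)); split.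
  by move=> i; have := d0 i; rewrite lecE => /andP[].
exists P; first exact: Pu.
have -> : rdiag (fun i => cRe (d 0 i)) = diag_mx d; last exact: AE.
congr diag_mx; by apply/rowP => i; rewrite [LHS]mxE -dR.
Qed.

(* An arbitrary enumeration of the eigenvalues, not known to be measurable: only
   symmetric functions of it are integrated. *)
Definition spec (g : J m -> R) : 'I_m -> R := projT1 (cid (spectrum_exists g)).

Lemma spec_ge0 g i : 0 <= spec g i.
Proof. by rewrite /spec; case: cid => x []. Qed.

Lemma specP g : exists2 P : 'M[C]_m, P \in unitmx &
  Am g = invmx P *m rdiag (spec g) *m P.
Proof. by rewrite /spec; case: cid => x []. Qed.

Lemma char_poly_similar (P D : 'M[C]_m) : P \in unitmx ->
  char_poly (invmx P *m D *m P) = char_poly D.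
Proof.
move=> Pu; rewrite /char_poly.
have PK : map_mx polyC (invmx P) *m map_mx polyC P = 1%:M.
  by rewrite -map_mxM mulVmx// map_mx1.
have -> : char_poly_mx (invmx P *m D *m P) =
    map_mx polyC (invmx P) *m char_poly_mx D *m map_mx polyC P.
  rewrite /char_poly_mx !map_mxM mulmxBr mulmxBl; congr (_ - _).
  by rewrite mul_mx_scalar -scalemxAl PK scalemx1.
by rewrite !det_mulmx mulrAC -det_mulmx PK det1 mul1r.
Qed.

Lemma det_similar (P D : 'M[C]_m) : P \in unitmx ->
  \det (invmx P *m D *m P) = \det D.
Proof.
by move=> Pu; rewrite !det_mulmx mulrAC -det_mulmx mulVmx// det1 mul1r.
Qed.

Lemma rdiag_pow x k : rdiag x ^+ k = rdiag (fun i => x i ^+ k).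
Proof.
elim: k => [|k IH].
  by apply/matrixP => a b; rewrite expr0 !mxE expr0.
rewrite exprS IH -mulmxE mulmx_diag; congr diag_mx; apply/rowP => i.
by rewrite !mxE exprS rmorphM.
Qed.

Lemma similar_pow (P D : 'M[C]_m) k : P \in unitmx ->
  (invmx P *m D *m P) ^+ k = invmx P *m D ^+ k *m P.
Proof.
move=> Pu; elim: k => [|k IH]; first by rewrite !expr0 mulmx1 mulVmx.
have E (Z : 'M[C]_m) : Z ^+ k.+1 = Z *m Z ^+ k by exact: exprS.
rewrite (E (invmx P *m D *m P)) IH (E D) !mulmxA; congr (_ *m _ *m _).
by rewrite -!mulmxA mulmxV// mulmx1.
Qed.

Lemma trk_spec k g : trk k g = rc (psum k (spec g)).
Proof.
have [P Pu AE] := specP g; rewrite /trk.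
rewrite AE similar_pow//.
rewrite mxtrace_mulC mulmxA mulmxV// mul1mx rdiag_pow mxtrace_diag /psum rmorph_sum.
by apply: eq_bigr => i _; rewrite mxE.
Qed.

Lemma trprod_spec K g : trprod K g = rc (pprod K (spec g)).
Proof.
rewrite /trprod /pprod rmorph_prod; apply: eq_bigr => k _; exact: trk_spec.
Qed.

Lemma affine_spec g (r : R) : exists2 P : 'M[C]_m, P \in unitmx &
  2%:R *: Am g - (rc r)%:M = invmx P *m rdiag (fun i => 2 * spec g i - r) *m P.
Proof.
have [P Pu AE] := specP g; exists P; first exact: Pu.
have -> : rdiag (fun i => 2 * spec g i - r) = 2%:R *: rdiag (spec g) - (rc r)%:M.
  apply/matrixP => a b; rewrite !mxE; case: eqP => _; last by rewrite !mulr0n mulr0 subr0.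
  by rewrite !mulr1n rmorphB rmorphM rmorph_nat.
rewrite mulmxBr mulmxBl -scalemxAr -scalemxAl -AE; congr (_ - _).
by rewrite mul_mx_scalar -scalemxAl mulVmx// scalemx1.
Qed.

Lemma char_poly_affine g r : char_poly (2%:R *: Am g - (rc r)%:M) =
  \prod_i ('X - (rc (2 * spec g i - r))%:P).
Proof.
have [P Pu ->] := affine_spec g r; rewrite char_poly_similar// char_poly_trig.
  by apply: eq_bigr => i _; rewrite !mxE eqxx mulr1n.
by apply/is_trig_mxP => i j ij; rewrite !mxE -val_eqE ltn_eqF// mulr0n.
Qed.

Lemma det_affine g r : \det (2%:R *: Am g - (rc r)%:M) =
  rc (\prod_i (2 * spec g i - r)).
Proof.
have [P Pu ->] := affine_spec g r; rewrite det_similar// det_diag rmorph_prod.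
by apply: eq_bigr => i _; rewrite mxE.
Qed.

(** Factorization into monic linear factors is unique up to order, so any list allowed by
    [num_neg_eig] is a permutation of [s0]. *)
Lemma num_neg_eigE g r k : num_neg_eig R m (2%:R *: Am g - (rc r)%:M) k <->
  #|[pred i | 2 * spec g i < r]| = k.
Proof.
pose s0 := [seq rc (2 * spec g i - r) | i <- enum 'I_m].
have cE : char_poly (2%:R *: Am g - (rc r)%:M) = \prod_(z <- s0) ('X - z%:P).
  by rewrite char_poly_affine big_map big_enum.
have s0c : count (fun z : C => z < 0) s0 = #|[pred i | 2 * spec g i < r]|.
  rewrite count_map -sum1_count big_enum_cond -sum1_card.
  by apply: eq_bigl => i; rewrite /= ltcE /= eqxx /= subr_lt0.
split => [[s [sE <-]]|<-]; last by exists s0; rewrite cE s0c.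
rewrite -s0c; apply/permP; apply: prod_XsubC_eq; rewrite -cE -sE //.
Qed.

(** The coordinates are orthonormal: an off-diagonal entry occurs twice, each time with squared
    scale [1 / 2]. This makes the Gaussian in [H] a product weight over the coordinates. *)
Lemma trace_Am g : psum 1 (spec g) = \sum_c g c ^+ 2.
Proof.
have h : rc (psum 1 (spec g)) = \tr (Am g) by rewrite -trk_spec /trk expr1.
have -> : psum 1 (spec g) = cRe (\tr (Am g)) by rewrite -h.
rewrite /mxtrace cRe_sum.
transitivity (\sum_a \sum_b scal R a b * scal R a b *
   (g (ordp a b, false) ^+ 2 + g (ordp a b, true) ^+ 2)).
  apply: eq_bigr => a _; rewrite /Am mxE cRe_sum; apply: eq_bigr => b _.
  rewrite cReM HsE cRe_conj cIm_conj !HmE /=; ring.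
rewrite pair_bigA /=.
rewrite (partition_big (fun p : 'I_m * 'I_m => ordp p.1 p.2) predT) //= sum_J.
apply: eq_bigr => -[[i j] /= ij] _; set p := exist _ _ _.
have pE : p = ordp i j by apply: val_inj; rewrite /= ij.
transitivity (\sum_(q | ordp q.1 q.2 == p) scal R q.1 q.2 * scal R q.1 q.2 *
    (g (p, false) ^+ 2 + g (p, true) ^+ 2)).
  by apply: eq_bigr => q /eqP ->.
rewrite -mulr_suml -[RHS]mul1r; congr (_ * _).
under eq_bigl do rewrite pE ordp_eq.
under eq_bigr do rewrite scal_sq.
case: (eqVneq i j) => [e|nij].
  rewrite (big_pred1 (i, i)) /= ?eqxx// => -[a b] /=.
  by rewrite -e orbb xpair_eqE.
rewrite (bigD1 (i, j)) /= ?eqxx// (big_pred1 (j, i)) /=.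
  rewrite (negPf nij) [j == i]eq_sym (negPf nij).
  by rewrite -[RHS](mulfV (_ : 2 != 0)) ?pnatr_eq0// mulrDl mul1r.
move=> [a b] /=; rewrite !xpair_eqE andb_orl andbN /=.
apply/andP/idP => [[]//|/andP[/eqP-> /eqP->]].
by rewrite !eqxx eq_sym (negPf nij).
Qed.

End Spectrum.

Section SpectralLaw.
Variables (R : realType) (m : nat).
Local Notation cRe := (@complex.Re R).
Local Notation J := (J m).
Implicit Types phi : R -> R.

Definition mx_fun phi (g : J -> R) : R := \prod_i phi (spec g i).
Definition ch_fun phi (x : 'I_m -> R) : R := chi x * vdm x * \prod_i phi (x i).

(** Integrability is bundled with the identity of means, so that the relation is stable under linear
    combinations and dominated limits. *)
Definition same_mean (a : (J -> R) -> R) (b : ('I_m -> R) -> R) :=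
  [/\ (@nu R J).-integrable setT (EFin \o a),
      (@nu R 'I_m).-integrable setT (EFin \o b) &
      (\int[@nu R J]_g (a g)%:E = (Cst R m)%:E * \int[@nu R 'I_m]_x (b x)%:E)%E].

Lemma prod_wgauss_spec (s : R) (g : J -> R) :
  \prod_i expR (- (s * spec g i)) = \prod_c wgauss s (g c).
Proof.
rewrite -!expR_sum; congr expR; rewrite !sumrN -!mulr_sumr -trace_Am.
by congr (- (_ * _)); apply: eq_bigr => i _; rewrite expr1.
Qed.

Lemma prod_wexp_cham (s : R) (x : 'I_m -> R) : cham x ->
  \prod_i expR (- (s * x i)) = \prod_i wexp s (x i).
Proof.
by move=> cx; rewrite wexp_prod_cham// -expR_sum sumrN -mulr_sumr.
Qed.

(** [newton_span] turns the product of the [q (y_i)] into a combination of products of power sums,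
    to which the moment identity applies term by term. *)
Lemma same_mean_poly (q : {poly R}) (s : R) : 0 < s ->
  same_mean (mx_fun (fun t => q.[t] * expR (- (s * t))))
            (ch_fun (fun t => q.[t] * expR (- (s * t)))).
Proof.
move=> s0; have gW := wgauss_good s0; have gX := wexp_good s0.
have [L hL] := newton_span m q.
pose a (g : J -> R) := \sum_(z <- L) z.1 * cRe (trprod z.2 g).
pose b (x : 'I_m -> R) := \sum_(z <- L) z.1 * (chi x * vdm x * pprod z.2 x).
have pa z : pgrow (fun g : J -> R => z.1 * cRe (trprod z.2 g)).
  by apply: pgrowM; [exact: pgrow_cst|have [] := @pgrowC_trprod R m z.2].
have pb z : pgrow (fun x : 'I_m -> R => z.1 * (chi x * vdm x * pprod z.2 x)).
  by apply: pgrowM; [exact: pgrow_cst|apply: pgrow_cv; exact: pgrow_pprod].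
have pA : pgrow a by apply: pgrow_sum.
have pB : pgrow b by apply: pgrow_sum.
have aE : mx_fun (fun t => q.[t] * expR (- (s * t))) = fun g => a g * \prod_c wgauss s (g c).
  apply/funext => g; rewrite /mx_fun big_split /= prod_wgauss_spec hL; congr (_ * _).
  by apply: eq_bigr => z _; rewrite trprod_spec.
have bE : ch_fun (fun t => q.[t] * expR (- (s * t))) = fun x => b x * \prod_i wexp s (x i).
  apply/funext => x; rewrite /ch_fun /b big_split /=.
  have -> : \sum_(z <- L) z.1 * (chi x * vdm x * pprod z.2 x) =
      chi x * vdm x * \prod_i q.[x i].
    by rewrite hL mulr_sumr; apply: eq_bigr => z _; rewrite mulrCA.
  rewrite mulrA /chi; case: (boolP (cham x)) => cx; last by rewrite !mul0r.
  by rewrite prod_wexp_cham.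
rewrite aE bE; split; [exact: EW_integrable|exact: EW_integrable|].
rewrite !EWE// -EFinM; congr (_%:E).
rewrite (EW_sum _ (P := predT) (f := fun z (g : J -> R) => z.1 * cRe (trprod z.2 g)) gW)//.
rewrite (EW_sum _ (P := predT) (f := fun z (x : 'I_m -> R) => z.1 * (chi x * vdm x * pprod z.2 x)) gX)//.
rewrite mulr_sumr; apply: eq_bigr => z _; rewrite !EWZ//; last 2 first.
- by apply: pgrow_cv; exact: pgrow_pprod.
- by have [] := @pgrowC_trprod R m z.2.
by rewrite -[EW _ _]/(mx_moment m s z.2) mx_moment_ch_moment// mulrCA.
Qed.

Lemma cvg_bigprod (T K : Type) (F : set_system T) (FF : Filter F) (r : seq K)
    (f : T -> K -> R) (l : K -> R) :
  (forall k, f t k @[t --> F] --> l k) ->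
  (\prod_(k <- r) f t k) @[t --> F] --> \prod_(k <- r) l k.
Proof.
move=> h; elim: r => [|k r IH].
  by under eq_fun do rewrite big_nil; rewrite big_nil; exact: cvg_cst.
under eq_fun do rewrite big_cons; rewrite big_cons.
by apply: cvgM.
Qed.

Lemma same_mean_lim (a_ : nat -> (J -> R) -> R) (b_ : nat -> ('I_m -> R) -> R)
    (a : (J -> R) -> R) (b : ('I_m -> R) -> R)
    (D : (J -> R) -> R) (E : ('I_m -> R) -> R) :
  (forall n, same_mean (a_ n) (b_ n)) ->
  (@nu R J).-integrable setT (EFin \o D) ->
  (@nu R 'I_m).-integrable setT (EFin \o E) ->
  (forall n g, `|a_ n g| <= D g) -> (forall n x, `|b_ n x| <= E x) ->
  (forall g, a_ n g @[n --> \oo] --> a g) ->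
  (forall x, b_ n x @[n --> \oo] --> b x) ->
  same_mean a b.
Proof.
move=> sm iD iE aD bE ca cb.
have ma_ n : measurable_fun [set: cfg R J] (EFin \o a_ n).
  by have [h _ _] := sm n; exact: measurable_int h.
have mb_ n : measurable_fun [set: cfg R 'I_m] (EFin \o b_ n).
  by have [_ h _] := sm n; exact: measurable_int h.
have ma : measurable_fun [set: cfg R J] (EFin \o a).
  apply: (@emeasurable_fun_cvg _ (cfg R J) R setT (fun n => EFin \o a_ n)) => // g _.
  by apply: cvg_EFin; [exact: nearW|exact: ca].
have mb : measurable_fun [set: cfg R 'I_m] (EFin \o b).
  apply: (@emeasurable_fun_cvg _ (cfg R 'I_m) R setT (fun n => EFin \o b_ n)) => // x _.
  by apply: cvg_EFin; [exact: nearW|exact: cb].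
have ca' : {ae @nu R J, forall g, [set: cfg R J] g -> (EFin \o a_ n) g @[n --> \oo] --> (EFin \o a) g}.
  by apply: aeW => g _; apply: cvg_EFin; [exact: nearW|exact: ca].
have cb' : {ae @nu R 'I_m, forall x, [set: cfg R 'I_m] x -> (EFin \o b_ n) x @[n --> \oo] --> (EFin \o b) x}.
  by apply: aeW => x _; apply: cvg_EFin; [exact: nearW|exact: cb].
have aD' : {ae @nu R J, forall g n, [set: cfg R J] g -> (`|(EFin \o a_ n) g| <= (EFin \o D) g)%E}.
  by apply: aeW => g n _; rewrite /= lee_fin.
have bE' : {ae @nu R 'I_m, forall x n, [set: cfg R 'I_m] x -> (`|(EFin \o b_ n) x| <= (EFin \o E) x)%E}.
  by apply: aeW => x n _; rewrite /= lee_fin.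
have [ia _ la] := dominated_convergence measurableT ma_ ma ca' iD aD'.
have [ib _ lb] := dominated_convergence measurableT mb_ mb cb' iE bE'.
split => //; have lb2 := cvgeZl (isT : (Cst R m)%:E \is a fin_num) lb.
rewrite (_ : (fun n => _) = (fun n => \int[@nu R J]_g (EFin \o a_ n) g)%E) in lb2.
  exact: (cvg_unique _ la lb2).
by apply/funext => n; have [_ _ ->] := sm n.
Qed.

Lemma prod_norm_le (K : finType) (f h : K -> R) (c : R) :
  (forall k, `|f k| <= c * h k) -> `|\prod_k f k| <= c ^+ #|K| * \prod_k h k.
Proof.
move=> fh; rewrite normr_prod.
have -> : c ^+ #|K| * \prod_k h k = \prod_k (c * h k).
  by rewrite big_split /= prodr_const.
by apply: ler_prod => k _; rewrite normr_ge0 fh.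
Qed.

Definition spectral_fun phi := same_mean (mx_fun phi) (ch_fun phi).

(** Bounds and limits are asked for [t >= 0] only, where eigenvalues and chamber coordinates lie.
    The product of the one-variable bounds is again a product weight, which dominates both sides. *)
Lemma spectral_fun_lim (phi_ : nat -> R -> R) phi c (s : R) : 0 < s ->
  (forall n, spectral_fun (phi_ n)) ->
  (forall n t, 0 <= t -> `|phi_ n t| <= c * expR (- (s * t))) ->
  (forall t, 0 <= t -> phi_ n t @[n --> \oo] --> phi t) ->
  spectral_fun phi.
Proof.
move=> s0 sp dom lim; have gW := wgauss_good s0; have gX := wexp_good s0.
apply: (@same_mean_lim (fun n => mx_fun (phi_ n)) (fun n => ch_fun (phi_ n)) _ _
  (fun g => c ^+ m * \prod_j wgauss s (g j))
  (fun x => `|chi x * vdm x| * c ^+ m * \prod_i wexp s (x i))) => //.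
- by apply: (EW_integrable gW); exact: pgrow_cst.
- apply: (EW_integrable gX (f := fun x => `|chi x * vdm x| * c ^+ m)).
  apply: pgrowM; last exact: pgrow_cst.
  have pv : pgrow (fun x : 'I_m -> R => chi x * vdm x).
    by apply: pgrowM; [exact: pgrow_chi|exact: pgrow_vdm].
  split; first exact: measurableT_comp (pgrow_measurable pv).
  by have [_ [C0 [k h]]] := pv; exists C0, k => g; rewrite normr_id.
- move=> n g; rewrite -prod_wgauss_spec -[in X in _ ^+ X](card_ord m).
  by apply: prod_norm_le => i; apply: dom; exact: spec_ge0.
- move=> n x; rewrite /ch_fun normrM -mulrA; case: (boolP (cham x)) => cx; last first.
    by rewrite /chi (negPf cx) !mul0r normr0 !mul0r.
  apply: ler_wpM2l => //; rewrite -prod_wexp_cham// -[in X in _ ^+ X](card_ord m).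
  by apply: prod_norm_le => i; apply: dom; have /chamP[_ /(_ i)/ltW] := cx.
- by move=> g; apply: cvg_bigprod => i; apply: lim; exact: spec_ge0.
- move=> x; rewrite /ch_fun; case: (boolP (cham x)) => cx; last first.
    by rewrite /chi (negPf cx) !mul0r; under eq_fun do rewrite mul0r; exact: cvg_cst.
  apply: cvgMr; apply: cvg_bigprod => i; apply: lim.
  by have /chamP[_ /(_ i)/ltW] := cx.
Qed.

End SpectralLaw.

(** * From polynomials to polynomials in exponentials *)

Section ExpPoly.
Variables (R : realType).
Implicit Types q P : {poly R}.

Lemma horner_exp_dom q (s : R) : 0 < s -> exists2 C, 0 <= C &
  forall t, 0 <= t -> `|q.[t]| * expR (- (s * t)) <= C * expR (- (s / 2 * t)).
Proof.
move=> s0; have [A A0 [k hA]] := horner_growth q; have [B B0 hB] := exp_dom k s0.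
exists (A * B); first exact: mulr_ge0.
move=> t t0; rewrite -mulrA; apply: (@le_trans _ _ (A * (1 + t) ^+ k * expR (- (s * t)))).
  by rewrite ler_wpM2r ?expR_ge0// (le_trans (hA t))// ger0_norm.
by rewrite -mulrA ler_wpM2l// hB.
Qed.

Lemma exp_partial_cvg (x : R) :
  (\sum_(l < n) x ^+ l / l`!%:R) @[n --> \oo] --> expR x.
Proof.
have -> : (fun n => \sum_(l < n) x ^+ l / l`!%:R) = series (exp_coeff x).
  by apply/funext => n; rewrite /series /= big_mkord.
exact: (is_cvg_series_exp_coeff x).
Qed.

Lemma exp_partial_le (x : R) n : 0 <= x ->
  \sum_(l < n) x ^+ l / l`!%:R <= expR x.
Proof.
move=> x0; have c := @exp_partial_cvg x.
rewrite -(cvg_lim _ c)//.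
apply: (@nondecreasing_cvgn_le _ (fun n => \sum_(l < n) x ^+ l / l`!%:R)).
  apply/nondecreasing_seqP => k; rewrite big_ord_recr/= lerDl.
  by rewrite divr_ge0// exprn_ge0.
by apply/cvg_ex; exists (expR x).
Qed.

End ExpPoly.

Section TestFunctions.
Variables (R : realType) (m : nat).
Implicit Types q P : {poly R}.

Lemma cvg_sum_ord (K : Type) (r : seq K) (f : nat -> K -> R) (l : K -> R) :
  (forall k, f n k @[n --> \oo] --> l k) ->
  (\sum_(k <- r) f n k) @[n --> \oo] --> \sum_(k <- r) l k.
Proof.
move=> h; elim: r => [|k r IH].
  by under eq_fun do rewrite big_nil; rewrite big_nil; exact: cvg_cst.
under eq_fun do rewrite big_cons; rewrite big_cons.
by apply: cvgD.
Qed.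

Lemma spectral_fun_exp q P (s b : R) : 0 < s -> 0 <= b ->
  spectral_fun m (fun t => q.[t] * P.[expR (- (b * t))] * expR (- (s * t))).
Proof.
(* [c] exceeds every [b * j] that occurs, so [expR (- (b * j * t))] is [expR (- (c * t))] times an
   exponential with non-negative exponent. The Taylor sums of the latter stay below it for [t >= 0],
   which gives the domination. *)
move=> s0 b0; pose c := b * (size P)%:R.
have c0 : 0 <= c by rewrite mulr_ge0.
pose S n := \sum_(j < size P) \sum_(l < n) (P`_j * ((c - b * j%:R) ^+ l / l`!%:R)) *: 'X^l.
have SE n t : (S n).[t] = \sum_(j < size P)
    P`_j * \sum_(l < n) ((c - b * j%:R) * t) ^+ l / l`!%:R.
  rewrite /S horner_sum; apply: eq_bigr => j _.
  rewrite horner_sum mulr_sumr; apply: eq_bigr => l _.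
  by rewrite hornerZ hornerXn exprMn; ring.
have cj (j : 'I_(size P)) : 0 <= c - b * j%:R.
  by rewrite subr_ge0 ler_wpM2l// ler_nat ltnW.
have [C C0 hC] := horner_exp_dom q s0.
pose A := \sum_(j < size P) `|P`_j|.
apply: (@spectral_fun_lim _ _ (fun n t => (q * S n).[t] * expR (- ((s + c) * t)))
  _ (A * C) (s / 2)) => //.
- by rewrite divr_gt0.
- by move=> n; apply: same_mean_poly; rewrite ltr_wpDr.
- move=> n t t0; rewrite hornerM !normrM (ger0_norm (expR_ge0 _)).
  have hS : `|(S n).[t]| * expR (- ((s + c) * t)) <= A * expR (- (s * t)).
    rewrite SE (_ : - ((s + c) * t) = - (c * t) + - (s * t)); last by ring.
    rewrite expRD mulrA ler_wpM2r ?expR_ge0//.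
    rewrite (le_trans (ler_wpM2r (expR_ge0 _) (ler_norm_sum _ _ _)))//.
    rewrite mulr_suml; apply: ler_sum => j _; rewrite normrM -mulrA ler_piMr//.
    have ct : 0 <= (c - b * j%:R) * t by rewrite mulr_ge0.
    rewrite ger0_norm; last by apply: sumr_ge0 => l _; rewrite divr_ge0// exprn_ge0.
    rewrite (le_trans (ler_wpM2r (expR_ge0 _) (exp_partial_le _ ct)))//.
    rewrite -expRD -[leRHS]expR0 ler_expR mulrBl.
    have : 0 <= b * j%:R * t by rewrite !mulr_ge0.
    lra.
  rewrite -[leLHS]mulrA; apply: (le_trans (ler_wpM2l (normr_ge0 _) hS)).
  by rewrite mulrCA -[leRHS]mulrA ler_wpM2l ?sumr_ge0// hC.
move=> t t0.
have -> : q.[t] * P.[expR (- (b * t))] * expR (- (s * t)) =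
    q.[t] * (\sum_(j < size P) P`_j * expR ((c - b * j%:R) * t)) * expR (- ((s + c) * t)).
  rewrite (_ : - ((s + c) * t) = - (c * t) + - (s * t)); last by ring.
  rewrite expRD [RHS]mulrA; congr (_ * _); rewrite -mulrA; congr (_ * _).
  rewrite horner_coef mulr_suml; apply: eq_bigr => j _; rewrite -mulrA; congr (_ * _).
  by rewrite -expRD -expRM_natl; congr expR; ring.
under eq_fun do rewrite hornerM SE.
apply: cvgMl; apply: cvgMr.
by apply: cvg_sum_ord => j; apply: cvgMr; exact: exp_partial_cvg.
Qed.

End TestFunctions.

(** * Counting negative eigenvalues *)

Section Step.
Variables (R : realType) (m : nat).

Lemma bernoulli_le (x : R) n : 0 <= x -> x <= 1 -> 1 - n%:R * x <= (1 - x) ^+ n.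
Proof.
move=> x0 x1; elim: n => [|n IH]; first by rewrite mul0r subr0 expr0.
rewrite exprS; apply: (@le_trans _ _ ((1 - x) * (1 - n%:R * x))); last first.
  by rewrite ler_wpM2l// subr_ge0.
have : 0 <= n%:R * (x * x) by rewrite !mulr_ge0.
rewrite -[n.+1]addn1 natrD; lra.
Qed.

Lemma expR_decay_cvg (d : R) : 0 < d -> expR (- (n%:R * d)) @[n --> \oo] --> (0 : R).
Proof.
move=> d0; rewrite (_ : (fun n => _) = (fun n => expR (- d) ^+ n)).
  by apply: cvg_expr; rewrite ger0_norm ?expR_ge0// expR_lt1 oppr_lt0.
by apply/funext => n; rewrite -expRM_natl mulrN.
Qed.

(* The double exponential [exp (- exp (- n (2t - r)))] tends to the indicator of
   [r < 2t]; replacing the outer exponential by [(1 - w/N)^N] keeps it a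
   polynomial in [exp (- 2nt)]. *)
Definition step_size (r : R) n := (Num.truncn (expR (n%:R * r))).+1.
Definition step_poly (r : R) n : {poly R} :=
  (1 - (expR (n%:R * r) / (step_size r n)%:R) *: 'X) ^+ step_size r n.

(** For [t >= 0] this puts [w / N] in [[0, 1]], where the powers of [1 - w / N] stay between 0 and 1
    and Bernoulli's inequality applies. *)
Lemma step_sizeP r n : expR (n%:R * r) <= (step_size r n)%:R.
Proof. by rewrite ltW// truncnS_gt. Qed.

Section Eval.
Variables (r t : R) (n : nat).
Hypothesis t0 : 0 <= t.
Let w := expR (- (n%:R * (2 * t - r))).
Let N := step_size r n.
Let v := w / N%:R.

Let v0 : 0 <= v. Proof. by rewrite divr_ge0// expR_ge0. Qed.

Let v1 : v <= 1.
Proof.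
rewrite ler_pdivrMr// mul1r (le_trans _ (step_sizeP r n))// ler_expR.
have : 0 <= n%:R * t by rewrite mulr_ge0.
lra.
Qed.

Lemma step_polyE : (step_poly r n).[expR (- (2 * n%:R * t))] = (1 - v) ^+ N.
Proof.
rewrite /step_poly horner_exp hornerD hornerN hornerZ hornerX hornerC.
congr ((1 - _) ^+ _); rewrite mulrAC -expRD /v /w; congr (expR _ / _); ring.
Qed.

Lemma step_poly_ge0 : 0 <= (step_poly r n).[expR (- (2 * n%:R * t))].
Proof. by rewrite step_polyE exprn_ge0// subr_ge0. Qed.

Lemma step_poly_le1 : (step_poly r n).[expR (- (2 * n%:R * t))] <= 1.
Proof. by rewrite step_polyE exprn_ile1 ?subr_ge0// gerBl. Qed.

Lemma step_poly_ge : 1 - w <= (step_poly r n).[expR (- (2 * n%:R * t))].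
Proof.
rewrite step_polyE; apply: le_trans (bernoulli_le _ v0 v1).
by rewrite /v mulrCA divff ?mulr1// gt_eqF.
Qed.

Lemma step_poly_le : (step_poly r n).[expR (- (2 * n%:R * t))] <=
  expR (- (n%:R * (r - 2 * t))).
Proof.
rewrite step_polyE (le_trans (_ : _ <= expR (- w))).
- by [].
- apply: (@le_trans _ _ (expR (- v) ^+ N)).
    by rewrite lerXn2r ?nnegrE ?subr_ge0 ?expR_ge0// expR_ge1Dx.
  by rewrite -expRM_natl mulrN /v mulrCA divff ?mulr1// gt_eqF.
(* [expR (- w) <= w^-1], because [w <= 1 + w <= expR w]. *)
rewrite expRN (_ : - _ = - - (n%:R * (2 * t - r))); last by ring.
rewrite expRN -/w lef_pV2 ?posrE ?expR_gt0//.
by rewrite (le_trans _ (expR_ge1Dx _))// lerDr.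
Qed.

End Eval.

Lemma step_poly_cvg1 (r t : R) : 0 <= t -> r < 2 * t ->
  (step_poly r n).[expR (- (2 * n%:R * t))] @[n --> \oo] --> (1 : R).
Proof.
move=> t0 rt; apply: (@squeeze_cvgr _ _ _ _ (fun n => 1 - expR (- (n%:R * (2 * t - r)))) (fun=> 1)).
- by apply: nearW => n; rewrite step_poly_ge// step_poly_le1.
- rewrite -[X in _ --> X](subr0 (1 : R)); apply: cvgB; first exact: cvg_cst.
  by apply: expR_decay_cvg; rewrite subr_gt0.
- exact: cvg_cst.
Qed.

Lemma step_poly_cvg0 (r t : R) : 0 <= t -> 2 * t < r ->
  (step_poly r n).[expR (- (2 * n%:R * t))] @[n --> \oo] --> (0 : R).
Proof.
move=> t0 rt; apply: (@squeeze_cvgr _ _ _ _ (fun=> 0) (fun n => expR (- (n%:R * (r - 2 * t))))).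
- by apply: nearW => n; rewrite step_poly_ge0// step_poly_le.
- exact: cvg_cst.
- by apply: expR_decay_cvg; rewrite subr_gt0.
Qed.

Definition tent (r z t : R) : R := if r < 2 * t then 2 * t - r else z * (r - 2 * t).

Lemma spectral_fun_tent (r z s : R) : 0 <= z -> 0 < s ->
  spectral_fun m (fun t => tent r z t * expR (- (s * t))).
Proof.
move=> z0 s0; pose q : {poly R} := 2 *: 'X - r%:P.
have qE t : q.[t] = 2 * t - r by rewrite /q hornerD hornerN hornerZ hornerX hornerC.
(* As the step tends to 1 or 0, [Q n] tends to 1 where [r < 2 t] and to [- z] where [2 t < r];
   multiplied by [q], this gives [tent]. *)
pose Q n : {poly R} := (1 + z) *: step_poly r n - z%:P.
have QE n u : (Q n).[u] = (1 + z) * (step_poly r n).[u] - z.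
  by rewrite /Q hornerD hornerN hornerZ hornerC.
have [C C0 hC] := horner_exp_dom q s0.
apply: (@spectral_fun_lim _ _
  (fun n t => q.[t] * (Q n).[expR (- (2 * n%:R * t))] * expR (- (s * t)))
  _ ((1 + z) * C) (s / 2)) => //.
- by rewrite divr_gt0.
- by move=> n; apply: spectral_fun_exp => //; rewrite mulr_ge0.
- move=> n t t0; rewrite !normrM (ger0_norm (expR_ge0 _)) QE.
  have p0 := step_poly_ge0 r n t0; have p1 := step_poly_le1 r n t0.
  set p := (step_poly r n).[_] in p0 p1 *.
  have hQ : `|(1 + z) * p - z| <= 1 + z.
    have h1 : (1 + z) * p <= 1 + z by rewrite ler_piMr// addr_ge0.
    have h2 : 0 <= (1 + z) * p by rewrite mulr_ge0// addr_ge0.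
    rewrite ler_norml; apply/andP; split; lra.
  rewrite mulrAC mulrC -[leRHS]mulrA; apply: ler_pM => //.
  exact: hC.
move=> t t0; apply: cvgMl; rewrite qE; under eq_fun do rewrite QE.
have [rt|rt|rt] := ltgtP (2 * t) r.
- rewrite (_ : tent r z t = (2 * t - r) * ((1 + z) * 0 - z)); last first.
    by rewrite /tent ltNge ltW//=; ring.
  apply: cvgMr; apply: cvgB; last exact: cvg_cst.
  by apply: cvgMr; exact: step_poly_cvg0.
- rewrite (_ : tent r z t = (2 * t - r) * ((1 + z) * 1 - z)); last first.
    by rewrite /tent rt; ring.
  apply: cvgMr; apply: cvgB; last exact: cvg_cst.
  by apply: cvgMr; exact: step_poly_cvg1.
(* At [2 t = r] the factor [2 t - r] vanishes, so no limit of the step is needed there. *)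
- rewrite /tent rt ltxx subrr mulr0 (_ : (fun _ => _) = fun=> 0); first exact: cvg_cst.
  by apply/funext => n; rewrite mul0r.
Qed.

End Step.

Section SignCount.
Variables (R : realType) (m : nat).

(* Extraction of the coefficient of [z ^ k] from the values at [z = 0, ..., m]. *)
Lemma moment_inverse (k : 'I_m.+1) : exists c : 'I_m.+1 -> R,
  forall j : nat, (j <= m)%N -> \sum_z c z * (z : nat)%:R ^+ j = (j == k)%:R.
Proof.
pose V : 'M[R]_m.+1 := Vandermonde m.+1 (\row_z (z : nat)%:R).
have uV : V \in unitmx.
  rewrite unitmxE unitfE det_Vandermonde; apply/prodf_neq0 => i _.
  apply/prodf_neq0 => j ij; rewrite !mxE subr_eq0 eqr_nat.
  by rewrite gtn_eqF.
exists (fun z => invmx V z k) => j jm.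
have := congr1 (fun M : 'M[R]_m.+1 => M (Ordinal (jm : (j < m.+1)%N)) k) (mulmxV uV).
rewrite !mxE -val_eqE /= => <-; apply: eq_bigr => z _.
by rewrite !mxE mulrC.
Qed.

Lemma same_mean0 : @same_mean R m (fun=> 0) (fun=> 0).
Proof.
split; [exact: integrable0|exact: integrable0|].
by rewrite !integral0 mule0.
Qed.

Lemma same_meanD a1 b1 a2 b2 : @same_mean R m a1 b1 -> same_mean a2 b2 ->
  same_mean (fun g => a1 g + a2 g) (fun x => b1 x + b2 x).
Proof.
move=> [i1 j1 e1] [i2 j2 e2].
split; [exact: (integrableD measurableT i1 i2)|exact: (integrableD measurableT j1 j2)|].
transitivity (\int[@nu R (J m)]_g (a1 g)%:E + \int[@nu R (J m)]_g (a2 g)%:E)%E.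
  exact: (integralD_EFin measurableT i1 i2).
rewrite e1 e2 -muleDr// ?fin_num_adde_defl//; last exact: (integrable_fin_num measurableT j2).
by congr (_ * _)%E; apply/esym; exact: (integralD_EFin measurableT j1 j2).
Qed.

Lemma same_meanZ a b c : @same_mean R m a b ->
  same_mean (fun g => c * a g) (fun x => c * b x).
Proof.
move=> [i j e].
split; [exact: (integrableZl measurableT c i)|exact: (integrableZl measurableT c j)|].
transitivity (c%:E * \int[@nu R (J m)]_g (a g)%:E)%E.
  exact: (integralZl measurableT i).
rewrite e muleCA; congr (_ * _)%E; apply/esym; exact: (integralZl measurableT j).
Qed.

Lemma same_mean_sum (K : Type) (s : seq K) (a : K -> _) (b : K -> _) (c : K -> R) :
  (forall k, @same_mean R m (a k) (b k)) ->
  same_mean (fun g => \sum_(k <- s) c k * a k g) (fun x => \sum_(k <- s) c k * b k x).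
Proof.
move=> h; elim: s => [|k s IH].
  rewrite (_ : (fun _ => _) = fun=> 0); last by apply/funext => ?; rewrite big_nil.
  rewrite [X in same_mean _ X](_ : _ = fun=> 0); first exact: same_mean0.
  by apply/funext => ?; rewrite big_nil.
have := same_meanD (same_meanZ (c k) (h k)) IH.
by congr same_mean; apply/funext => ?; rewrite big_cons.
Qed.

Definition sign_count (r : R) (k : nat) (y : 'I_m -> R) : R :=
  (#|[pred i | 2 * y i < r]| == k)%:R * `|\prod_i (2 * y i - r)| *
  expR (- \sum_i y i).

Lemma prod_tent (r z : R) (y : 'I_m -> R) :
  \prod_i (tent r z (y i) * expR (- (1 * y i))) =
  z ^+ #|[pred i | 2 * y i < r]| * `|\prod_i (2 * y i - r)| * expR (- \sum_i y i).
Proof.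
rewrite big_split /= -expR_sum sumrN -mulr_sumr mul1r; congr (_ * _).
have -> : z ^+ #|[pred i | 2 * y i < r]| = \prod_i (if 2 * y i < r then z else 1).
  by rewrite -big_mkcond /= prodr_const.
rewrite normr_prod -big_split /=; apply: eq_bigr => i _; rewrite /tent.
case: ltgtP => ry; rewrite ?mul1r.
- by rewrite ger0_norm// subr_ge0 ltW.
- by rewrite ler0_norm ?opprB// subr_le0 ltW.
- by rewrite ry subrr normr0 mulr0.
Qed.

Lemma sign_count_tent (k : nat) : (k <= m)%N -> exists c : 'I_m.+1 -> R,
  forall r y, sign_count r k y =
    \sum_z c z * \prod_i (tent r (z : nat)%:R (y i) * expR (- (1 * y i))).
Proof.
move=> km; have [c hc] := moment_inverse (Ordinal (km : (k < m.+1)%N)).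
exists c => r y; rewrite /sign_count -[k in _ == k]/(val (Ordinal (km : (k < m.+1)%N))).
rewrite -(hc _ _); last by rewrite (leq_trans (max_card _))// card_ord.
by rewrite -mulrA mulr_suml; apply: eq_bigr => z _; rewrite prod_tent !mulrA.
Qed.

Lemma sign_count_mean (r : R) (k : nat) : (k <= m)%N ->
  @same_mean R m (fun g => sign_count r k (spec g))
            (fun x => chi x * vdm x * sign_count r k x).
Proof.
move=> km; have [c key] := sign_count_tent km.
have /(_ (index_enum 'I_m.+1) c) := same_mean_sum _ _
  (fun z : 'I_m.+1 => @spectral_fun_tent R m r (z : nat)%:R 1 (ler0n _ _) ltr01).
congr same_mean; apply/funext => g; first by rewrite key.
by rewrite key mulr_sumr; apply: eq_bigr => z _; rewrite mulrCA.
Qed.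

End SignCount.

(** * Integration over x *)

Section Radial.
Variable R : realType.
Local Notation leb := (@lebesgue_measure R).

Definition tail (s c t : R) : R := if c < t then expR (- (s * t)) else 0.

Lemma tail_ge0 s c t : 0 <= tail s c t.
Proof. by rewrite /tail; case: ifP => // _; exact: expR_ge0. Qed.

Lemma measurable_tail s c : measurable_fun [set: R] (tail s c).
Proof.
have -> : tail s c = (fun t => expR (- (s * t))) \_ `]c, +oo[.
  by apply/funext => t; rewrite patchE /tail mem_setE in_itv/= andbT.
apply/measurable_restrict => //; apply: measurable_funTS.
exact: continuous_measurable_fun (@continuous_expRMl R s).
Qed.

Lemma integral_tail (s c : R) : 0 < s ->
  (\int[leb]_t (tail s c t)%:E = (expR (- (s * c)) / s)%:E)%E.
Proof.
move=> s0; have mE : measurable_fun [set: R] (fun t => (expR (- (s * t)))%:E).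
  apply/measurable_EFinP.
  exact: continuous_measurable_fun (@continuous_expRMl R s).
transitivity (\int[leb]_(t in `]c, +oo[) (expR (- (s * t)))%:E)%E.
  rewrite [RHS]integral_mkcond; apply: eq_integral => t _.
  by rewrite patchE /tail mem_setE in_itv/= andbT; case: ifP.
rewrite integral_itv_obnd_cbnd; last exact: measurable_funTS.
transitivity (\int[leb]_t ((expR (- (s * c)))%:E * (wexp s (t + - c))%:E))%E.
  rewrite [LHS]integral_mkcond; apply: eq_integral => t _.
  rewrite patchE /wexp mem_setE in_itv/= andbT subr_ge0 -EFinM.
  case: ifP => _; last by rewrite mulr0.
  by rewrite -expRD; congr (expR _)%:E; ring.
have mw := @measurable_wexp R s.
rewrite ge0_integralZl_EFin ?expR_ge0//; last 2 first.
- by move=> t _; rewrite lee_fin wexp_ge0.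
- by apply/measurable_EFinP; exact: (measurableT_comp mw (measurable_addr (- c))).
rewrite (ge0_integral_shift (f := fun t => (wexp s t)%:E)); last 2 first.
- exact/measurable_EFinP.
- by move=> t; rewrite lee_fin wexp_ge0.
by rewrite integral_wexp.
Qed.

(** The indicator of [c < t] is the limit of the difference quotients, in the parameter [r], of the
    positive part of [2 t - r] at [r = 2 c]. *)
Lemma spectral_fun_tail (s c : R) : 0 < s -> spectral_fun 1 (tail s c).
Proof.
move=> s0.
pose h n t := n.+1%:R * ((tent (2 * c) 0 t - tent (2 * c + n.+1%:R^-1) 0 t) * expR (- (s * t))).
have tentE r t : tent r 0 t = if r < 2 * t then 2 * t - r else 0.
  by rewrite /tent mul0r.
apply: (@spectral_fun_lim _ _ h _ 1 s) => //.
- move=> n; have sp r : spectral_fun 1 (fun t => tent r 0 t * expR (- (s * t))).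
    exact: spectral_fun_tent.
  have := same_meanZ n.+1%:R (same_meanD (sp (2 * c)) (same_meanZ (-1) (sp (2 * c + n.+1%:R^-1)))).
  by congr same_mean; apply/funext => y; rewrite /mx_fun /ch_fun /h !big_ord1; ring.
- move=> n t t0; rewrite mul1r /h mulrA normrM (ger0_norm (expR_ge0 _)).
  rewrite [leLHS]mulrC ler_piMr ?expR_ge0// normrM ger0_norm//.
  have n0 : 0 < n.+1%:R^-1 :> R by rewrite invr_gt0.
  rewrite -ler_pdivlMl// mulr1 !tentE ler_norml; apply/andP.
  move: (n.+1%:R^-1) n0 => d d0.
  case: ltP => h1; case: ltP => h2; split; lra.
move=> t t0; rewrite /tail; case: ltP => ct.
- rewrite -[X in _ --> X]mul1r /h; under eq_fun do rewrite mulrA.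
  apply: cvgMl; apply: cvg_near_cst.
  have e0 : 0 < 2 * (t - c) by rewrite mulr_gt0 ?subr_gt0.
  have := near_infty_natSinv_lt (PosNum e0); apply: filterS => n /= hn.
  rewrite !tentE; have n0 : n.+1%:R * n.+1%:R^-1 = 1 :> R by rewrite divff.
  move: (n.+1%:R^-1) n0 hn => d nd hd; rewrite !ifT; [|lra|lra].
  by rewrite (_ : _ - _ = d) //; ring.
- rewrite (_ : (fun n => _) = fun=> 0); first exact: cvg_cst.
  apply/funext => n; have n0 : 0 < n.+1%:R^-1 :> R by rewrite invr_gt0.
  rewrite /h !tentE; move: (n.+1%:R^-1) n0 => d d0.
  by rewrite !ifF ?subrr ?mul0r ?mulr0//; apply/negbTE; rewrite -leNgt; lra.
Qed.

(* The spectral law for [m = 1]: the only eigenvalue of [H H^*] is [a ^+ 2 + b ^+ 2]. *)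
Lemma iint_radial (s c : R) : 0 < s ->
  (\int[leb]_a \int[leb]_b (tail s c (a ^+ 2 + b ^+ 2))%:E =
   (pi / s * expR (- (s * Num.max c 0)))%:E)%E.
Proof.
move=> s0; have [iA iB] := spectral_fun_tail c s0.
have mA := measurable_int _ iA; have mB := measurable_int _ iB.
rewrite !ge0_integral_nu//; last 2 first.
- move=> x; rewrite lee_fin /ch_fun mulr_ge0 ?prodr_ge0// => [|i _]; last exact: tail_ge0.
  rewrite /chi; case: (boolP (cham x)) => cx; last by rewrite mul0r.
  by rewrite mul1r ltW// vdm_gt0.
- by move=> g; rewrite lee_fin prodr_ge0// => i _; exact: tail_ge0.
pose p0 : sym_index 1 := Sub (ord0, ord0) (leqnn 0).
have p0E p : p = p0 by apply/val_inj; case: p => -[i j] /= _; rewrite (ord1 i) (ord1 j).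
rewrite /leb_int (@iint_perm _ _ _ [:: (p0, false); (p0, true)])//; first last.
- apply: uniq_perm; rewrite ?enum_uniq// => -[p b].
  by rewrite mem_enum !inE (p0E p) !xpair_eqE eqxx; case: b.
- exact: enum_uniq.
- by move=> g; rewrite lee_fin prodr_ge0// => i _; exact: tail_ge0.
rewrite (_ : enum 'I_1 = [:: ord0]); last first.
  by apply: (inj_map val_inj); rewrite val_enum_ord.
(* The chamber for [m = 1] is [0 < t], which combines with [c < t] into a single tail starting at
   [Num.max c 0]. *)
move=> /= eqAB; transitivity ((Cst R 1)%:E * \int[leb]_t (tail s (Num.max c 0) t)%:E)%E.
  rewrite [LHS](_ : _ = (\int[leb]_a \int[leb]_b (mx_fun (tail s c)
     (upd R (J 1) (upd R (J 1) (fun=> 0) (p0, false) a) (p0, true) b))%:E)%E).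
    rewrite eqAB; congr (_ * _)%E; apply: eq_integral => t _; congr (_%:E).
    rewrite /ch_fun big_ord1 updE eqxx.
    have -> : vdm (upd R _ (fun=> 0) (ord0 : 'I_1) t) = 1.
      by rewrite vdmE big_pred0// => -[i j] /=; rewrite (ord1 i) (ord1 j).
    have -> : chi (upd R _ (fun=> 0) (ord0 : 'I_1) t) = (0 < t)%R%:R.
      congr (_%:R); congr nat_of_bool; apply/chamP/idP => [[_ /(_ ord0)]|t0].
        by rewrite updE eqxx.
      by split => [i j|i]; rewrite ?(ord1 i) ?(ord1 j)// updE eqxx.
    rewrite mulr1 /tail gt_max.
    by case: (c < t); case: (0 < t); rewrite ?mul1r ?mul0r.
  apply: eq_integral => a _; apply: eq_integral => b _; congr (_%:E).
  rewrite /mx_fun big_ord1; congr tail.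
  have := trace_Am (upd R (J 1) (upd R (J 1) (fun=> 0) (p0, false) a) (p0, true) b).
  rewrite /psum big_ord1 expr1 => ->.
  rewrite -big_enum/=.
  rewrite (perm_big [:: (p0, false); (p0, true)])/=; last first.
    apply: uniq_perm; rewrite ?enum_uniq// => -[p d].
    by rewrite mem_enum !inE (p0E p) !xpair_eqE eqxx; case: d.
  by rewrite big_cons big_seq1 !updE !xpair_eqE !eqxx.
rewrite integral_tail// -EFinM; congr (_%:E).
(* [Cst R 1] is [pi]. *)
rewrite /Cst big_geq// (bin_small (isT : (1 < 2)%N)) binn expr1 expr0; field.
by rewrite gt_eqF.
Qed.

End Radial.

(** * Joint measurability in the matrix and x *)

Section Parametric.
Variable R : realType.

Lemma truncn_approx_cvg (x : R) : 0 <= x ->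
  ((Num.truncn (n.+1%:R * x))%:R / n.+1%:R : R) @[n --> \oo] --> x.
Proof.
move=> x0; apply: (@squeeze_cvgr _ _ _ _ (fun n => x - n.+1%:R^-1) (fun=> x)).
- apply: nearW => n; have n0 : (0 : R) < n.+1%:R by [].
  have /truncn_itv/andP[h1 h2] : 0 <= n.+1%:R * x by rewrite mulr_ge0.
  rewrite ler_pdivlMr// ler_pdivrMr// mulrBl mulVf ?gt_eqF// mulrC h1 andbT.
  by rewrite lerBlDr natr1 mulrC ltW// mulrC.
- rewrite -[X in _ --> X]subr0; apply: cvgB; first exact: cvg_cst.
  exact: cvg_harmonic.
- exact: cvg_cst.
Qed.

(* A Caratheodory function composed with a measurable parameter is measurable:
   round the parameter to multiples of [1 / (n + 1)]. *)
Lemma measurable_fun_param d (X : measurableType d) (h : R -> X -> R) (rho : X -> R) :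
  (forall r, measurable_fun setT (h r)) -> (forall x, continuous (h ^~ x)) ->
  measurable_fun setT rho -> (forall x, 0 <= rho x) ->
  measurable_fun setT (fun x => h (rho x) x).
Proof.
move=> mh ch mrho rho0.
pose N n x := Num.truncn (n.+1%:R * rho x).
apply/measurable_EFinP.
apply: (@emeasurable_fun_cvg _ _ _ setT (fun n x => (h ((N n x)%:R / n.+1%:R) x)%:E)); last first.
  move=> x _; apply: cvg_EFin; first exact: nearW.
  apply: (cvg_comp (fun n => (N n x)%:R / n.+1%:R) (h ^~ x) (G := nbhs (rho x))).
    exact: truncn_approx_cvg.
  exact: ch.
(* On each piece of this countable partition the rounded parameter is constant. *)
move=> n; apply/measurable_EFinP; pose E k := [set x | N n x = k].
have -> : [set: X] = \bigcup_k E k.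
  by apply/seteqP; split => // x _; exists (N n x).
have mE k : measurable (E k).
  have mr : measurable_fun setT (fun x => n.+1%:R * rho x) by exact: measurable_funM.
  have := mr measurableT _ (measurable_itv `[(k%:R : R), k.+1%:R[%R); rewrite setTI.
  congr measurable; apply/seteqP; split => x; rewrite /E /N /= in_itv /=.
    exact: truncn_def.
  by move=> <-; apply: truncn_itv; rewrite mulr_ge0.
apply/measurable_fun_bigcup => // k.
apply: (@eq_measurable_fun _ _ _ _ _ (h (k%:R / n.+1%:R))); last exact: measurable_funTS.
by move=> x /set_mem; rewrite /E /= => ->.
Qed.

End Parametric.

Section JointMeasurability.
Variables (R : realType) (m : nat).
Local Notation X := (cfg R (coord_index m)).

Lemma continuous_tent (z t : R) : continuous (fun r => tent r z t).
Proof.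
have -> : (fun r => tent r z t) = fun r => (2 * t - r + `|2 * t - r|) / 2
    + z * ((`|2 * t - r| - (2 * t - r)) / 2).
  apply/funext => r; rewrite /tent; case: ltP => rt.
    by rewrite ger0_norm ?subr_ge0 1?ltW//; lra.
  by rewrite ler0_norm ?subr_le0//; field.
move=> r.
have c1 : 2 * t - x @[x --> r] --> 2 * t - r.
  by apply: cvgB; [exact: cvg_cst|exact: cvg_id].
have c2 : `|2 * t - x| @[x --> r] --> `|2 * t - r| by exact: cvg_norm.
apply: cvgD; first by apply: cvgMl; exact: cvgD.
by apply: cvgMr; apply: cvgMl; exact: cvgB.
Qed.

(** [spec] is not known to be measurable. For fixed [r] the products of tents are measurable as part
    of the spectral law, and they are continuous in [r], so [measurable_fun_param] applies to each
    term of [sign_count_tent]. *)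
Lemma measurable_sign_count (k : nat) (rho : X -> R) : (k <= m)%N ->
  measurable_fun setT rho -> (forall G, 0 <= rho G) ->
  measurable_fun [set: X] (fun G => sign_count (rho G) k (spec (fun c => G (inl c)))).
Proof.
move=> km mrho rho0; have [c hc] := sign_count_tent R km.
rewrite (_ : (fun G => _) = fun G => \sum_z c z *
    \prod_i (tent (rho G) (z : nat)%:R (spec (fun c => G (inl c)) i) *
      expR (- (1 * spec (fun c => G (inl c)) i)))); last first.
  by apply/funext => G; rewrite hc.
apply: measurable_sum => z; apply: measurable_funM => //.
have mI : measurable_fun [set: X] ((fun G c => G (inl c)) : X -> cfg R (J m)).
  by apply: measurable_to_cfg => i; exact: measurable_coord.
apply: (@measurable_fun_param _ _ X (fun r G => \prod_i (tent r (z : nat)%:R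
    (spec (fun c => G (inl c)) i) * expR (- (1 * spec (fun c => G (inl c)) i))))) => //.
- move=> r; have [iA _ _] := @spectral_fun_tent R m r (z : nat)%:R 1 (ler0n _ _) ltr01.
  have /measurable_EFinP mA := measurable_int _ iA.
  exact: (measurableT_comp mA mI).
- move=> G r; apply: (@cvg_bigprod R _ _ _ _ _ (fun r i => tent r (z : nat)%:R
    (spec (fun c => G (inl c)) i) * expR (- (1 * spec (fun c => G (inl c)) i)))) => i.
  by apply: cvgMl; exact: continuous_tent.
Qed.

End JointMeasurability.

(** * The density in terms of the spectrum *)

Section DensityReduction.
Variables (R : realType) (m : nat).
Local Notation rc := (real_complex R).
Local Notation cRe := (@complex.Re R).

Definition xnorm2 (G : coord_index m -> R) : R := G (inr false) ^+ 2 + G (inr true) ^+ 2.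
Definition mxpart (G : coord_index m -> R) : J m -> R := fun c => G (inl c).

Lemma symH_mxpart (G : coord_index m -> R) : symH R m G = Hm (mxpart G).
Proof.
have E i j b : sym_coord R m G i j b = sym_coord R m (ext (mxpart G)) i j b.
  by rewrite /sym_coord; case: insub.
by apply/matrixP => i j; rewrite [LHS]mxE [RHS]mxE !E.
Qed.

Lemma xcoord_norm2 (G : coord_index m -> R) : `|xcoord R m G| ^+ 2 = rc (xnorm2 G).
Proof.
rewrite sqr_normc /xcoord /xnorm2 /=.
by apply/eqP; rewrite eq_complex /=; apply/andP; split; apply/eqP; ring.
Qed.

Lemma MxE (G : coord_index m -> R) :
  Mx R m G = 2%:R *: Am (mxpart G) - (rc (xnorm2 G))%:M.
Proof. by rewrite /Mx xcoord_norm2 symH_mxpart. Qed.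

Lemma Re_norm_real (x : R) : cRe `|rc x| = `|x|.
Proof. by rewrite normc_def /= expr0n /= addr0 sqrtr_sqr. Qed.

Lemma density_sign_count (k : nat) (G : coord_index m -> R) :
  (if `[< Sset R m k G >] then
    (complex.Re `|\det (Mx R m G)| *
      expR (- complex.Re (\tr (symH R m G *m adjmx R m (symH R m G)))
            - complex.Re (`|xcoord R m G| ^+ 2)))%:E else 0%E) =
  (sign_count (xnorm2 G) k (spec (mxpart G)) * expR (- xnorm2 G))%:E.
Proof.
have -> : `[< Sset R m k G >] = (#|[pred i | 2 * spec (mxpart G) i < xnorm2 G]| == k).
  apply/asboolP/eqP; rewrite /Sset /= MxE; first by move/num_neg_eigE.
  by move=> h; apply/num_neg_eigE.
rewrite MxE det_affine Re_norm_real xcoord_norm2 symH_mxpart /=.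
have -> : \tr (Hm (mxpart G) *m adjmx R m (Hm (mxpart G))) = rc (\sum_i spec (mxpart G) i).
  have := trk_spec 1 (mxpart G); rewrite /trk /psum expr1.
  by under eq_bigr do rewrite expr1.
rewrite /sign_count /= expRD; case: eqP => _; last by rewrite !mul0r.
by rewrite mul1r mulrA.
Qed.

End DensityReduction.

(** * The weight on decreasing vectors *)

Section OrderedWeight.
Variables (R : realType) (m : nat).

Lemma card_ord_ge p : (p <= m)%N -> #|[pred i : 'I_m | (p <= i)%N]| = (m - p)%N.
Proof.
move=> pm; have : #|[pred i : 'I_m | (i < p)%N]| = p.
  transitivity (\sum_(i < p) 1)%N; last by rewrite sum1_card card_ord.
  by rewrite (big_ord_widen m (fun=> 1%N) pm) -sum1_card; apply: eq_bigl.
move=> cp; have := cardC [pred i : 'I_m | (i < p)%N]; rewrite card_ord cp => cm.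
apply: (@addnI p); rewrite subnKC//; apply: etrans cm; congr addn.
by apply: eq_card => i; rewrite !inE leqNgt.
Qed.

Definition decr (x : 'I_m -> R) : bool :=
  [forall p : 'I_m * 'I_m, (p.1 < p.2)%N ==> (x p.2 < x p.1)].

Lemma decrP (x : 'I_m -> R) :
  reflect (forall i j : 'I_m, (i < j)%N -> x j < x i) (decr x).
Proof.
apply: (iffP forallP) => [h i j ij|h [i j]]; first by have /implyP := h (i, j); exact.
by apply/implyP; exact: h.
Qed.

Lemma decr_le (x : 'I_m -> R) (i j : 'I_m) : decr x -> (i <= j)%N -> x j <= x i.
Proof.
move=> /decrP h; rewrite leq_eqVlt => /orP[/eqP/val_inj -> //|/h]; exact: ltW.
Qed.

(** The negative entries of a decreasing vector form a final segment, so their number determines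
    where the sign changes. *)
Lemma decr_neg_count (k : nat) (x : 'I_m -> R) : (k <= m)%N -> decr x ->
  (forall i, x i != 0) ->
  (#|[pred i | x i < 0]| == k) =
  [forall i : 'I_m, if (i < m - k)%N then 0 < x i else x i < 0].
Proof.
move=> km dx nx; have pE (i : 'I_m) : (0 < x i) = ~~ (x i < 0).
  by rewrite -leNgt lt_neqAle eq_sym nx.
apply/eqP/forallP => [ck i|h]; last first.
  rewrite -[RHS](subKn km) -card_ord_ge ?leq_subr//; apply: eq_card => i.
  rewrite !inE; have := h i; case: ltnP => // im.
  by rewrite pE => /negPf.
case: ltnP => im; last apply/negPn; rewrite ?pE; apply/negP.
  move=> xi; suff: (#|[pred j : 'I_m | (i <= j)%N]| <= k)%N.
    by rewrite card_ord_ge ?(ltnW (ltn_ord i))//; lia.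
  rewrite -ck; apply: subset_leq_card; apply/fintype.subsetP => j; rewrite !inE => ij.
  exact: le_lt_trans (decr_le dx ij) xi.
rewrite -pE => xi; suff: (k <= #|[pred j : 'I_m | (i.+1 <= j)%N]|)%N.
  by rewrite card_ord_ge ?ltn_ord//; have := ltn_ord i; lia.
rewrite -ck; apply: subset_leq_card; apply/fintype.subsetP => j; rewrite !inE => xj.
rewrite ltnNge; apply/negP => ji.
by have := lt_le_trans xi (decr_le dx ji); rewrite pE xj.
Qed.

Definition oweight (k : nat) (x : 'I_m -> R) : R :=
  (decr x)%:R * (#|[pred i | x i < 0]| == k)%:R * `|\prod_i x i| * vdm x *
  expR (- \sum_i x i).

Lemma oweight_neq0 k x : oweight k x != 0 ->
  [/\ decr x, #|[pred i | x i < 0]| = k & forall i, x i != 0].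
Proof.
rewrite /oweight; case: (decr x); last by rewrite !mul0r eqxx.
case: (#|_| =P k) => ck; last by rewrite mulr0 !mul0r eqxx.
rewrite !mul1r => h; split => // i; apply: contraNneq h => xi.
by rewrite (bigD1 i)//= xi !(mul0r, normr0).
Qed.

Lemma oweight_ge0 k x : 0 <= oweight k x.
Proof.
rewrite /oweight; case: (boolP (decr x)) => [/decrP dx|_]; last by rewrite !mul0r.
rewrite !mulr_ge0 ?expR_ge0// vdmE; apply: prodr_ge0 => -[i j] /= ij.
by rewrite subr_ge0 ltW// dx.
Qed.

Lemma measurable_oweight k : measurable_fun [set: cfg R 'I_m] (oweight k).
Proof.
apply: measurable_funM; last first.
  apply: measurableT_comp => //; apply: measurable_funN; apply: measurable_sum => i.
  exact: measurable_coord.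
apply: measurable_funM; last exact: pgrow_measurable (pgrow_vdm _ _).
apply: measurable_funM; last first.
  apply: measurableT_comp => //; apply: measurable_prod => i _; exact: measurable_coord.
apply: measurable_funM.
  apply: measurable_forall_natr => -[i j] /=.
  case: (i < j)%N => //=; apply: measurable_fun_ltr; exact: measurable_coord.
apply: measurable_bool_natr.
have E (x : 'I_m -> R) : (#|[pred i | x i < 0]| == k) = (\sum_i (x i < 0)%R%:R == k%:R :> R).
  rewrite -natr_sum eqr_nat; congr (_ == k).
  by rewrite -sum1_card big_mkcond /=; apply: eq_bigr => i _; rewrite inE; case: ifP.
rewrite (_ : (fun _ => _) = fun x : cfg R 'I_m => \sum_i (x i < 0)%R%:R == k%:R :> R); last by apply/funext => x; exact: E.
apply: measurable_fun_eqr => //; apply: measurable_sum => i.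
by apply: measurable_bool_natr; apply: measurable_fun_ltr => //; exact: measurable_coord.
Qed.

End OrderedWeight.

Section Assembly.
Variables (R : realType) (m : nat).
Hypothesis m0 : (0 < m)%N.
Local Notation s := ((m + 2)%:R / 2 : R).
Local Notation low x := (lam_at R m x m.-1).

Let last_ord : 'I_m := Ordinal (ltac:(by rewrite ltn_predL) : (m.-1 < m)%N).

Lemma lam_at_last (x : 'I_m -> R) : low x = x last_ord.
Proof.
rewrite /lam_at; case: insubP => [i _ iE|]; first by congr x; apply: val_inj.
by rewrite ltn_predL m0.
Qed.

Lemma cham_shift (x : 'I_m -> R) (c : R) :
  cham (fun i => x i + c) = decr x && (0 < low x + c).
Proof.
rewrite lam_at_last; apply/chamP/andP => [[h1 h2]|[dx l0]].
  split; last exact: h2.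
  by apply/decrP => i j ij; have := h1 i j ij; rewrite ltrD2r.
split => [i j ij|i]; first by rewrite ltrD2r; exact: (decrP _ dx).
apply: lt_le_trans l0 _; rewrite lerD2r; apply: decr_le => //=.
by rewrite -ltnS prednK.
Qed.

(** With [y = x + r / 2], each factor [2 y_i - r] is [2 x_i], hence [2 ^ m]. The exponential of
    [- sum y_i] contributes the rate [m / 2] in [r] and the weight [expR (- r)] the rate 1, hence
    [(m + 2) / 2]. Positivity of the last coordinate becomes [- 2 * low x < r]. *)
Lemma shifted_weight (k : nat) (r : R) (x : 'I_m -> R) :
  chi (fun i => x i + r / 2) * vdm (fun i => x i + r / 2) *
  sign_count r k (fun i => x i + r / 2) * expR (- r) =
  2 ^+ m * oweight k x * tail s (- (2 * low x)) r.
Proof.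
have -> : vdm (fun i => x i + r / 2) = vdm x.
  by rewrite !vdmE; apply: eq_bigr => p _; ring.
have -> : sign_count r k (fun i => x i + r / 2) =
    (#|[pred i | x i < 0]| == k)%:R * (2 ^+ m * `|\prod_i x i|) *
    expR (- \sum_i x i - m%:R * (r / 2)).
  rewrite /sign_count; congr (_ * _ * _).
  - congr ((_ == k)%:R); apply: eq_card => i; rewrite !inE; lra.
  - rewrite (eq_bigr (fun i => 2 * x i)); last by move=> i _; field.
    rewrite big_split /= prodr_const card_ord normrM.
    by rewrite (ger0_norm (exprn_ge0 m (ler0n R 2))).
  - by congr expR; rewrite big_split /= sumr_const card_ord -(mulr_natl (r / 2)) opprD.
rewrite /chi cham_shift /oweight /tail; case: (decr x) => /=; last by rewrite !(mul0r, mulr0).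
have -> : (- (2 * low x) < r) = (0 < low x + r / 2) by lra.
case: ifP => _; last by rewrite !(mul0r, mulr0).
rewrite !mul1r (_ : - (s * r) = - (m%:R * (r / 2)) - r); last by rewrite natrD; field.
by rewrite !expRD; ring.
Qed.

(** For [k > 0] the last coordinate is negative, the maximum is [- 2 * low x], and twice the rate is
    [m + 2]. For [k = 0] all coordinates are positive and the maximum is 0. *)
Lemma oweight_tail (k q : nat) (x : 'I_m -> R) : (k <= m)%N -> (k == 0)%N = ~~ (m < q)%N ->
  oweight k x * expR (- (s * Num.max (- (2 * low x)) 0)) = oweight k x * Fq R m q x.
Proof.
move=> km kq; have [->|/oweight_neq0[dx ck nx]] := eqVneq (oweight k x) 0.
  by rewrite !mul0r.
congr (_ * _); rewrite /Fq; move: kq; case: ltnP => mq /= kq.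
  have l0 : low x < 0.
    have /eqP := ck; rewrite decr_neg_count// => /forallP/(_ last_ord).
    rewrite lam_at_last ifF//=; apply/negbTE; rewrite -leqNgt.
    by move: kq m0; lia.
  rewrite max_l; last by lra.
  by congr expR; field.
have l0 : 0 < low x.
  have /eqP := ck; rewrite decr_neg_count// => /forallP/(_ last_ord).
  rewrite lam_at_last ifT//=.
  by move: kq m0; lia.
by rewrite max_r ?mulr0 ?oppr0 ?expR0//; lra.
Qed.

Lemma oweight_Yset (k : nat) (x : 'I_m -> R) (c : R) : (k <= m)%N ->
  (if `[< Yset R m (m - k) x >] then
    (`|\prod_(j < m) x j| * vandermonde R m x * expR (- \sum_(j < m) x j) * c)%:E
   else 0%E) = (oweight k x * c)%:E.
Proof.
(* A zero coordinate makes both sides vanish, so the strict signs of [Yset] can be compared with the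
   count of negative entries. *)
move=> km; case: (pickP (fun i => x i == 0)) => [i /eqP xi|nx].
  rewrite /oweight (bigD1 i)//= xi mul0r normr0 !(mul0r, mulr0).
  by case: ifP.
have nx' i : x i != 0 by rewrite nx.
rewrite /oweight; have -> : `[< Yset R m (m - k) x >] = decr x && (#|[pred i | x i < 0]| == k).
  apply/asboolP/andP => [[h1 [h2 h3]]|[dx]].
    have dx : decr x by apply/decrP.
    split => //; rewrite decr_neg_count//; apply/forallP => i.
    by case: ltnP; [exact: h2|exact: h3].
  rewrite decr_neg_count// => /forallP h; split; first exact/decrP.
  by split => i im; have := h i; [rewrite im|rewrite ltnNge im].
case: (decr x) => /=; last by rewrite !mul0r.
by case: (_ == k) => /=; rewrite ?mul1r ?(mul0r, mulr0) // !mul1r.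
Qed.

End Assembly.

Section SplitX.
Variables (R : realType) (m : nat).
Local Notation leb := (@lebesgue_measure R).

Definition join_x (g : J m -> R) (a b : R) : coord_index m -> R :=
  fun c => match c with inl j => g j | inr d => if d then b else a end.

Lemma leb_int_split (f : (coord_index m -> R) -> \bar R) :
  measurable_fun [set: cfg R (coord_index m)] f -> (forall G, 0 <= f G)%E ->
  leb_int R (coord_index m) f =
  (\int[leb]_a \int[leb]_b leb_int R (J m) (fun g => f (join_x g a b)))%E.
Proof.
move=> mf f0; pose e : seq (coord_index m) := map inl (enum {: J m}).
have ne d : inr d \notin e by apply/mapP => -[].
have pe : perm_eq (enum {: coord_index m}) (inr false :: inr true :: e).
  apply: uniq_perm; first exact: enum_uniq.
    by rewrite /= inE /= !ne map_inj_uniq ?enum_uniq// => ? ? [].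
  move=> [j|d]; rewrite mem_enum !inE /=; last by case: d.
  by rewrite map_f// mem_enum.
rewrite /leb_int (iint_perm _ mf f0 (enum_uniq _) pe).
move=> /=; apply: eq_integral => a _; apply: eq_integral => b _.
rewrite iint_upd// iint_upd//.
apply: (@iint_map _ _ _ inl) => [? ? []//|G].
congr f; apply/funext => -[j|[]]; by rewrite !updE.
Qed.

End SplitX.

Section Swap.
Variables (R : realType) (I : finType).
Local Notation leb := (@lebesgue_measure R).

(** Tonelli brings the two integrals over the real and imaginary parts of [x] inside, where
    [iint_radial] evaluates them for each fixed vector. *)
Lemma leb_int_swap2 (w c : (I -> R) -> R) (s : R) : 0 < s ->
  measurable_fun [set: cfg R I] w -> measurable_fun [set: cfg R I] c ->
  (forall x, 0 <= w x) ->
  (\int[leb]_a \int[leb]_b leb_int R I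
     (fun x => (w x * tail s (c x) (a ^+ 2 + b ^+ 2))%:E))%E =
  leb_int R I (fun x => (w x * (pi / s * expR (- (s * Num.max (c x) 0))))%:E).
Proof.
move=> s0 mw mc w0.
pose h (p : (measurableTypeR R * cfg R I) * measurableTypeR R) : \bar R :=
  (w p.1.2 * tail s (c p.1.2) (p.1.1 ^+ 2 + p.2 ^+ 2))%:E.
have h0 p : (0 <= h p)%E by rewrite lee_fin mulr_ge0// tail_ge0.
have mx : measurable_fun setT
    (fun p : (measurableTypeR R * cfg R I) * measurableTypeR R => p.1.2).
  exact: (measurableT_comp measurable_snd measurable_fst).
have mr : measurable_fun setT
    (fun p : (measurableTypeR R * cfg R I) * measurableTypeR R =>
      (p.1.1 ^+ 2 + p.2 ^+ 2 : R)).
  apply: measurable_funD; apply: measurable_funX.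
    exact: (measurableT_comp measurable_fst measurable_fst).
  exact: measurable_snd.
have mh : measurable_fun setT h.
  apply/measurable_EFinP; apply: measurable_funM.
    exact: (measurableT_comp mw mx).
  rewrite /tail; apply: measurable_fun_ifT => //.
    by apply: measurable_fun_ltr => //; exact: (measurableT_comp mc mx).
  apply: measurableT_comp => //; apply: measurable_funN; exact: measurable_funM.
transitivity (\int[leb]_a leb_int R I (fun x => \int[leb]_b h ((a, x), b)))%E.
  apply: eq_integral => a _; rewrite /leb_int.
  apply: (@iint_tonelli R _ (measurableTypeR R) leb I (enum I)
    (fun b x => h ((a, x), b))) => //.
  pose k (p : measurableTypeR R * cfg R I) := ((a : measurableTypeR R, p.2), p.1).
  suff mk : measurable_fun setT k by exact: (measurableT_comp mh mk).
  apply/measurable_fun_pairP; split; last exact: measurable_fst.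
  by apply/measurable_fun_pairP; split; [exact: measurable_cst|exact: measurable_snd].
rewrite /leb_int (@iint_tonelli R _ (measurableTypeR R) leb I (enum I)
  (fun a x => \int[leb]_b h ((a, x), b))%E)//; last 2 first.
- exact: (measurable_fun_fubini_tonelli_F (m2 := leb) h mh h0).
- by move=> a x; apply: integral_ge0.
apply: eq_iint => x /=; rewrite EFinM -iint_radial//.
have mab : measurable_fun setT (fun p : measurableTypeR R * measurableTypeR R =>
    (tail s (c x) (p.1 ^+ 2 + p.2 ^+ 2))%:E).
  apply/measurable_EFinP; apply: (measurableT_comp (@measurable_tail R s (c x))).
  by apply: measurable_funD; apply: measurable_funX;
    [exact: measurable_fst|exact: measurable_snd].
rewrite -ge0_integralZl_EFin//; last 2 first.
- by move=> a _; apply: integral_ge0 => b _; rewrite lee_fin tail_ge0.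
- apply: (measurable_fun_fubini_tonelli_F (m2 := leb) _ mab) => p.
  by rewrite lee_fin tail_ge0.
apply: eq_integral => a _; rewrite /h /= -ge0_integralZl_EFin//.
- by move=> b _; rewrite lee_fin tail_ge0.
- apply/measurable_EFinP; apply: (measurableT_comp (@measurable_tail R s (c x))).
  by apply: measurable_funD => //; exact: measurable_funX.
Qed.

End Swap.

(** * Assembly of the formula *)

Section Main.
Variable R : realType.

(** The matrix integral for a fixed value [r] of [|x| ^ 2]: the spectral law, followed by the
    translation of the chamber by [r / 2]. *)
Lemma sign_count_fiber (m k : nat) (r : R) : (0 < m)%N -> (k <= m)%N ->
  leb_int R (J m) (fun g => (sign_count r k (spec g) * expR (- r))%:E) =
  ((Cst R m)%:E * leb_int R 'I_m (fun x => (2 ^+ m * oweight k x *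
     tail ((m + 2)%:R / 2) (- (2 * lam_at R m x m.-1)) r)%:E))%E.
Proof.
move=> m0 km; have [iA iB eAB] := sign_count_mean r km.
have mA := measurable_int _ iA; have mB := measurable_int _ iB.
have sc0 y : 0 <= sign_count r k y :> R by rewrite /sign_count !mulr_ge0// expR_ge0.
have cv0 (x : 'I_m -> R) : 0 <= chi x * vdm x.
  by rewrite /chi; case: (boolP (cham x)) => cx; rewrite ?mul0r// mul1r ltW// vdm_gt0.
have B0 (x : 'I_m -> R) : (0 <= (chi x * vdm x * sign_count r k x)%:E)%E.
  by rewrite lee_fin mulr_ge0.
have A0 (g : J m -> R) : (0 <= (sign_count r k (spec g))%:E)%E by rewrite lee_fin.
move: eAB; rewrite !ge0_integral_nu// => eAB.
transitivity ((expR (- r))%:E * leb_int R (J m) (fun g => (sign_count r k (spec g))%:E))%E.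
  rewrite /leb_int -iintZl ?expR_ge0//.
  by apply: eq_iint => g; rewrite mulrC.
rewrite eAB muleCA -(leb_int_shift (r / 2))//; congr (_ * _)%E.
rewrite /leb_int -iintZl ?expR_ge0//; last exact: (measurableT_comp mB (measurable_shift _)).
by apply: eq_iint => x; rewrite -EFinM -shifted_weight// mulrC.
Qed.

(** [Cst] comes from the spectral law, [2 ^ m] from [shifted_weight] and [pi / ((m + 2) / 2)] from
    the integral over [x]. Of the [pi] powers, ['C(m + 2, 2) = 'C(m.+1, 2) + m + 1] leaves
    [pi ^- m]. *)
Lemma leading_constant (m : nat) : (0 < m)%N ->
  pi ^- 'C(m + 2, 2) * (Cst R m * 2 ^+ m * (pi / ((m + 2)%:R / 2))) =
  2 ^+ ((m ^ 2 + m + 2) %/ 2) /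
    (pi ^+ m * (m + 2)%:R * \prod_(1 <= j < m) (j`!)%:R).
Proof.
move=> m0; have -> : ((m ^ 2 + m + 2) %/ 2 = 'C(m, 2) + m + 1)%N.
  rewrite bin2 -divn2; case: m m0 => // n _.
  have -> : (n.+1 ^ 2 + n.+1 + 2 = n.+1 * n + (n.+1 + 1) * 2)%N by rewrite expnS expn1; lia.
  by rewrite addnC divnMDl//= addnC addnA.
have -> : 'C(m + 2, 2) = ('C(m.+1, 2) + (m + 1))%N by rewrite addn2 binS bin1 addn1.
rewrite /Cst !exprD expr1.
have d0 : (m + 2)%:R != 0 :> R by rewrite pnatr_eq0 addn2.
have p0 : pi != 0 :> R by rewrite gt_eqF// pi_gt0.
move: (prod_fact_neq0 R m) d0; move: (\prod_(_ <= _ < _) _) (_%:R) => u d u0 d0.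
move: pi 'C(m.+1, 2) 'C(m, 2) p0 => p b1 b2 p0.
by field; rewrite u0 d0 p0 !expf_neq0.
Qed.

End Main.

Theorem theorem1p5 (R : realType) (m q : nat)
  (hm : (1 <= m)%N) (hq1 : (m <= q)%N) (hq2 : (q <= 2 * m)%N) :
  b0q R m q =
  ((2 ^+ ((m ^ 2 + m + 2) %/ 2) /
      (pi ^+ m * (m + 2)%:R * \prod_(1 <= j < m) (j`!)%:R))%:E *
   leb_int_on R _ (Yset R m (2 * m - q))
     (fun lam : 'I_m -> R =>
        (`|\prod_(j < m) lam j| * vandermonde R m lam *
        expR (- \sum_(j < m) lam j) * Fq R m q lam)%R))%E.
Proof.
pose k := (q - m)%N; have km : (k <= m)%N by rewrite /k; lia.
have kq : (k == 0)%N = ~~ (m < q)%N by rewrite subn_eq0 leqNgt.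
have s0 : 0 < (m + 2)%:R / 2 :> R by rewrite divr_gt0// ltr0n addn2.
have c0 : 0 <= Cst R m.
  rewrite /Cst divr_ge0 ?mulr_ge0 ?exprn_ge0 ?pi_ge0//; exact: prodr_ge0.
have c20 : 0 <= Cst R m * 2 ^+ m by rewrite mulr_ge0// exprn_ge0.
have mw := @measurable_oweight R m k; have w0 := @oweight_ge0 R m k.
have mlow : measurable_fun [set: cfg R 'I_m] (fun x => - (2 * lam_at R m x m.-1)).
  rewrite (_ : (fun _ => _) = fun x => - (2 * x (Ordinal (ltac:(by rewrite ltn_predL) : (m.-1 < m)%N)))).
    by apply: measurable_funN; apply: measurable_funM => //; exact: measurable_coord.
  by apply/funext => x; rewrite lam_at_last.
pose f (G : coord_index m -> R) := (sign_count (xnorm2 G) k (spec (mxpart G)) * expR (- xnorm2 G))%:E.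
have mxn : measurable_fun [set: cfg R (coord_index m)] (@xnorm2 R m).
  by apply: measurable_funD; apply: measurable_funX; exact: measurable_coord.
have xn0 G : 0 <= @xnorm2 R m G by rewrite addr_ge0// sqr_ge0.
have f0 G : (0 <= f G)%E.
  by rewrite lee_fin mulr_ge0 ?expR_ge0// /sign_count !mulr_ge0// expR_ge0.
have mf : measurable_fun [set: cfg R (coord_index m)] f.
  apply/measurable_EFinP; apply: measurable_funM; first exact: measurable_sign_count.
  by apply: measurableT_comp => //; exact: measurable_funN.
rewrite /b0q /leb_int_on (_ : (fun g => _) = f); last first.
  by apply/funext => G; exact: density_sign_count.
rewrite leb_int_split//.
(* For each fixed [x = a + i b] the matrix integral is replaced by an integral over decreasing
   vectors, with [r = a ^ 2 + b ^ 2]. *)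
transitivity ((pi ^- 'C(m + 2, 2))%:E * (\int[@lebesgue_measure R]_a \int[@lebesgue_measure R]_b leb_int R 'I_m
    (fun x => (Cst R m * 2 ^+ m * oweight k x *
      tail ((m + 2)%:R / 2) (- (2 * lam_at R m x m.-1)) (a ^+ 2 + b ^+ 2))%:E)))%E.
  congr (_ * _)%E; apply: eq_integral => a _; apply: eq_integral => b _.
  transitivity (leb_int R (J m) (fun g => (sign_count (a ^+ 2 + b ^+ 2) k (spec g) *
      expR (- (a ^+ 2 + b ^+ 2)))%:E)); first exact: eq_iint.
  rewrite sign_count_fiber// /leb_int -iintZl//.
  - by apply: eq_iint => x; rewrite -EFinM !mulrA.
  - apply/measurable_EFinP; apply: measurable_funM; first exact: measurable_funM.
    rewrite /tail; apply: measurable_fun_ifT => //.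
    exact: measurable_fun_ltr.
  - move=> x; rewrite lee_fin; apply: mulr_ge0; last exact: tail_ge0.
    by apply: mulr_ge0 => //; exact: exprn_ge0.
(* Now [x] is integrated out for each fixed vector; what it leaves is [Fq], by [oweight_tail]. *)
rewrite (leb_int_swap2 s0 (w := fun x => Cst R m * 2 ^+ m * oweight k x))//; last 2 first.
- exact: measurable_funM.
- by move=> x; rewrite mulr_ge0.
have mF : measurable_fun [set: cfg R 'I_m] (Fq R m q).
  rewrite /Fq; case: (m < q)%N => //; apply: measurableT_comp => //.
  apply: measurable_funM => //.
  rewrite (_ : (fun _ => _) = fun x => - (- (2 * lam_at R m x m.-1)) / 2); last first.
    by apply/funext => x; field.
  by apply: measurable_funM => //; exact: measurable_funN.
have F0 x : 0 <= Fq R m q x by rewrite /Fq; case: ifP => // _; exact: expR_ge0.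
have cE x : (if `[< Yset R m (2 * m - q) x >] then
    (`|\prod_(j < m) x j| * vandermonde R m x * expR (- \sum_(j < m) x j) * Fq R m q x)%:E
   else 0%E) = (oweight k x * Fq R m q x)%:E.
  by rewrite -oweight_Yset// (_ : (2 * m - q = m - k)%N)//; rewrite /k; lia.
rewrite [in RHS](_ : (fun g => _) = fun x => (oweight k x * Fq R m q x)%:E); last exact/funext.
have mwF : measurable_fun [set: cfg R 'I_m] (fun x => (oweight k x * Fq R m q x)%:E).
  by apply/measurable_EFinP; exact: measurable_funM.
have wF0 x : (0 <= (oweight k x * Fq R m q x)%:E)%E by rewrite lee_fin mulr_ge0.
rewrite -leading_constant// EFinM -muleA; congr (_ * _)%E.
have p0 : 0 <= pi / ((m + 2)%:R / 2) :> R by rewrite divr_ge0 ?pi_ge0 ?ltW.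
rewrite /leb_int -iintZl//; last exact: mulr_ge0.
apply: eq_iint => x.
rewrite -EFinM; congr (_%:E); rewrite -(oweight_tail _ _ km kq)//; ring.
Qed.
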